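(* Let $X$ be an $n$-dimensional complex manifold, $\mathcal F$ a coherent sheaf of ideals of $\mathcal O_X$, and $p$ a point of the support of $\mathcal O_X/\mathcal F$. Let $f_1,\dots,f_d$ be a set of local generators of $\mathcal F$ on a Stein open neighborhood $U$ of $p$, and let $\iota:U\to U\times\mathbb C^d$, $\iota(x)=(x,f_1(x),\dots,f_d(x))$, be the associated graph embedding. Let $\mathcal M$ be a coherent left $\mathcal D_X$-module defined on $U$ and $u$ a section of $\mathcal M$ defined on a neighborhood of $p$. Then: 1. Assume that there exists the $b$-function $b(s)$ of $\iota_*(u)$ along $U\times\{0\}$ at $\iota(p)$. Then $b(s-d)$ does not depend on the choice of local generators $f_1,\dots,f_d$ of $\mathcal F$. (One calls $b(s-d)$ the $b$-function of $u$ at $p$ with respect to $\mathcal F$.) 2. The set $$B_p(u,\mathcal F):=\{b(s,x)\in(\mathcal O_X)_p[s]\mid b(s+d,x)\text{ is an indicial polynomial of }\iota_*(u)\text{ along }U\times\{0\}\text{ at }\iota(p)\}$$ depends only on $u$ and $\mathcal F$. (One calls an element of $B_p(u,\mathcal F)$ an indicial polynomial of $u$ at $p$ with respect to $\mathcal F$.) 3. If $b(s,x)\in B_p(u,\mathcal F)$ and the degree of $c(s,x)\in\mathcal F_p[s]$ in $s$ is less than that of $b(s,x)$, then $b(s,x)+c(s,x)$ also belongs to $B_p(u,\mathcal F)$.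
   Context: $\mathcal O_X$ is the sheaf of holomorphic functions on $X$ and $\mathcal D_X$ the sheaf of rings of differential operators with holomorphic coefficients. $\mathcal F_p[s]$ denotes the polynomials in $s$ with coefficients in the stalk $\mathcal F_p$. $b$-functions and indicial polynomials along a submanifold: for a complex submanifold $Y$ of a complex manifold $W$ with defining ideal $\mathcal I_Y$, set $V_Y^j(\mathcal D_W)=\{P\in\mathcal D_W|_Y\mid P\,\mathcal I_Y^i\subset\mathcal I_Y^{i-j}\ (\forall i\in\mathbb Z)\}$, with $\mathcal I_Y^i=\mathcal O_W|_Y$ for $i\le0$. Let $\theta$ be a vector field inducing the identity on $\mathcal I_Y/\mathcal I_Y^2$ (for $W=U\times\mathbb C^d$ with coordinates $(x,t)$ and $Y=U\times\{0\}$ one takes $\theta=t_1\partial_{t_1}+\dots+t_d\partial_{t_d}$), and let $y$ be local coordinates of $Y$ near $q\in Y$. For a section $v$ of a coherent left $\mathcal D_W$-module defined near $q$: the $b$-function of $v$ along $Y$ at $q$ is the monic polynomial $b(s)\in\mathbb C[s]$ of least degree, if any, such that $b(\theta)v\in V_Y^{-1}(\mathcal D_W)_qv$; an indicial polynomial of $v$ along $Y$ at $q$ is an element $b(s,y)\in(\mathcal O_Y)_q[s]$, monic in $s$ and of smallest degree in $s$ among the monic elements satisfying $b(\theta,y)v\in V_Y^{-1}(\mathcal D_W)_qv$. Here $f_i(p)=0$ for all $i$, so $\iota(p)=(p,0)$, and $U\times\{0\}$ is identified with $U$, so that indicial polynomials of $\iota_*(u)$ along $U\times\{0\}$ at $\iota(p)$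 lie in $(\mathcal O_X)_p[s]$. Direct image: with $Z=\iota(U)=\{t_i=f_i(x),\ i=1,\dots,d\}$ and $\mathcal B_{Z|U\times\mathbb C^d}=\mathcal H^d_{[Z]}(\mathcal O_{U\times\mathbb C^d})$ (algebraic local cohomology), $\iota_*(\mathcal M)=\mathcal M\otimes_{\mathcal O_X|_U}\mathcal B_{Z|U\times\mathbb C^d}$, a left $\mathcal D_{U\times\mathbb C^d}$-module, and $\iota_*(u)=u\otimes\delta(t_1-f_1)\cdots\delta(t_d-f_d)$, where $\delta(t_1-f_1)\cdots\delta(t_d-f_d)$ is the class of $\frac1{(t_1-f_1)\cdots(t_d-f_d)}$ in $\mathcal O_{U\times\mathbb C^d}[h^{-1}]/\sum_{j=1}^d\mathcal O_{U\times\mathbb C^d}[h_j^{-1}]\simeq\mathcal B_{Z|U\times\mathbb C^d}$, with $h=(t_1-f_1)\cdots(t_d-f_d)$ and $h_j=h/(t_j-f_j)$. *)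

(* Defs.v *)
From HB Require Import structures.
From mathcomp Require Import all_boot all_order all_algebra.
From mathcomp Require Import complex generic_quotient ring_quotient.
From mathcomp Require Import all_classical all_reals.
From mathcomp Require Import topology normedtype sequences derive.
Set Implicit Arguments. Unset Strict Implicit. Unset Printing Implicit Defensive.
Import Order.TTheory GRing.Theory Num.Theory.
Import numFieldNormedType.Exports.
Local Open Scope classical_set_scope.
Local Open Scope ring_scope.

(* The complex numbers, packaged as a numClosedFieldType so that the normed and
   topological structures of an abstract numFieldType apply. *)
Definition Cx (R : realType) : numClosedFieldType := R[i]%C.

Section Analytic.
Variable C : numFieldType.
Variable n : nat.
Implicit Types (c d : {ffun 'I_n -> nat} -> C) (h a : 'rV[C]_n).

Definition monomial h (alpha : {ffun 'I_n -> nat}) : C :=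
  \prod_i h 0 i ^+ alpha i.

(* The multi-indices all of whose entries are < N. *)
Definition cube N : seq {ffun 'I_n -> nat} :=
  [seq [ffun i => val (e i)] | e : {ffun 'I_n -> 'I_N}].

Definition power_sum c h N : C := \sum_(alpha <- cube N) c alpha * monomial h alpha.

Definition power_sum_norm c h N : C :=
  \sum_(alpha <- cube N) `|c alpha * monomial h alpha|.

(* f is near a the sum of an absolutely convergent power series in the n
   coordinates; `| h | is the sup norm, so `| h | < r is a polydisc.  A function
   is holomorphic on an open set when it is analytic at each of its points. *)
Definition analytic_at (f : 'rV[C]_n -> C) a :=
  exists c (r : C), 0 < r /\ forall h, `|h| < r ->
    (exists M : C, forall N, power_sum_norm c h N <= M) /\
    power_sum c h N @[N --> \oo] --> f (a + h).

Lemma mem_cube N alpha : (alpha \in cube N) = [forall i, alpha i < N]%N.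
Proof.
apply/mapP/forallP => [[e _ ->] i|H]; first by rewrite ffunE ltn_ord.
exists [ffun i => Ordinal (H i)]; first by rewrite mem_enum.
by apply/ffunP => i; rewrite !ffunE.
Qed.

Lemma cube_uniq N : uniq (cube N).
Proof.
rewrite map_inj_uniq ?enum_uniq // => e1 e2 /ffunP H.
by apply/ffunP => i; have := H i; rewrite !ffunE => /val_inj.
Qed.

Lemma cube_sub M N : (M <= N)%N -> {subset cube M <= cube N}.
Proof.
move=> MN alpha; rewrite !mem_cube => /forallP H; apply/forallP => i.
exact: leq_trans (H i) MN.
Qed.

Lemma analytic_at_cst (k : C) a : analytic_at (fun=> k) a.
Proof.
exists (fun alpha => if alpha == [ffun=> 0%N] then k else 0), 1; split => // h _.
pose F alpha := (if alpha == [ffun=> 0%N] then k else 0) * monomial h alpha.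
have F0 alpha : alpha != [ffun=> 0%N] -> F alpha = 0.
  by rewrite /F => /negbTE ->; rewrite mul0r.
have Fk : F [ffun=> 0%N] = k.
  rewrite /F eqxx /monomial big1 ?mulr1 // => i _.
  by rewrite ffunE expr0.
have z_cube N : (0 < N)%N -> [ffun=> 0%N] \in cube N.
  by move=> N0; rewrite mem_cube; apply/forallP => i; rewrite ffunE.
split.
  exists `|k| => N; rewrite /power_sum_norm -/F.
  have [zN|zN] := boolP ([ffun=> 0%N] \in cube N).
    rewrite (bigD1_seq _ zN (cube_uniq N)) /= -/(F _) Fk big1 ?addr0 // => alpha /F0.
    by rewrite -/(F alpha) => ->; rewrite normr0.
  rewrite big_seq big1 // => alpha alphaN; rewrite -/(F alpha) F0 ?normr0 //.
  by apply: contraNneq zN => <-.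
apply: (@cvg_trans _ ((fun=> k) @ \oo)); last exact: cvg_cst.
apply: near_eq_cvg; exists 1%N => // N /= N0.
rewrite /power_sum (bigD1_seq _ (z_cube _ N0) (cube_uniq N)) /= -/(F _) Fk.
by rewrite big1 ?addr0 // => alpha /F0.
Qed.

Lemma analytic_atB f g a :
  analytic_at f a -> analytic_at g a -> analytic_at (f - g) a.
Proof.
move=> [c [r [r0 Hf]]] [d [s [s0 Hg]]].
have rs : r >=< s by apply: real_comparable; exact: gtr0_real.
exists (fun alpha => c alpha - d alpha), (Order.min r s); split.
  by rewrite comparable_lt_min // r0 s0.
move=> h; rewrite comparable_lt_min // => /andP[/Hf[[M HM] cf] /Hg[[M' HM'] cg]].
split.
  exists (M + M') => N; apply: le_trans (lerD (HM N) (HM' N)).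
  rewrite /power_sum_norm -big_split /=; apply: ler_sum => alpha _.
  by rewrite mulrBl; exact: ler_normB.
have -> : (fun N => power_sum (fun alpha => c alpha - d alpha) h N) =
    (fun N => power_sum c h N - power_sum d h N).
  apply/funext => N; rewrite /power_sum -sumrB; apply: eq_bigr => alpha _.
  by rewrite mulrBl.
by apply: (@cvgB _ C^o _ _ _ _ _ _ _ cf cg).
Qed.



Definition conv c d (gamma : {ffun 'I_n -> nat}) : C :=
  \sum_(alpha <- cube (\sum_i gamma i).+1 | [forall i, alpha i <= gamma i]%N)
    c alpha * d [ffun i => (gamma i - alpha i)%N].

Lemma convE c d gamma N : gamma \in cube N ->
  conv c d gamma = \sum_(alpha <- cube N | [forall i, alpha i <= gamma i]%N)
    c alpha * d [ffun i => (gamma i - alpha i)%N].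
Proof.
move=> gN; rewrite /conv -[LHS]big_filter -[RHS]big_filter; apply: perm_big.
apply: uniq_perm; rewrite ?filter_uniq ?cube_uniq // => alpha.
rewrite !mem_filter; case: (boolP [forall i, _]) => //= /forallP le_ag.
move: gN; rewrite !mem_cube => /forallP gN.
apply/forallP/forallP => _ i; first exact: leq_ltn_trans (le_ag i) (gN i).
by rewrite ltnS (leq_trans (le_ag i)) // (bigD1 i) //= leq_addr.
Qed.

Definition addf (alpha beta : {ffun 'I_n -> nat}) := [ffun i => (alpha i + beta i)%N].

Lemma monomialD h alpha beta :
  monomial h (addf alpha beta) = monomial h alpha * monomial h beta.
Proof.
by rewrite /monomial -big_split /=; apply: eq_bigr => i _; rewrite ffunE exprD.
Qed.

Lemma power_sum_conv c d h N : power_sum (conv c d) h N =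
  \sum_(alpha <- cube N) \sum_(beta <- cube N | addf alpha beta \in cube N)
    (c alpha * monomial h alpha) * (d beta * monomial h beta).
Proof.
transitivity (\sum_(gamma <- cube N)
    \sum_(alpha <- cube N | [forall i, alpha i <= gamma i]%N)
      c alpha * d [ffun i => (gamma i - alpha i)%N] * monomial h gamma).
  rewrite /power_sum !big_seq; apply: eq_bigr => gamma gN.
  by rewrite (convE _ _ gN) mulr_suml.
rewrite (exchange_big_dep predT) //=; apply: eq_big_seq => alpha aN.
rewrite -[LHS]big_filter -[RHS]big_filter.
rewrite (perm_big [seq addf alpha beta |
    beta <- [seq beta <- cube N | addf alpha beta \in cube N]]); last first.
  have addf_inj : injective (addf alpha).
    move=> b1 b2 /ffunP H; apply/ffunP => i.
    by have := H i; rewrite !ffunE => /addnI.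
  apply: uniq_perm; rewrite ?map_inj_uniq ?filter_uniq ?cube_uniq //.
  move=> gamma; rewrite mem_filter; apply/andP/mapP.
    move=> [/forallP le_ag gN]; exists [ffun i => (gamma i - alpha i)%N].
      rewrite mem_filter; have -> : addf alpha [ffun i => (gamma i - alpha i)%N] = gamma.
        by apply/ffunP => i; rewrite !ffunE subnKC.
      rewrite gN /=; move: gN; rewrite !mem_cube => /forallP gN.
      by apply/forallP => i; rewrite ffunE (leq_ltn_trans (leq_subr _ _)).
    by apply/ffunP => i; rewrite !ffunE subnKC.
  move=> [beta]; rewrite mem_filter => /andP[abN _] ->; split => //.
  by apply/forallP => i; rewrite ffunE leq_addr.
rewrite big_map; apply: eq_bigr => beta _.
have -> : [ffun i => (addf alpha beta i - alpha i)%N] = beta.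
  by apply/ffunP => i; rewrite !ffunE addKn.
by rewrite monomialD; rewrite mulrACA.
Qed.

Definition bounded_cauchy := forall u : nat -> C,
  (forall N, 0 <= u N) -> {homo u : M N / (M <= N)%N >-> M <= N} ->
  (exists B, forall N, u N <= B) ->
  forall e, 0 < e -> exists N, forall M, (N <= M)%N -> u M - u N < e.

Lemma power_sum_norm_ge0 c h N : 0 <= power_sum_norm c h N.
Proof. by apply: sumr_ge0 => alpha _; exact: normr_ge0. Qed.

Lemma power_sum_norm_homo c h :
  {homo power_sum_norm c h : M N / (M <= N)%N >-> M <= N}.
Proof.
move=> M N MN; rewrite /power_sum_norm.
rewrite [leRHS](bigID (fun alpha => alpha \in cube M)) /=.
rewrite -[X in _ <= X + _]big_filter.
have cubeMN : perm_eq [seq alpha <- cube N | alpha \in cube M] (cube M).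
  apply: uniq_perm; rewrite ?filter_uniq ?cube_uniq // => alpha.
  by rewrite mem_filter; have [/(cube_sub MN)|] := boolP (alpha \in cube M).
by rewrite (perm_big _ cubeMN) lerDl; apply: sumr_ge0.
Qed.

Lemma power_sum_conv_near c d h M N : (M.*2 <= N)%N ->
  `|power_sum c h N * power_sum d h N - power_sum (conv c d) h N| <=
  power_sum_norm c h N * power_sum_norm d h N
    - power_sum_norm c h M * power_sum_norm d h M.
Proof.
move=> MN; set a := fun alpha => c alpha * monomial h alpha.
set b := fun beta => d beta * monomial h beta.
have MN1 : (M <= N)%N by apply: leq_trans MN; rewrite -addnn leq_addr.
have cubeD alpha beta : alpha \in cube M -> beta \in cube M ->
    addf alpha beta \in cube N.
  rewrite !mem_cube => /forallP aM /forallP bM; apply/forallP => i.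
  rewrite ffunE; apply: leq_trans MN; rewrite -addnn -addSn leq_add //.
  exact: ltnW.
have -> : power_sum c h N * power_sum d h N - power_sum (conv c d) h N =
    \sum_(alpha <- cube N) \sum_(beta <- cube N | addf alpha beta \notin cube N)
      a alpha * b beta.
  rewrite power_sum_conv {1 2}/power_sum big_distrlr /= -sumrB.
  apply: eq_bigr => alpha _.
  rewrite (bigID (fun beta => addf alpha beta \in cube N)) /=.
  by rewrite addrAC subrr add0r.
have -> : power_sum_norm c h M * power_sum_norm d h M =
    \sum_(alpha <- cube N) \sum_(beta <- cube N |
      (alpha \in cube M) && (beta \in cube M)) `|a alpha * b beta|.
  have cubeMN : perm_eq (cube M) [seq alpha <- cube N | alpha \in cube M].
    apply: uniq_perm; rewrite ?filter_uniq ?cube_uniq // => alpha.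
    by rewrite mem_filter; have [/(cube_sub MN1)|] := boolP (alpha \in cube M).
  rewrite /power_sum_norm big_distrlr /= (perm_big _ cubeMN) /= big_filter.
  rewrite big_mkcond /=; apply: eq_bigr => alpha _.
  case: ifP => aM; last by rewrite big_pred0.
  rewrite (perm_big _ cubeMN) /= big_filter.
  by apply: eq_bigr => beta _; rewrite [RHS]normrM.
rewrite {1 2}/power_sum_norm big_distrlr /= -sumrB.
apply: le_trans (ler_norm_sum _ _ _) _; apply: ler_sum => alpha _.
rewrite lerBrDr addrC.
rewrite [leRHS](bigID (fun beta => (alpha \in cube M) && (beta \in cube M))) /=.
apply: lerD; first by apply: ler_sum => beta _; rewrite [leLHS]normrM.
apply: le_trans (ler_norm_sum _ _ _) _.
rewrite [leLHS]big_mkcond [leRHS]big_mkcond /=; apply: ler_sum => beta _.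
case: ifPn => abN; last by case: ifP => // _; exact: mulr_ge0.
case: ifPn => [_|/negPn/andP[aM bM]]; first by rewrite [leLHS]normrM.
by rewrite cubeD in abN.
Qed.

Lemma analytic_atM_subproof f g a : bounded_cauchy ->
  analytic_at f a -> analytic_at g a -> analytic_at (f * g) a.
Proof.
move=> bcauchy [c [r [r0 Hf]]] [d [s [s0 Hg]]].
have rs : r >=< s by apply: real_comparable; exact: gtr0_real.
exists (conv c d), (Order.min r s); split.
  by rewrite comparable_lt_min // r0 s0.
move=> h; rewrite comparable_lt_min // => /andP[/Hf[[M HM] cf] /Hg[[M' HM'] cg]].
have bd N : power_sum_norm c h N * power_sum_norm d h N <= M * M'.
  by apply: ler_pM => //; exact: power_sum_norm_ge0.
split.
  exists (M * M') => N; apply: le_trans (bd N).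
  pose nc alpha : C := `|c alpha|; pose nd beta : C := `|d beta|.
  pose nh : 'rV[C]_n := map_mx Num.norm h.
  have nmE gamma : monomial nh gamma = `|monomial h gamma|.
    rewrite /monomial normr_prod; apply: eq_bigr => i _.
    by rewrite mxE normrX.
  apply: (@le_trans _ _ (power_sum (conv nc nd) nh N)).
    apply: ler_sum => gamma _; rewrite normrM nmE; apply: ler_wpM2r => //.
    apply: le_trans (ler_norm_sum _ _ _) _; apply: ler_sum => alpha _.
    by rewrite normrM.
  rewrite power_sum_conv /power_sum_norm big_distrlr /=.
  apply: ler_sum => alpha _; rewrite big_mkcond /=; apply: ler_sum => beta _.
  by rewrite !nmE !normrM; case: ifP => // _; rewrite !mulr_ge0.
have cfg : (power_sum c h \* power_sum d h) N @[N --> \oo] --> f (a + h) * g (a + h) by apply: cvgM.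
pose u N := power_sum_norm c h N * power_sum_norm d h N.
have u0 N : 0 <= u N by rewrite mulr_ge0 ?power_sum_norm_ge0.
have uh : {homo u : M N / (M <= N)%N >-> M <= N}.
  by move=> K L KL; rewrite ler_pM ?power_sum_norm_ge0 ?power_sum_norm_homo.
have uB : exists B, forall N, u N <= B by exists (M * M').
have near0 : (power_sum c h N * power_sum d h N - power_sum (conv c d) h N)
    @[N --> \oo] --> (0 : C^o).
  apply/cvgr0Pnorm_lt => e e0.
  have [K HK] := bcauchy _ u0 uh uB _ e0.
  exists K.*2 => // N /= KN.
  apply: le_lt_trans (power_sum_conv_near c d h KN) (HK N _).
  by apply: leq_trans KN; rewrite -addnn leq_addr.
have -> : power_sum (conv c d) h = (power_sum c h \* power_sum d h) -
    (fun N => power_sum c h N * power_sum d h N - power_sum (conv c d) h N).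
  by apply/funext => N; rewrite !fctE subKr.
rewrite -[X in _ --> X]subr0.
exact: (@cvgB _ C^o _ _ _ _ _ _ _ cfg near0).
Qed.
End Analytic.

Section AnalyticComplex.
Variable R : realType.
Local Notation C := (Cx R).

Lemma Cx_bounded_cauchy : bounded_cauchy C.
Proof.
move=> u u0 uh [B uB] e e0.
have reE (x : C) : 0 <= x -> x = (complex.Re x)%:C%C.
  by case: x => a b; rewrite lecE /= => /andP[/eqP -> _].
pose v N : R := complex.Re (u N).
have vh : {homo v : M N / (M <= N)%N >-> M <= N}.
  by move=> M N /uh; rewrite (reE _ (u0 M)) (reE _ (u0 N)) lecR.
have B0 : 0 <= B by apply: le_trans (u0 0%N) (uB 0%N).
have vB N : v N <= complex.Re B.
  by have := uB N; rewrite (reE _ (u0 N)) (reE _ B0) lecR.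
have e0' : 0 < complex.Re e.
  by have := e0; rewrite {1}(reE _ (ltW e0)) ltcR.
have sv : has_sup (range v).
  by split; [exists (v 0%N); exists 0%N | exists (complex.Re B) => _ [N _ <-]].
have [_ [N _ <-] Hx] := sup_adherent e0' sv.
exists N => M NM.
rewrite (reE _ (u0 N)) (reE _ (u0 M)) -rmorphB [e](reE _ (ltW e0)) ltcR.
rewrite ltrBlDr; apply: le_lt_trans (_ : sup (range v) < _).
  by apply: ub_le_sup; [case: sv | exists M].
by rewrite -ltrBlDl.
Qed.

Lemma analytic_atM n (f g : 'rV[C]_n -> C) a :
  analytic_at f a -> analytic_at g a -> analytic_at (f * g) a.
Proof. exact: (analytic_atM_subproof (@Cx_bounded_cauchy)). Qed.

End AnalyticComplex.

Section Atlas.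
Variables (R : realType) (n : nat).
Local Notation C := (Cx R).

(* Charts without the manifold axioms, which are in complexManifold; chart_inv i
   is only meaningful on the image of chart_dom i. *)
Record atlas (T : topologicalType) := Atlas {
  chart_index : Type;
  chart_dom : chart_index -> set T;
  chart : chart_index -> T -> 'rV[C]_n;
  chart_inv : chart_index -> 'rV[C]_n -> T
}.
Arguments chart_dom {T} a i.
Arguments chart {T} a i.
Arguments chart_inv {T} a i.

(* Read in every chart at x, so that no compatibility of the charts is needed
   for holomorphic functions to form a ring. *)
Definition hol_at (T : topologicalType) (A : atlas T) (f : T -> C) (x : T) :=
  forall i, chart_dom A i x ->
    analytic_at (f \o chart_inv A i) (chart A i x).

Definition hol_on (T : topologicalType) (A : atlas T) (V : set T) (f : T -> C) :=
  forall x, V x -> hol_at A f x.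

(* Second countability is not required. *)
Record complexManifold := ComplexManifold {
  carrier :> topologicalType;
  charts : atlas carrier;
  _ : hausdorff_space carrier;
  _ : forall x, exists i, chart_dom charts i x;
  _ : forall i, open (chart_dom charts i);
  _ : forall i, open (chart charts i @` chart_dom charts i);
  _ : forall i x, chart_dom charts i x ->
    [/\ chart_inv charts i (chart charts i x) = x,
        {for x, continuous (chart charts i)} &
        {for chart charts i x, continuous (chart_inv charts i)}];
  _ : forall i j x, chart_dom charts i x -> chart_dom charts j x ->
    forall k, analytic_at (fun z => chart charts j (chart_inv charts i z) 0 k)
                          (chart charts i x)
}.

End Atlas.
Arguments chart_dom {R n T} a i.
Arguments chart {R n T} a i.
Arguments chart_inv {R n T} a i.

(* The product charts of T * C^d. *)
Definition prod_atlas (R : realType) (n d : nat) (T : topologicalType)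
    (A : atlas R n T) : atlas R (n + d) (T * 'rV[Cx R]_d)%type :=
  @Atlas R (n + d) (T * 'rV[Cx R]_d)%type (chart_index A)
    (fun i w => chart_dom A i w.1)
    (fun i w => row_mx (chart A i w.1) w.2)
    (fun i z => (chart_inv A i (lsubmx z), rsubmx z)).

Section Germs.
Variables (R : realType) (n : nat) (T : topologicalType) (A : atlas R n T).
Local Notation C := (Cx R).

(* The stalk of the structure sheaf at x: functions holomorphic near x, modulo
   those vanishing near x. *)
Definition loc_hol (x : T) : {pred T -> C} :=
  fun f => `[< \forall y \near x, hol_at A f y >].

Lemma loc_hol_subring x : subring_closed (loc_hol x).
Proof.
split.
- by apply/asboolP; apply: nearW => y i _; exact: analytic_at_cst.
- move=> f g /asboolP Hf /asboolP Hg; apply/asboolP.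
  near=> y => i yi; apply: analytic_atB; last by move: yi; apply: (near Hg y).
  by move: yi; apply: (near Hf y).
- move=> f g /asboolP Hf /asboolP Hg; apply/asboolP.
  near=> y => i yi; apply: analytic_atM; last by move: yi; apply: (near Hg y).
  by move: yi; apply: (near Hf y).
Unshelve. all: by end_near.
Qed.

HB.instance Definition _ x :=
  GRing.isSubringClosed.Build (T -> C) (loc_hol x) (loc_hol_subring x).

Definition hol_near (x : T) := {f : T -> C | f \in loc_hol x}.
HB.instance Definition _ x := SubType.on (hol_near x).
HB.instance Definition _ x := Choice.on (hol_near x).
HB.instance Definition _ x := [SubChoice_isSubZmodule of hol_near x by <:].

Definition hol_near1 x : hol_near x := Sub 1 (rpred1 (loc_hol x)).
Definition hol_near_mul x (f g : hol_near x) : hol_near x :=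
  Sub (val f * val g) (rpredM (valP f) (valP g)).

Lemma hol_near_mulA x : associative (@hol_near_mul x).
Proof. by move=> f g k; apply: val_inj; rewrite /= mulrA. Qed.
Lemma hol_near_mulC x : commutative (@hol_near_mul x).
Proof. by move=> f g; apply: val_inj; rewrite /= mulrC. Qed.
Lemma hol_near_mul1 x : left_id (hol_near1 x) (@hol_near_mul x).
Proof. by move=> f; apply: val_inj; rewrite /= mul1r. Qed.
Lemma hol_near_mulDl x : left_distributive (@hol_near_mul x) +%R.
Proof. by move=> f g k; apply: val_inj; rewrite /= mulrDl. Qed.
Lemma hol_near1_neq0 x : hol_near1 x != 0.
Proof.
apply/negP => /eqP /(congr1 val) /= /(congr1 (fun f => f x)) /eqP.
by rewrite /= oner_eq0.
Qed.

HB.instance Definition _ x := GRing.Zmodule_isComNzRing.Build (hol_near x)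
  (@hol_near_mulA x) (@hol_near_mulC x) (@hol_near_mul1 x) (@hol_near_mulDl x)
  (@hol_near1_neq0 x).

Definition null_germ (x : T) : {pred hol_near x} :=
  fun f => `[< \forall y \near x, val f y = 0 >].

Lemma null_germ_idealr x : idealr_closed (@null_germ x).
Proof.
split.
- by apply/asboolP; apply: nearW.
- by apply/asboolPn => /nbhs_singleton /eqP; rewrite /= oner_eq0.
- move=> a f g /asboolP Hf /asboolP Hg; apply/asboolP; near=> y.
  rewrite /= !fctE (near Hf y) // (near Hg y) //.
  by rewrite mulr0 addr0.
Unshelve. all: by end_near.
Qed.

HB.instance Definition _ x :=
  isIdealr.Build (hol_near x) (@null_germ x) (null_germ_idealr x).

Definition ostalk (x : T) := {ideal_quot @null_germ x}.
HB.instance Definition _ x := GRing.ComNzRing.on (ostalk x).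

(* Junk value 0 when f is not holomorphic near x. *)
Definition germ (f : T -> C) (x : T) : ostalk x :=
  \pi_(ostalk x)%qT (insubd (0 : hol_near x) f).

Definition germ_rep (x : T) (g : ostalk x) : T -> C := val (repr g).
End Germs.

Section DiffOp.
Variables (R : realType) (n : nat) (T : topologicalType) (A : atlas R n T).
Local Notation C := (Cx R).
Local Notation O := (ostalk A).

Definition derivation (x : T) (xi : O x -> O x) :=
  [/\ forall f g, xi (f + g) = xi f + xi g,
      forall f g, xi (f * g) = xi f * g + f * xi g &
      forall k : C, xi (germ A (fun=> k) x) = 0].

(* The stalk at x of the sheaf D_X: the subring of the C-linear endomorphisms of
   the stalk O_x generated by O_x and the germs of holomorphic vector fields,
   i.e. the C-linear derivations of O_x. *)
Inductive diffop (x : T) : (O x -> O x) -> Prop :=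
| Diffop_fun (a : O x) : diffop ( *%R a)
| Diffop_field (xi : O x -> O x) : derivation xi -> diffop xi
| Diffop_add (P Q : O x -> O x) : diffop P -> diffop Q -> diffop (P + Q)
| Diffop_comp (P Q : O x -> O x) : diffop P -> diffop Q -> diffop (P \o Q).

Definition diffopb (x : T) : {pred O x -> O x} := fun P => `[< diffop P >].

Lemma diffop_additive x (P : O x -> O x) :
  diffop P -> forall f g, P (f + g) = P f + P g.
Proof.
elim=> [a f g|xi []//|P1 P2 _ IH1 _ IH2 f g|P1 P2 _ IH1 _ IH2 f g].
- exact: mulrDr.
- by rewrite !fctE IH1 IH2 addrACA.
- by rewrite /= IH2 IH1.
Qed.

Lemma diffopb_zmod x : zmod_closed (@diffopb x).
Proof.
split.
  apply/asboolP; have -> : 0 = *%R (0 : O x); last exact: Diffop_fun.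
  by apply/funext => f; rewrite mul0r.
move=> P Q /asboolP HP /asboolP HQ; apply/asboolP; apply: Diffop_add => //.
have -> : - Q = *%R (-1 : O x) \o Q by apply/funext => f; rewrite /= mulN1r.
by apply: Diffop_comp => //; exact: Diffop_fun.
Qed.

HB.instance Definition _ x :=
  GRing.isZmodClosed.Build (O x -> O x) (@diffopb x) (diffopb_zmod x).

Definition dstalk (x : T) := {P : O x -> O x | P \in @diffopb x}.
HB.instance Definition _ x := SubType.on (dstalk x).
HB.instance Definition _ x := Choice.on (dstalk x).
HB.instance Definition _ x := [SubChoice_isSubZmodule of dstalk x by <:].

Lemma dstalk_diffop x (P : dstalk x) : diffop (val P).
Proof. exact/asboolP/(valP P). Qed.

Definition dstalk_of (x : T) (P : O x -> O x) (HP : diffop P) : dstalk x :=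
  Sub P (introT (asboolP _) HP).

Definition fun_op (x : T) (a : O x) : dstalk x := dstalk_of (Diffop_fun a).

Definition dstalk1 x : dstalk x := fun_op 1.
Definition dstalk_mul x (P Q : dstalk x) : dstalk x :=
  dstalk_of (Diffop_comp (dstalk_diffop P) (dstalk_diffop Q)).

Lemma dstalk_mulA x : associative (@dstalk_mul x).
Proof. by move=> P Q S; apply: val_inj. Qed.
Lemma dstalk_mul1 x : left_id (dstalk1 x) (@dstalk_mul x).
Proof. by move=> P; apply: val_inj; apply/funext => f; rewrite /= mul1r. Qed.
Lemma dstalk_mulr1 x : right_id (dstalk1 x) (@dstalk_mul x).
Proof. by move=> P; apply: val_inj; apply/funext => f; rewrite /= mul1r. Qed.
Lemma dstalk_mulDl x : left_distributive (@dstalk_mul x) +%R.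
Proof. by move=> P Q S; apply: val_inj. Qed.
Lemma dstalk_mulDr x : right_distributive (@dstalk_mul x) +%R.
Proof.
move=> P Q S; apply: val_inj; apply/funext => f /=.
exact: (diffop_additive (dstalk_diffop P)).
Qed.

HB.instance Definition _ x := GRing.Zmodule_isPzRing.Build (dstalk x)
  (@dstalk_mulA x) (@dstalk_mul1 x) (@dstalk_mulr1 x)
  (@dstalk_mulDl x) (@dstalk_mulDr x).

(* Sheaves are handled as etale spaces: a section over an open set V is a family
   of germs, whose values outside V are irrelevant. *)
Definition osection (V : set T) (s : forall x, O x) :=
  exists f, hol_on A V f /\ forall x, V x -> s x = germ A f x.

(* Sections of D_X over V: endomorphisms of the sheaf O_X|V which at each point
   are germs of differential operators. *)
Definition dsection (V : set T) (P : forall x, dstalk x) :=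
  forall W f, open W -> W `<=` V -> hol_on A W f ->
    exists g, hol_on A W g /\ forall x, W x -> val (P x) (germ A f x) = germ A g x.

End DiffOp.

Section Sheaves.
Variable T : topologicalType.
Variables (S : T -> pzRingType) (ssec : set T -> (forall x, S x) -> Prop).

(* A sheaf on the open set U of left modules over the sheaf of rings with stalks S
   and sections ssec: stalks together with the families of germs that are
   sections.  Only open V `<=` U and stalks at points of U matter. *)
Record sheafModule (U : set T) := SheafModule {
  mstalk : forall x, lmodType (S x);
  msec : set T -> (forall x, mstalk x) -> Prop;
  _ : forall V s t, msec V s -> (forall x, V x -> s x = t x) -> msec V t;
  _ : forall V W s, open V -> open W -> W `<=` V -> V `<=` U ->
    msec V s -> msec W s;
  _ : forall V s, open V -> V `<=` U ->
    (forall x, V x -> exists W, [/\ open W, W x, W `<=` V & msec W s]) -> msec V s;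
  _ : forall x (m : mstalk x), U x ->
    exists V s, [/\ open V, V x, V `<=` U, msec V s & s x = m];
  _ : forall V s t x, open V -> V `<=` U -> V x -> msec V s -> msec V t ->
    s x = t x -> exists W, [/\ open W, W x, W `<=` V & forall y, W y -> s y = t y];
  _ : forall V s t, open V -> V `<=` U -> msec V s -> msec V t ->
    msec V (fun x => s x + t x);
  _ : forall V a s, open V -> V `<=` U -> ssec V a -> msec V s ->
    msec V (fun x => a x *: s x)
}.

Section Coherence.
(* mem x is the stalk at x of a subsheaf of E, and esec its sections. *)
Variables (E : forall x, lmodType (S x)) (mem : forall x, set (E x)).
Variable esec : set T -> (forall x, E x) -> Prop.

Definition finite_type (U : set T) :=
  forall x, U x -> exists V k (e : 'I_k -> forall y, E y),
    [/\ open V, V x, V `<=` U, forall i, esec V (e i) &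
        forall y, V y -> forall m, mem m ->
          exists c : 'I_k -> S y, m = \sum_i c i *: e i y].
End Coherence.

(* Finite type, and for all finitely many sections e over an open V the sheaf rel
   of relations between them is of finite type. *)
Definition coherent (E : forall x, lmodType (S x)) (mem : forall x, set (E x))
    (esec : set T -> (forall x, E x) -> Prop) (U : set T) :=
  finite_type mem esec U /\
  forall V k (e : 'I_k -> forall y, E y), open V -> V `<=` U ->
    (forall i, esec V (e i)) ->
    let rel y : set 'rV[S y]_k := [set a | \sum_i a 0 i *: e i y = 0] in
    finite_type rel
      (fun W (a : forall y, 'rV[S y]_k) => (forall i, ssec W (fun y => a y 0 i)) /\
         forall y, W y -> rel y (a y)) V.

End Sheaves.

Section IdealSheaf.
Variables (R : realType) (n : nat) (T : topologicalType) (A : atlas R n T).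
Local Notation O := (ostalk A).

Definition ideal_sheaf (F : forall x, set (O x)) :=
  (forall x, [/\ F x 0, forall g h, F x g -> F x h -> F x (g + h) &
                 forall a g, F x g -> F x (a * g)]) /\
  (forall x g, F x g -> exists V f, [/\ open V, V x, hol_on A V f,
     g = germ A f x & forall y, V y -> F y (germ A f y)]).

Definition coherent_ideal_sheaf (F : forall x, set (O x)) :=
  ideal_sheaf F /\
  @coherent T O (@osection _ _ _ A) (fun x => (O x)^o) F
    (fun V s => osection V s /\ forall x, V x -> F x (s x)) setT.

Definition generators (F : forall x, set (O x)) (U : set T) d
    (f : 'I_d -> T -> Cx R) :=
  (forall i, hol_on A U (f i)) /\
  forall x, U x -> forall g,
    F x g <-> exists a : 'I_d -> O x, g = \sum_i a i * germ A (f i) x.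

(* Holomorphically convex and holomorphically separable. *)
Definition stein (U : set T) :=
  [/\ open U,
      forall K, compact K -> K `<=` U ->
        compact [set x | U x /\ forall f (c : Cx R), hol_on A U f ->
                  (forall y, K y -> `|f y| <= c) -> `|f x| <= c] &
      forall x y, U x -> U y -> x <> y -> exists f, hol_on A U f /\ f x <> f y].

Definition coherent_dmodule (U : set T)
    (M : sheafModule (@dsection _ _ _ A) U) :=
  coherent (@dsection _ _ _ A) (fun x => [set: mstalk M x]) (@msec _ _ _ _ M) U.

End IdealSheaf.

Section LocalizationDerivation.
Variables (B : comNzRingType) (D : B -> B) (h : B).

(* The extension of D to B[h^-1] = B['X] / (1 - h 'X), on representatives:
   D (h^-1) = - D h / h ^ 2. *)
Definition frac_der (q : {poly B}) : {poly B} :=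
  map_poly D q - D h *: ('X^2 * deriv q).
End LocalizationDerivation.

(* With h the product of the l j and h_j = h / l j, loc_cohom is the quotient of
   B[h^-1] by the sum over j of the images of the B[h_j^-1].  B[h^-1] is presented
   as B['X] / (1 - h 'X), 'X being h^-1; the map from B[h_j^-1] to it sends
   h_j^-1 to l j / h, i.e. substitutes l j *: 'X. *)
Section LocalCohomology.
Variables (B : comNzRingType) (d : nat) (l : 'I_d -> B).

Definition loc_den : B := \prod_j l j.

Definition loc_null : {pred {poly B}} := fun q =>
  `[< exists (r : {poly B}) (c : 'I_d -> {poly B}),
        q = r * (1 - loc_den *: 'X) + \sum_j (c j \Po (l j *: 'X)) >].

Lemma loc_null_zmod : zmod_closed loc_null.
Proof.
split.
  apply/asboolP; exists 0, (fun=> 0).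
  by rewrite mul0r add0r big1 // => j _; rewrite comp_poly0.
move=> q1 q2 /asboolP[r1 [c1 ->]] /asboolP[r2 [c2 ->]]; apply/asboolP.
exists (r1 - r2), (fun j => c1 j - c2 j).
under [in RHS]eq_bigr do rewrite comp_polyB.
by rewrite sumrB mulrBl opprD addrACA.
Qed.

HB.instance Definition _ :=
  GRing.isZmodClosed.Build {poly B} loc_null loc_null_zmod.

Definition loc_cohom := Quotient.quot loc_null.
HB.instance Definition _ := GRing.Zmodule.on loc_cohom.

Definition loc_class (q : {poly B}) : loc_cohom := \pi_loc_cohom%qT q.
End LocalCohomology.

(* W = T * C^d, Y = T * {0}, q = (p, 0); the stalk of O_Y at q is identified with
   that of O_T at p. *)
Section AlongZeroSection.
Variables (R : realType) (n : nat) (T : topologicalType) (A : atlas R n T).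
Variables (d : nat) (p : T).
Local Notation C := (Cx R).
Local Notation W := (T * 'rV[C]_d)%type.
Local Notation AW := (prod_atlas d A).
Local Notation q := ((p, 0) : W).
Local Notation OX := (ostalk A p).
Local Notation OW := (ostalk AW q).
Local Notation DX := (dstalk A p).
Local Notation DW := (dstalk AW q).

Definition pullback (g : OX) : OW := germ AW (fun w => germ_rep g w.1) q.

Definition tcoord (j : 'I_d) : OW := germ AW (fun w => w.2 0 j) q.

(* The partial derivative along the j-th coordinate of C^d. *)
Definition dt (j : 'I_d) (g : OW) : OW :=
  germ AW (fun w =>
    derive1 (fun z : C => germ_rep g (w.1, w.2 + z *: delta_mx 0 j) : C^o) 0) q.

(* theta = t_1 d/dt_1 + ... + t_d d/dt_d, as an element of the stalk of D_W. *)
Definition is_theta (theta : DW) :=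
  forall g, val theta g = \sum_j tcoord j * dt j g.

(* The stalk at q of the defining ideal of Y, and its powers. *)
Definition ideal_Y (g : OW) := exists V F,
  [/\ open V, V q, hol_on AW V F, g = germ AW F q &
      forall x, V (x, 0) -> F (x, 0) = 0].

Fixpoint ideal_Y_expn (i : nat) (g : OW) : Prop :=
  if i is i'.+1 then
    exists k (a b : 'I_k -> OW),
      [/\ forall l, ideal_Y (a l), forall l, ideal_Y_expn i' (b l) &
          g = \sum_l a l * b l]
  else True.

Definition ideal_Y_exp (i : int) (g : OW) : Prop :=
  if i is Posz k then ideal_Y_expn k g else True.

Definition V_filtration (j : int) (P : DW) :=
  forall i g, ideal_Y_exp i g -> ideal_Y_exp (i - j) (val P g).

(* b(theta, y), coefficients on the left. *)
Definition eval_theta (theta : DW) (b : {poly OX}) : DW :=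
  \sum_(i < size b) fun_op (pullback b`_i) * theta ^+ i.

Section Module.
Variables (N : lmodType DW) (v : N).

(* b(theta, y) v belongs to V^-1 v. *)
Definition kills_mod_V (b : {poly OX}) :=
  exists theta P : DW, [/\ is_theta theta, V_filtration (-1) P &
    eval_theta theta b *: v = P *: v].

Definition is_indicial (b : {poly OX}) :=
  [/\ b \is monic, kills_mod_V b &
      forall b', b' \is monic -> kills_mod_V b' -> (size b <= size b')%N].

Definition const_poly (b : {poly C}) : {poly OX} :=
  map_poly (fun k => germ A (fun=> k) p) b.

Definition is_bfunction (b : {poly C}) :=
  [/\ b \is monic, kills_mod_V (const_poly b) &
      forall b', b' \is monic -> kills_mod_V (const_poly b') ->
        (size b <= size b')%N].
End Module.

Section DirectImage.
Variables (M : lmodType DX) (f : 'I_d -> T -> C).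

(* The equations t_j - f_j of the graph of f. *)
Definition graph_eq (j : 'I_d) : OW := germ AW (fun w => w.2 0 j - f j w.1) q.

Local Notation B := (loc_cohom graph_eq).

Definition balanced (G : zmodType) (phi : M -> B -> G) :=
  [/\ forall m m' b, phi (m + m') b = phi m b + phi m' b,
      forall m b b', phi m (b + b') = phi m b + phi m b' &
      forall (a : OX) m c, phi (fun_op a *: m) (loc_class graph_eq c) =
                     phi m (loc_class graph_eq (pullback a *: c))].

Definition is_tensor (N : zmodType) (tau : M -> B -> N) :=
  balanced tau /\
  forall (G : zmodType) (phi : M -> B -> G), balanced phi ->
    exists! psi : N -> G, (forall x y, psi (x + y) = psi x + psi y) /\
                          forall m b, phi m b = psi (tau m b).

(* The stalk at q of the direct image of M under the graph embedding of f: the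
   tensor product over O_p of the stalk M with the local cohomology of O_W along
   the graph, with its D_W-module structure.  As D_W is generated by functions and
   vector fields, the latter is determined by the action of functions, on the second
   factor, and by the Leibniz rule for the fields P projecting to a field Q on T
   (Q = 0 for the fields d/dt_j). *)
Record direct_image := DirectImage {
  dimage :> lmodType DW;
  tens : M -> B -> dimage;
  _ : is_tensor tens;
  _ : forall (a : OW) m c,
    fun_op a *: tens m (loc_class graph_eq c) = tens m (loc_class graph_eq (a *: c));
  _ : forall (P : DW) (Q : DX) m c,
    derivation (val P) -> derivation (val Q) ->
    (forall g, val P (pullback g) = pullback (val Q g)) ->
    P *: tens m (loc_class graph_eq c) =
      tens (Q *: m) (loc_class graph_eq c) +
      tens m (loc_class graph_eq (frac_der (val P) (loc_den graph_eq) c))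
}.

(* The class of 1 / prod_j (t_j - f_j). *)
Definition delta_class : B := loc_class graph_eq 'X.

Definition image_section (N : direct_image) (u : M) : N := tens N u delta_class.

(* The b(s, x) such that b(s + d, x) is an indicial polynomial. *)
Definition indicial_set (N : direct_image) (u : M) : set {poly OX} :=
  [set b | is_indicial (image_section N u) (b \Po ('X + d%:R%:P))].

End DirectImage.
End AlongZeroSection.

(* Main.v *)
Require Import Defs.
From HB Require Import structures.
From mathcomp Require Import all_boot all_order all_algebra.
From mathcomp Require Import complex generic_quotient ring_quotient.
From mathcomp Require Import all_classical all_reals interval_inference.
From mathcomp Require Import topology normedtype sequences derive.
From mathcomp Require Import ring.
Set Implicit Arguments. Unset Strict Implicit. Unset Printing Implicit Defensive.
Import Order.TTheory GRing.Theory Num.Theory.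
Import numFieldNormedType.Exports.
Local Open Scope classical_set_scope.
Local Open Scope ring_scope.

(** If g_k = sum_j a_kj f_j, then pulling the residue of a local cohomology class along
    the graph of f through this substitution gives an additive map Phi between the two
    direct images with Phi (m (x) delta_f) = m (x) delta_g and
    Phi o d/dt_j = (sum_k a_kj d/dt'_k) o Phi; it turns theta_f + d into theta_g + e,
    and this is where the shifts by d and e come from.  It remains to see that Phi maps
    V^-1 u to V^-1 u.  Put an operator in normal form: P is in V^-1 exactly when the
    coefficient of each monomial in the derivations lies in a power of I_Y exceeding by
    one the number of t-derivatives, and since t_j acts on m (x) delta_f as f_j, V^-1 u
    is generated under coordinate fields, functions and d/dt_j by the hu (x) delta_f with
    h in F^(r+1), where r counts the d/dt_j applied afterwards.  This description only
    involves F, and Phi respects it.  As c(theta) u with c in F[s] belongs to V^-1 u,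
    indicial polynomials may be altered by c. *)

(** * Absolutely convergent power series *)

(** [Phi] is not linear over the operators on the base. For a coordinate field Y_i one finds Phi Y_i
    = Y_i Phi + sum_jk X_i(a_kj) d/dt'_k Phi t_j: differentiating g_k = sum_j a_kj f_j also hits the
    matrix. What saves the filtration is that each such defect applies one t-derivative only after
    one factor t_j. The shift by d is the commutator in sum_j (d/dt_j) t_j = theta + d, together
    with the action of t_j on m (x) delta_f as f_j. A direct image is given only by the universal
    property of a tensor product. Existence yields [Phi]; uniqueness yields its compatibility with
    d/dt_j, by comparing two factorisations of one balanced map. The other rules for [Phi] are
    proved on the span of the t-derivatives of the m (x) delta_f. The normal form is where analysis
    enters. The stalk of D_X is generated by functions and by all derivations of the local ring, so
    these must first be reduced to coordinate fields. This rests on Hadamard's lemma and on the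
    vanishing of flat germs, hence on a theory of convergent power series closed under composition
    and differentiation. *)

Section UnorderedSums.
Variable R : realType.
Local Notation C := (Cx R).

(** The bound is kept as a parameter because it serves as a norm: it multiplies under products and
    bounds the sum. *)
Definition absum (I : eqType) (f : I -> C) (M : C) :=
  forall s, uniq s -> \sum_(i <- s) `|f i| <= M.

(** Convergence along the finite subsets of the index set. Being independent of any enumeration, it
    survives the regroupings that products and compositions of series call for. *)
Definition has_sum (I : eqType) (f : I -> C) (S : C) :=
  forall e, 0 < e -> exists s0 : seq I,
    forall s, uniq s -> {subset s0 <= s} -> `|\sum_(i <- s) f i - S| < e.

Lemma Cx_ge0E (x : C) : 0 <= x -> x = (complex.Re x)%:C%C.
Proof. by case: x => a b; rewrite lecE /= => /andP[/eqP -> _]. Qed.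

Lemma half_gt0 (e : C) : 0 < e -> 0 < e / 2.
Proof. by move=> e0; rewrite divr_gt0. Qed.

(** The order on the complex numbers is partial: the hypothesis for [e = 1] already forces equal
    imaginary parts, and the rest is a statement about real parts. *)
Lemma Cx_le_eps (x : C) y : (forall e : C, 0 < e -> x <= y + e) -> x <= y.
Proof.
move=> H; have H1 := H 1 ltr01.
have yx : y \is Num.real = (x \is Num.real).
  by rewrite -(rpredDr y (real1 C)) (ger_real H1).
case: x y H H1 yx => [a b] [c d] H.
rewrite lecE /= addr0 => /andP[/eqP db _] _.
rewrite lecE /= db eqxx /=; apply/ler_addgt0Pr => e e0.
have := H e%:C%C; rewrite ltcR => /(_ e0).
by rewrite lecE /= => /andP[].
Qed.

Section OneIndex.
Variable I : eqType.
Implicit Types (f g : I -> C) (s : seq I).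

Lemma absum_ge0 f M : absum f M -> 0 <= M.
Proof. by move=> /(_ [::] isT); rewrite big_nil. Qed.

Lemma absum_le f g M : (forall i, `|f i| <= `|g i|) -> absum g M -> absum f M.
Proof. by move=> fg gM s us; apply: le_trans (gM s us); apply: ler_sum. Qed.

Lemma ler_sum_subset (g : I -> C) s t : (forall i, 0 <= g i) -> uniq s -> uniq t ->
  {subset s <= t} -> \sum_(i <- s) g i <= \sum_(i <- t) g i.
Proof.
move=> g0 us ut st; rewrite [leRHS](bigID (mem s)) /= -[leLHS]addr0.
apply: lerD; last by apply: sumr_ge0 => i _.
have P : perm_eq [seq i <- t | mem s i] s.
  apply: uniq_perm; rewrite ?filter_uniq // => i; rewrite mem_filter.
  by apply/andP/idP => [[]//|is_]; split => //; exact: st.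
by rewrite -[leRHS]big_filter (perm_big _ P).
Qed.

Lemma absumZ a f M : absum f M -> absum (fun i => a * f i) (`|a| * M).
Proof.
move=> fM s us; under eq_bigr do rewrite normrM.
by rewrite -mulr_sumr ler_wpM2l // fM.
Qed.

Lemma absumZr a f M : absum f M -> absum (fun i => f i * a) (M * `|a|).
Proof.
move=> fM; rewrite mulrC; apply: absum_le (absumZ a fM) => i.
by rewrite mulrC.
Qed.

Lemma absumD f g M M' : absum f M -> absum g M' -> absum (fun i => f i + g i) (M + M').
Proof.
move=> fM gM s us; apply: le_trans (lerD (fM s us) (gM s us)).
by rewrite -big_split; apply: ler_sum => i _; exact: ler_normD.
Qed.

Lemma has_sum_ext f g S : f =1 g -> has_sum f S -> has_sum g S.
Proof.
move=> fg H e /H[s0 Hs]; exists s0 => s us /(Hs _ us).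
by under eq_bigr do rewrite fg.
Qed.

Lemma has_sum_inj f S S' : has_sum f S -> has_sum f S' -> S = S'.
Proof.
move=> H H'; apply/eqP; rewrite -subr_eq0 -normr_le0.
apply: Cx_le_eps => e e0; rewrite add0r.
have [s0 Hs] := H _ (half_gt0 e0); have [s1 Hs'] := H' _ (half_gt0 e0).
pose s := undup (s0 ++ s1).
have sub0 : {subset s0 <= s} by move=> i i0; rewrite mem_undup mem_cat i0.
have sub1 : {subset s1 <= s} by move=> i i0; rewrite mem_undup mem_cat i0 orbT.
have us : uniq s := undup_uniq _.
have := ltrD (Hs s us sub0) (Hs' s us sub1).
rewrite -splitr => /ltW; apply: le_trans.
rewrite -(opprB S' S) normrN.
rewrite (_ : S' - S = (\sum_(i <- s) f i - S) - (\sum_(i <- s) f i - S')) ?ler_normB //.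
by rewrite opprB [RHS]addrC addrA subrK.
Qed.

Lemma has_sumD f g S S' : has_sum f S -> has_sum g S' ->
  has_sum (fun i => f i + g i) (S + S').
Proof.
move=> H H' e e0.
have [s0 Hs] := H _ (half_gt0 e0); have [s1 Hs'] := H' _ (half_gt0 e0).
exists (s0 ++ s1) => s us sub.
have sub0 : {subset s0 <= s} by move=> i i0; rewrite sub // mem_cat i0.
have sub1 : {subset s1 <= s} by move=> i i0; rewrite sub // mem_cat i0 orbT.
rewrite big_split /= opprD addrACA (splitr e).
exact: le_lt_trans (ler_normD _ _) (ltrD (Hs s us sub0) (Hs' s us sub1)).
Qed.

Lemma has_sumZ a f S : has_sum f S -> has_sum (fun i => a * f i) (a * S).
Proof.
move=> H e e0; have a0 : 0 < `|a| + 1 by rewrite ltr_wpDl.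
have [s0 Hs] := H _ (divr_gt0 e0 a0); exists s0 => s us /(Hs s us).
rewrite ltr_pdivlMr // => H1; rewrite -mulr_sumr -mulrBr normrM mulrC.
by apply: le_lt_trans H1; rewrite ler_wpM2l // lerDl.
Qed.

Lemma has_sumZr a f S : has_sum f S -> has_sum (fun i => f i * a) (S * a).
Proof.
move=> /(has_sumZ a); rewrite mulrC; apply: has_sum_ext => i.
by rewrite mulrC.
Qed.

Lemma has_sumN f S : has_sum f S -> has_sum (fun i => - f i) (- S).
Proof.
move=> /(has_sumZ (-1)); rewrite mulN1r; apply: has_sum_ext => i.
by rewrite mulN1r.
Qed.

Lemma has_sumB f g S S' : has_sum f S -> has_sum g S' ->
  has_sum (fun i => f i - g i) (S - S').
Proof. by move=> H /has_sumN; exact: has_sumD. Qed.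

Lemma has_sum_fin f s : uniq s -> (forall i, i \notin s -> f i = 0) ->
  has_sum f (\sum_(i <- s) f i).
Proof.
move=> us f0 e e0; exists s => t ut st.
suff -> : \sum_(i <- t) f i = \sum_(i <- s) f i by rewrite subrr normr0.
rewrite (bigID (mem s)) /= [X in _ + X]big1 ?addr0; last first.
  by move=> i /f0.
rewrite -big_filter; apply: perm_big.
apply: uniq_perm; rewrite ?filter_uniq // => i; rewrite mem_filter.
by apply/andP/idP => [[]//|is_]; split => //; exact: st.
Qed.

Lemma absum_fin f s : uniq s -> (forall i, i \notin s -> f i = 0) ->
  absum f (\sum_(i <- s) `|f i|).
Proof.
move=> us f0 t ut; rewrite (bigID (mem s)) /= [X in _ + X]big1 ?addr0; last first.
  by move=> i /f0 ->; rewrite normr0.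
rewrite [leRHS](bigID (mem t)) /= -[leLHS]addr0; apply: lerD; last exact: sumr_ge0.
have P : perm_eq [seq i <- t | mem s i] [seq i <- s | mem t i].
  by apply: uniq_perm; rewrite ?filter_uniq // => i; rewrite !mem_filter andbC.
by rewrite -[leLHS]big_filter (perm_big _ P) big_filter.
Qed.

(** Nonnegative terms are real, so completeness of [R] provides the sum as the supremum of the
    finite partial sums. *)
Lemma has_sum_ge0_exists f M :
  (forall i, 0 <= f i) -> absum f M -> exists S, has_sum f S.
Proof.
move=> f0 fM; pose g i : R := complex.Re (f i).
have fE i : f i = (g i)%:C%C by exact: Cx_ge0E.
have sE s : \sum_(i <- s) f i = (\sum_(i <- s) g i)%:C%C.
  by rewrite rmorph_sum; under eq_bigr do rewrite fE.
have g0 i : 0 <= g i by rewrite -lecR -fE.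
pose V := [set x | exists2 s, uniq s & x = \sum_(i <- s) g i].
have supV : has_sup V.
  split; first by exists 0, [::]; rewrite ?big_nil.
  exists (complex.Re M) => _ [s us ->]; rewrite -lecR -(Cx_ge0E (absum_ge0 fM)).
  rewrite -sE; apply: le_trans (fM s us).
  by under [leRHS]eq_bigr do rewrite (ger0_norm (f0 _)).
exists (sup V)%:C%C => e e0.
have e0' : 0 < complex.Re e by rewrite -ltcR -Cx_ge0E ?ltW.
have [_ [s0 us0 ->] Hs0] := sup_adherent e0' supV.
exists s0 => s us sub.
have le1 : \sum_(i <- s) g i <= sup V.
  by apply: ub_le_sup; [case: supV | exists s].
have le2 : \sum_(i <- s0) g i <= \sum_(i <- s) g i.
  rewrite [leRHS](bigID (mem s0)) /= -[leLHS]addr0; apply: lerD; last exact: sumr_ge0.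
  have P : perm_eq [seq i <- s | mem s0 i] s0.
    apply: uniq_perm; rewrite ?filter_uniq ?us0 // => i; rewrite mem_filter.
    by apply/andP/idP => [[]//|is_]; split => //; exact: sub.
  by rewrite -[leRHS]big_filter (perm_big _ P).
rewrite sE -rmorphB /= -normrN -rmorphN /= opprB ger0_norm; last by rewrite ler0c subr_ge0.
rewrite (Cx_ge0E (ltW e0)) ltcR ltrBlDr -ltrBlDl.
exact: lt_le_trans Hs0 le2.
Qed.

(** The positive and negative parts of the real and imaginary parts are four nonnegative families
    dominated by [f]. *)
Lemma absum_has_sum f M : absum f M -> exists S, has_sum f S.
Proof.
move=> fM.
have part (g : I -> R) : (forall i, 0 <= g i) -> (forall i, (g i)%:C%C <= `|f i|) ->
    exists S, has_sum (fun i => (g i)%:C%C : C) S.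
  move=> g0 gf; apply: (@has_sum_ge0_exists _ M) => [i|s us].
    by rewrite ler0c.
  apply: le_trans (fM s us); apply: ler_sum => i _.
  by rewrite ger0_norm ?ler0c.
have Re_le i := normc_ge_Re (f i).
have Im_le i : `|complex.Im (f i)|%:C%C <= `|f i|.
  by rewrite normc_def lecR -sqrtr_sqr ler_wsqrtr // lerDr sqr_ge0.
have pos (x : R) : Num.max x 0 <= `|x| by rewrite ge_max ler_norm normr_ge0.
have neg (x : R) : Num.max (- x) 0 <= `|x| by rewrite -normrN; exact: pos.
have max0 (x : R) : 0 <= Num.max x 0 by rewrite le_max lexx orbT.
have [||S1 H1] := part (fun i => Num.max (complex.Re (f i)) 0) => // [i|].
  by apply: le_trans (Re_le i); rewrite lecR.
have [||S2 H2] := part (fun i => Num.max (- complex.Re (f i)) 0) => // [i|].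
  by apply: le_trans (Re_le i); rewrite lecR.
have [||S3 H3] := part (fun i => Num.max (complex.Im (f i)) 0) => // [i|].
  by apply: le_trans (Im_le i); rewrite lecR.
have [||S4 H4] := part (fun i => Num.max (- complex.Im (f i)) 0) => // [i|].
  by apply: le_trans (Im_le i); rewrite lecR.
have H := has_sumD (has_sumB H1 H2) (has_sumZ 'i%C (has_sumB H3 H4)).
eexists; apply: has_sum_ext H => i /=.
have E (x : R) : Num.max x 0 - Num.max (- x) 0 = x.
  case: (leP 0 x) => x0.
    by rewrite max_r ?oppr_le0 // subr0.
  by rewrite max_l ?oppr_ge0 ?ltW // sub0r opprK.
rewrite -!rmorphB /= !E; case: (f i) => a b /=.
by rewrite complexiE; apply/eqP; rewrite eq_complex /= !(mul0r,mul1r,mulr0,subr0,add0r,addr0) !eqxx.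
Qed.

Lemma has_sum_norm f S M : has_sum f S -> absum f M -> `|S| <= M.
Proof.
move=> H fM; apply: Cx_le_eps => e e0; have [s0 Hs] := H e e0.
have lte : `|\sum_(i <- undup s0) f i - S| < e.
  by apply: Hs (undup_uniq _) _ => i; rewrite mem_undup.
apply: le_trans (lerD (fM _ (undup_uniq s0)) (ltW lte)).
set x := \sum_(i <- _) `|_|; set y := \sum_(i <- _) f i.
rewrite -{1}[S](subKr y); apply: le_trans (ler_normB _ _) _.
by rewrite lerD2r ler_norm_sum.
Qed.

End OneIndex.
End UnorderedSums.

Section Fubini.
Variable R : realType.
Local Notation C := (Cx R).
Variables (I J : eqType).

Lemma cover_allpairs (s : seq (I * J)) :
  {subset s <= [seq (i, j) | i <- undup (map fst s), j <- undup (map snd s)]}.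
Proof.
move=> [i j] ij; apply/allpairsP; exists (i, j); split => //=.
  by rewrite mem_undup; apply/mapP; exists (i, j).
by rewrite mem_undup; apply/mapP; exists (i, j).
Qed.

Lemma allpairs_pair_uniq (a : seq I) (b : seq J) : uniq a -> uniq b ->
  uniq [seq (i, j) | i <- a, j <- b].
Proof. by move=> ua ub; apply: allpairs_uniq => // -[? ?] [? ?] _ _ [-> ->]. Qed.

Lemma big_allpairs_pair (f : I * J -> C) (a : seq I) (b : seq J) :
  \sum_(x <- [seq (i, j) | i <- a, j <- b]) f x = \sum_(i <- a) \sum_(j <- b) f (i, j).
Proof. by rewrite big_allpairs. Qed.

(** Only finitely many rows occur, so the finite sets witnessing their convergence can be united. *)
Lemma rows_approx (f : I * J -> C) (r : I -> C) (a : seq I) :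
  (forall i, has_sum (fun j => f (i, j)) (r i)) -> forall e, 0 < e ->
  exists b0 : seq J, forall b, uniq b -> {subset b0 <= b} ->
    \sum_(i <- a) `|\sum_(j <- b) f (i, j) - r i| < e.
Proof.
move=> Hr; elim: a => [|i a IH] e e0.
  by exists [::] => b _ _; rewrite big_nil.
have [b1 H1] := IH _ (half_gt0 e0); have [b2 H2] := Hr i _ (half_gt0 e0).
exists (b1 ++ b2) => b ub sub; rewrite big_cons (splitr e); apply: ltrD.
  by apply: H2 => // j jb; rewrite sub // mem_cat jb orbT.
by apply: H1 => // j jb; rewrite sub // mem_cat jb.
Qed.

(** Finitely many rows are cut off at one finite set of columns, with total error below [e]. What
    remains is a finite rectangle, where the hypotheses on [f] apply. *)
Lemma fubini (f : I * J -> C) (r : I -> C) M :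
  absum f M -> (forall i, has_sum (fun j => f (i, j)) (r i)) ->
  absum r M /\ forall S, has_sum f S -> has_sum r S.
Proof.
move=> fM Hr; split.
  move=> a ua; apply: Cx_le_eps => e e0.
  have [b0 /(_ _ (undup_uniq b0))] := rows_approx a Hr e0.
  set b := undup b0 => Hb.
  have {}Hb : \sum_(i <- a) `|\sum_(j <- b) f (i, j) - r i| < e.
    by apply: Hb => j; rewrite mem_undup.
  have := fM _ (allpairs_pair_uniq ua (undup_uniq b0)).
  rewrite (@big_allpairs_pair (fun x => `|f x|)) => Hf.
  apply: le_trans (lerD Hf (ltW Hb)); rewrite -big_split /=; apply: ler_sum => i _.
  rewrite -{1}[r i](subKr (\sum_(j <- b) f (i, j))).
  apply: le_trans (ler_normB _ _) _.
  by rewrite lerD2r ler_norm_sum.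
move=> S HS e e0.
have [s0 H0] := HS _ (half_gt0 e0).
exists (map fst s0) => a ua sub.
have [b0 H1] := rows_approx a Hr (half_gt0 e0).
pose b := undup (b0 ++ map snd s0); have ub : uniq b := undup_uniq _.
have {}H1 : \sum_(i <- a) `|\sum_(j <- b) f (i, j) - r i| < e / 2.
  by apply: H1 => // j jb; rewrite mem_undup mem_cat jb.
have := H0 _ (allpairs_pair_uniq ua ub); rewrite big_allpairs_pair.
set x := \sum_(i <- a) \sum_(j <- b) _ => {}H0.
have {}H0 : `|x - S| < e / 2.
  apply: H0 => -[i j] ij; apply/allpairsP; exists (i, j); split => //=.
    by apply: sub; apply/mapP; exists (i, j).
  by rewrite mem_undup mem_cat; apply/orP; right; apply/mapP; exists (i, j).
rewrite (_ : _ - S = (x - S) - \sum_(i <- a) (\sum_(j <- b) f (i, j) - r i)); last first.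
  by rewrite sumrB -/x opprB [RHS]addrC addrA subrK.
rewrite (splitr e); apply: le_lt_trans (ler_normB _ _) (ltrD H0 _).
exact: le_lt_trans (ler_norm_sum _ _ _) H1.
Qed.

End Fubini.

Section Regroup.
Variable R : realType.
Local Notation C := (Cx R).
Variables (I J : eqType).

Lemma absum_pair (f : I * J -> C) (m : I -> C) M :
  (forall i, absum (fun j => f (i, j)) (m i)) -> absum m M -> absum f M.
Proof.
move=> fm mM s us.
pose a := undup (map fst s); pose b := undup (map snd s).
have ab : uniq [seq (i, j) | i <- a, j <- b] by apply: allpairs_pair_uniq; exact: undup_uniq.
apply: (@le_trans _ _ (\sum_(x <- [seq (i, j) | i <- a, j <- b]) `|f x|)).
  exact: (ler_sum_subset (fun x => normr_ge0 (f x)) us ab (@cover_allpairs _ _ s)).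
rewrite (@big_allpairs_pair _ _ _ (fun x => `|f x|)) /=.
apply: le_trans (mM a (undup_uniq _)); apply: ler_sum => i _.
rewrite ger0_norm; last exact: absum_ge0 (fm i).
by apply: fm; exact: undup_uniq.
Qed.

Lemma fubini_swap (f : I * J -> C) (r : I -> C) (c : J -> C) M S : absum f M ->
  (forall i, has_sum (fun j => f (i, j)) (r i)) ->
  (forall j, has_sum (fun i => f (i, j)) (c j)) -> has_sum r S ->
  absum c M /\ has_sum c S.
Proof.
move=> fM Hr Hc HS; pose g (x : J * I) := f (x.2, x.1).
have swap (s : seq (J * I)) : uniq s -> uniq [seq (x.2, x.1) | x <- s].
  by move=> us; rewrite map_inj_uniq // => -[? ?] [? ?] [-> ->].
have gM : absum g M by move=> s /swap/fM; rewrite big_map.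
have [T HT] := absum_has_sum fM.
have HT' : has_sum g T.
  move=> e e0; have [s0 H0] := HT e e0.
  exists [seq (x.2, x.1) | x <- s0] => s us sub.
  have := H0 _ (swap _ us); rewrite big_map; apply => -[i j] ij.
  apply/mapP; exists (j, i) => //; apply: sub.
  by apply/mapP; exists (i, j).
have [_ /(_ _ HT) /has_sum_inj TS] := fubini fM Hr.
by have [? /(_ _ HT')] := fubini gM Hc; rewrite (TS _ HS).
Qed.

Lemma absum_prod (f : I -> C) (g : J -> C) M M' : absum f M -> absum g M' ->
  absum (fun x : I * J => f x.1 * g x.2) (M * M').
Proof.
move=> fM gM; apply: (@absum_pair _ (fun i => `|f i| * M')) => [i|]; first exact: (absumZ (f i) gM).
move=> s us; under eq_bigr do rewrite normrM normr_id (ger0_norm (absum_ge0 gM)).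
by rewrite -mulr_suml ler_wpM2r ?fM // (absum_ge0 gM).
Qed.

Lemma has_sum_prod (f : I -> C) (g : J -> C) M M' S S' :
  absum f M -> absum g M' -> has_sum f S -> has_sum g S' ->
  has_sum (fun x : I * J => f x.1 * g x.2) (S * S').
Proof.
move=> fM gM Hf Hg; have fg := absum_prod fM gM.
have [T HT] := absum_has_sum fg; suff -> : S * S' = T by [].
have [_ /(_ _ HT)] := fubini fg (fun i => has_sumZ (f i) Hg).
by apply: has_sum_inj; exact: has_sumZr.
Qed.

(* Fubini on the graph of pi, transposed. *)
Lemma regroup (f : I -> C) (pi : I -> J) M S : absum f M -> has_sum f S ->
  exists g : J -> C, [/\ absum g M, has_sum g S &
    forall j, has_sum (fun i => if pi i == j then f i else 0) (g j)].
Proof.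
move=> fM HS; pose F (x : I * J) := if pi x.1 == x.2 then f x.1 else 0.
have FM : absum F M.
  apply: (@absum_pair _ (fun i => `|f i|)) => [i|]; last first.
    by apply: absum_le fM => i; rewrite normr_id.
  have := @absum_fin _ _ (fun j => F (i, j)) [:: pi i] isT.
  rewrite big_seq1 /F /= eqxx; apply => j; rewrite inE eq_sym.
  by move/negbTE ->.
have row i : has_sum (fun j => F (i, j)) (f i).
  have := @has_sum_fin _ _ (fun j => F (i, j)) [:: pi i] isT.
  rewrite big_seq1 /F /= eqxx; apply => j; rewrite inE eq_sym.
  by move/negbTE ->.
have col j : exists S, has_sum (fun i => F (i, j)) S.
  apply: (@absum_has_sum _ _ _ M); apply: absum_le fM => i.
  by rewrite /F; case: ifP; rewrite ?normr0.
have [g Hg] := choice col.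
by have [gM gS] := fubini_swap FM row Hg HS; exists g; split.
Qed.

Lemma has_sum_image (f : J -> C) (phi : I -> J) S : injective phi ->
  (forall j, ~ (exists i, j = phi i) -> f j = 0) -> has_sum f S ->
  has_sum (fun i => f (phi i)) S.
Proof.
move=> phiI f0 HS e e0; have [s0 H0] := HS e e0.
have [s1 H1] : exists s1 : seq I, forall i, phi i \in s0 -> i \in s1.
  elim: s0 {H0} => [|j s0 [s1 H1]]; first by exists [::].
  have [[i ji]|nji] := pselect (exists i, j = phi i).
    exists (i :: s1) => k; rewrite !inE ji => /orP[/eqP/phiI ->|/H1 ->]; rewrite ?eqxx ?orbT //.
  exists s1 => k; rewrite inE => /orP[/eqP kj|/H1 //].
  by case: nji; exists k.
exists s1 => s us sub; rewrite -(big_map phi xpredT f).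
have -> : \sum_(j <- map phi s) f j = \sum_(j <- undup (map phi s ++ s0)) f j.
  rewrite [RHS](bigID (mem (map phi s))) /= [X in _ + X]big_seq_cond [X in _ + X]big1 ?addr0.
    have P : perm_eq [seq j <- undup (map phi s ++ s0) | mem (map phi s) j] (map phi s).
      apply: uniq_perm; rewrite ?filter_uniq ?undup_uniq ?map_inj_uniq // => j.
      rewrite mem_filter mem_undup mem_cat -[mem _ j]/(j \in map phi s).
      by case: (j \in map phi s); rewrite // andbF.
    by rewrite -[RHS]big_filter (perm_big _ P).
  move=> j /andP[]; rewrite mem_undup mem_cat => /orP[->//|js0] jn; apply: f0 => -[i ji].
  by move: jn; rewrite ji map_f // sub // H1 // -ji.
apply: H0; first exact: undup_uniq.
by move=> j js0; rewrite mem_undup mem_cat js0 orbT.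
Qed.

Lemma absum_image (f : J -> C) (phi : I -> J) M : injective phi ->
  absum f M -> absum (fun i => f (phi i)) M.
Proof.
move=> phiI fM s us; rewrite -(big_map phi xpredT (fun j => `|f j|)).
by apply: fM; rewrite map_inj_uniq.
Qed.
End Regroup.

(** * Power series on polydiscs and their products *)

Section PowerSeries.
Variable R : realType.
Local Notation C := (Cx R).

Lemma rV_norm_entry n (h : 'rV[C]_n) i : `|h 0 i| <= `|h|.
Proof.
rewrite [leRHS]/Num.norm /= mx_normE -[leLHS]nngE num_le.
exact: (le_bigmax _ (fun ij : 'I_1 * 'I_n => `|h ij.1 ij.2|%:nng) (0, i)).
Qed.

Lemma rV_norm_lt n (h : 'rV[C]_n) r : 0 < r -> (forall i, `|h 0 i| < r) -> `|h| < r.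
Proof.
move=> r0 H; have [->|h0] := eqVneq `|h| 0; first by [].
have [[i j] /= E] : exists ij : 'I_1 * 'I_n, `|h| = `|h ij.1 ij.2|.
  exact: mx_norm_neq0.
by rewrite E ord1.
Qed.

Section Fixed.
Variable n : nat.
Local Notation mi := {ffun 'I_n -> nat}.
Implicit Types (c : mi -> C) (h a : 'rV[C]_n) (r s : C).

Definition powser c a r (f : 'rV[C]_n -> C) := forall h, `|h| < r ->
  (exists M, absum (fun alpha => c alpha * monomial h alpha) M) /\
  has_sum (fun alpha => c alpha * monomial h alpha) (f (a + h)).

Lemma sub_cube (s : seq mi) : exists N, forall M, (N <= M)%N -> {subset s <= cube n M}.
Proof.
elim: s => [|alpha s [N HN]]; first by exists 0%N.
exists (maxn N (\sum_i alpha i).+1) => M; rewrite geq_max => /andP[NM aM] beta.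
rewrite inE => /orP[/eqP ->|]; last exact: HN.
rewrite mem_cube; apply/forallP => i; apply: leq_trans aM.
by rewrite ltnS (bigD1 i) //= leq_addr.
Qed.

Lemma has_sum_cube (f : mi -> C) S : has_sum f S ->
  (\sum_(alpha <- cube n N) f alpha) @[N --> \oo] --> (S : C^o).
Proof.
move=> HS; apply/cvgrPdist_lt => e e0; have [s0 H0] := HS e e0.
have [N HN] := sub_cube s0.
exists N => // M /= NM; rewrite distrC; apply: H0; first exact: cube_uniq.
exact: HN.
Qed.

(** The cubes exhaust the finite sets of multi-indices, so under absolute convergence the limit
    along cubes and the unordered sum coincide. *)
Lemma analytic_atP (f : 'rV[C]_n -> C) a :
  analytic_at f a <-> exists c r, 0 < r /\ powser c a r f.
Proof.
split=> -[c [r [r0 H]]]; exists c, r; split => // h /H[[M HM] Hf].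
  have cM : absum (fun alpha => c alpha * monomial h alpha) M.
    move=> s us; have [N /(_ _ (leqnn N)) sN] := sub_cube s.
    apply: le_trans (HM N).
    exact: (ler_sum_subset (fun x => normr_ge0 _) us (cube_uniq n N) sN).
  split; first by exists M.
  have [S HS] := absum_has_sum cM; suff -> : f (a + h) = S by [].
  exact: (@cvg_unique C^o (@norm_hausdorff _ C^o) _ _ _ _ Hf (has_sum_cube HS)).
split; last exact: has_sum_cube.
by exists M => N; apply: HM; exact: cube_uniq.
Qed.

Lemma monomial0 (alpha : mi) : monomial (0 : 'rV[C]_n) alpha = (alpha == [ffun=> 0%N])%:R.
Proof.
have [->|] := eqVneq; first by rewrite /monomial big1 // => i _; rewrite ffunE.
move=> /eqP; rewrite /monomial => a0.
have [i ai] : exists i, alpha i != 0%N.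
  apply/existsP; apply: contra_notT a0 => /existsPn H; apply/ffunP => i.
  by have := H i; rewrite negbK ffunE => /eqP.
by rewrite (bigD1 i) //= mxE expr0n (negbTE ai) mul0r.
Qed.

Lemma monomial_le h r (alpha : mi) : (forall i, `|h 0 i| <= r) ->
  `|monomial h alpha| <= monomial (const_mx r) alpha.
Proof.
move=> H; rewrite /monomial normr_prod; apply: ler_prod => i _.
by rewrite normr_ge0 normrX mxE; apply: lerXn2r; rewrite ?nnegrE //; exact: le_trans (H i).
Qed.

Lemma monomial_const_gt0 r (alpha : mi) : 0 < r -> 0 < monomial (const_mx r : 'rV[C]_n) alpha.
Proof. by move=> r0; apply: prodr_gt0 => i _; rewrite mxE exprn_gt0. Qed.

Lemma const_mx_norm_lt s r : 0 <= s -> s < r -> `|const_mx s : 'rV[C]_n| < r.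
Proof.
move=> s0 sr; apply: rV_norm_lt => [|i]; first exact: le_lt_trans sr.
by rewrite mxE ger0_norm.
Qed.

Lemma powser_absum c a r f s : powser c a r f -> 0 <= s -> s < r ->
  exists M, absum (fun alpha => c alpha * monomial (const_mx s) alpha) M.
Proof. by move=> H s0 sr; have [] := H _ (const_mx_norm_lt s0 sr). Qed.

Lemma absum_polydisc c s M h : absum (fun alpha => c alpha * monomial (const_mx s) alpha) M ->
  0 <= s -> (forall i, `|h 0 i| <= s) -> absum (fun alpha => c alpha * monomial h alpha) M.
Proof.
move=> cM s0 hs; apply: absum_le cM => alpha; rewrite !normrM ler_wpM2l //.
apply: le_trans (monomial_le alpha hs) _; rewrite ger0_norm //.
by apply: prodr_ge0 => i _; rewrite mxE exprn_ge0.
Qed.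

(* The function w is the sum of a power series of norm at most rho in the Banach
   algebra of absolutely convergent series on the polydisc of radius s. *)
Definition series_on s rho (w : 'rV[C]_n -> C) := exists c,
  absum (fun alpha => c alpha * monomial (const_mx s) alpha) rho /\
  forall h, (forall i, `|h 0 i| <= s) -> has_sum (fun alpha => c alpha * monomial h alpha) (w h).

Lemma series_on1 s : series_on s 1 (fun=> 1).
Proof.
pose c (alpha : mi) : C := (alpha == [ffun=> 0%N])%:R; exists c.
have c0 h (alpha : mi) : alpha \notin [:: [ffun=> 0%N]] -> c alpha * monomial h alpha = 0.
  by rewrite inE /c => /negbTE ->; rewrite mul0r.
have c1 h : c [ffun=> 0%N] * monomial h [ffun=> 0%N] = 1.
  by rewrite /c eqxx /monomial mul1r big1 // => i _; rewrite ffunE.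
split=> [|h _].
  have := absum_fin (s := [:: [ffun=> 0%N]]) isT (c0 (const_mx s)).
  by rewrite big_seq1 c1 normr1.
by have := has_sum_fin (s := [:: [ffun=> 0%N]]) isT (c0 h); rewrite big_seq1 c1.
Qed.

Lemma series_onM s rho rho' w w' : 0 < s -> series_on s rho w -> series_on s rho' w' ->
  series_on s (rho * rho') (fun h => w h * w' h).
Proof.
move=> s0 [c [cM Hc]] [d [dM Hd]].
have s0' : 0 <= s by exact: ltW.
have at_ h (hs : forall i, `|h 0 i| <= s) :=
  regroup (fun x : mi * mi => Defs.addf x.1 x.2)
    (absum_prod (absum_polydisc cM s0' hs) (absum_polydisc dM s0' hs))
    (has_sum_prod (absum_polydisc cM s0' hs) (absum_polydisc dM s0' hs) (Hc h hs) (Hd h hs)).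
have cs i : `|(const_mx s : 'rV[C]_n) 0 i| <= s by rewrite mxE ger0_norm.
have [g [gM _ gE]] := at_ _ cs.
have ms0 gamma : monomial (const_mx s : 'rV[C]_n) gamma != 0.
  by rewrite gt_eqF // monomial_const_gt0.
(* The Cauchy product is regrouped at the corner [const_mx s] of the polydisc; dividing by the
   nonzero monomial there gives the coefficient, and the regrouped sums at any other [h] must agree
   with it. *)
exists (fun gamma => g gamma / monomial (const_mx s) gamma); split.
  by apply: absum_le gM => gamma; rewrite divfK.
move=> h hs; have [g' [_ g'S g'E]] := at_ h hs.
apply: has_sum_ext g'S => gamma; apply: has_sum_inj (g'E gamma) _.
rewrite mulrAC -mulrA.
apply: has_sum_ext (has_sumZr _ (gE gamma)) => -[alpha beta] /=.
case: eqP => [<-|]; last by rewrite mul0r.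
rewrite !monomialD; have ma := ms0 alpha; have mb := ms0 beta; field.
by rewrite ma mb.
Qed.

End Fixed.

End PowerSeries.

(** * Composition of analytic maps *)

Section Composition.
Variable R : realType.
Local Notation C := (Cx R).

Lemma series_on_prod m n s rho (w : 'I_n -> 'rV[C]_m -> C) (alpha : {ffun 'I_n -> nat}) :
  0 < s -> (forall i, series_on s rho (w i)) ->
  series_on s (monomial (const_mx rho : 'rV_n) alpha)
    (fun h => monomial (\row_i w i h) alpha).
Proof.
move=> s0 Hw.
have -> : (fun h => monomial (\row_i w i h) alpha) =
    (fun h => \prod_(i < n) w i h ^+ alpha i).
  by apply/funext => h; apply: eq_bigr => i _; rewrite mxE.
have -> : monomial (const_mx rho : 'rV_n) alpha = \prod_(i < n) rho ^+ alpha i.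
  by apply: eq_bigr => i _; rewrite mxE.
elim: (index_enum _) => [|i l IH].
  rewrite big_nil (_ : (fun=> _) = (fun=> 1)); first exact: series_on1.
  by apply/funext => h; rewrite big_nil.
rewrite big_cons (_ : (fun h => _) = (fun h => w i h ^+ alpha i *
    \prod_(j <- l) w j h ^+ alpha j)); last by apply/funext => h; rewrite big_cons.
apply: series_onM => //; elim: (alpha i) => [|k IHk]; first exact: series_on1.
rewrite exprS (_ : (fun h => _) = (fun h => w i h * w i h ^+ k)).
  exact: series_onM.
by apply/funext => h; rewrite exprS.
Qed.

(** Subtracting [k] affects the constant term only, which becomes [phi a - k]. Every other term has
    positive degree and shrinks at least by the factor [tau] when the radius does, so the norm on
    small polydiscs comes arbitrarily close to that of the constant term. *)
Lemma series_on_small m (phi : 'rV[C]_m -> C) a k rho :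
  analytic_at phi a -> `|phi a - k| < rho ->
  exists2 s0, 0 < s0 & forall s, 0 < s -> s <= s0 ->
    series_on s rho (fun h => phi (a + h) - k).
Proof.
move=> /analytic_atP[d [r [r0 Hd]]] lerho.
pose z : {ffun 'I_m -> nat} := [ffun=> 0%N].
pose dk alpha := if alpha == z then d alpha - k else d alpha.
have dkE h alpha : dk alpha * monomial h alpha =
    d alpha * monomial h alpha - (if alpha == z then k else 0) * monomial h alpha.
  by rewrite /dk; case: eqP; rewrite ?mulrBl // mul0r subr0.
have mz (h : 'rV[C]_m) : monomial h z = 1.
  by rewrite /monomial big1 // => i _; rewrite ffunE.
have kfin h alpha : alpha \notin [:: z] ->
    (if alpha == z then k else 0) * monomial h alpha = 0.
  by rewrite inE => /negbTE ->; rewrite mul0r.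
have kS h : has_sum (fun alpha => (if alpha == z then k else 0) * monomial h alpha) k.
  by have := has_sum_fin (s := [:: z]) isT (kfin h); rewrite big_seq1 eqxx mz mulr1.
have dkS h : `|h| < r -> has_sum (fun alpha => dk alpha * monomial h alpha) (phi (a + h) - k).
  move=> /Hd[_ /has_sumB/(_ (kS h))]; apply: has_sum_ext => alpha.
  by rewrite dkE.
have dz : dk z = phi a - k.
  apply: esym; have := dkS 0; rewrite normr0 addr0 => /(_ r0) /has_sum_inj; apply.
  have := @has_sum_fin _ _ (fun alpha => dk alpha * monomial (0 : 'rV[C]_m) alpha) [:: z] isT.
  rewrite big_seq1 mz mulr1; apply => alpha; rewrite inE => /negbTE az.
  by rewrite monomial0 az mulr0.
pose s1 := r / 2; have s10 : 0 < s1 by rewrite /s1 divr_gt0.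
have s1r : s1 < r by rewrite [ltRHS]splitr ltrDl.
have [M1 HM1] := powser_absum Hd (ltW s10) s1r.
pose M := M1 + `|k|.
have HM : absum (fun alpha => dk alpha * monomial (const_mx s1) alpha) M.
  have kM : absum (fun alpha => (if alpha == z then k else 0) * monomial (const_mx s1) alpha) `|k|.
    by have := absum_fin (s := [:: z]) isT (kfin (const_mx s1)); rewrite big_seq1 eqxx mz mulr1.
  have := absumD HM1 (absumZ (-1) kM); rewrite normrN normr1 mul1r.
  by apply: absum_le => alpha; rewrite dkE mulN1r.
have M0 := absum_ge0 HM.
(* [eps] is the room left beside the constant term; [tau] below is at most 1 and makes
   [tau * M <= eps]. *)
pose eps := rho - `|phi a - k|; have eps0 : 0 < eps by rewrite subr_gt0.
pose tau := eps / (eps + M); have epsM : 0 < eps + M by rewrite ltr_wpDr.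
have tau0 : 0 < tau by rewrite divr_gt0.
have tau1 : tau <= 1 by rewrite ler_pdivrMr // mul1r lerDl.
have tauM : tau * M <= eps.
  by rewrite /tau mulrAC ler_pdivrMr // ler_wpM2l ?lerDr ?ltW.
exists (tau * s1) => [|s s0 sle]; first exact: mulr_gt0.
have ss1 : s <= s1 by apply: le_trans sle _; rewrite ler_piMl // ltW.
exists dk; split; last first.
  move=> h hs; apply: dkS; apply: rV_norm_lt => // i.
  by apply: le_lt_trans (hs i) _; apply: le_lt_trans s1r.
have step alpha : alpha != z ->
    `|dk alpha * monomial (const_mx s) alpha| <= tau * `|dk alpha * monomial (const_mx s1) alpha|.
  move=> az; rewrite !normrM mulrCA ler_wpM2l //.
  rewrite (ger0_norm (ltW (monomial_const_gt0 alpha s0))).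
  rewrite (ger0_norm (ltW (monomial_const_gt0 alpha s10))).
  have [s0' s10'] := (ltW s0, ltW s10).
  have [i ai] : exists i, alpha i != 0%N.
    apply/existsP; apply: contraNT az => /existsPn H; apply/eqP/ffunP => i.
    by have := H i; rewrite negbK ffunE => /eqP.
  have E t : monomial (const_mx t : 'rV[C]_m) alpha =
      t ^+ alpha i * \prod_(j | j != i) t ^+ alpha j.
    by rewrite /monomial (bigD1 i) //= mxE; under eq_bigr do rewrite mxE.
  rewrite !E mulrA; apply: ler_pM.
  - by rewrite exprn_ge0 ?ltW.
  - by apply: prodr_ge0 => j _; rewrite exprn_ge0 ?ltW.
  - case: (alpha i) ai => // k' _; rewrite !exprS mulrA.
    by apply: ler_pM; rewrite ?exprn_ge0 //; apply: lerXn2r; rewrite ?nnegrE.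
  apply: ler_prod => j _; rewrite exprn_ge0 //=.
  by apply: lerXn2r; rewrite ?nnegrE.
move=> l ul; rewrite (bigID (pred1 z)) /=.
apply: (@le_trans _ _ (`|phi a - k| + eps)); last by rewrite /eps addrC subrK.
apply: lerD.
  have [zl|zl] := boolP (z \in l).
    rewrite (big_rem z) //= eqxx dz mz mulr1 big_seq_cond big1 ?addr0 // => i.
    by rewrite mem_rem_uniq // !inE => /andP[/andP[/negbTE ->]].
  rewrite big_seq_cond big1 // => i /andP[il /eqP iz].
  by move: zl; rewrite -iz il.
apply: le_trans tauM.
apply: le_trans (ler_sum _ (fun i iz => step i iz)) _.
rewrite -mulr_sumr ler_wpM2l ?(ltW tau0) //.
by rewrite -big_filter; apply: HM; exact: filter_uniq.
Qed.

Lemma common_radius n (P : 'I_n -> C -> Prop) :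
  (forall i, exists2 s0, 0 < s0 & forall s, 0 < s -> s <= s0 -> P i s) ->
  exists2 s, 0 < s & forall i, P i s.
Proof.
move=> H.
have [s s0 Hs] : exists2 s0, 0 < s0 & forall i, i \in enum 'I_n ->
    forall s, 0 < s -> s <= s0 -> P i s.
  elim: (enum _) => [|i l [s0 s00 IH]]; first by exists 1.
  (* A positive number below both radii that avoids a minimum in the partial order of the complex
     numbers; the device recurs below. *)
  have [t0 t00 Ht] := H i; exists (s0 * t0 / (s0 + t0)).
    by rewrite divr_gt0 ?mulr_gt0 ?addr_gt0.
  have le1 : s0 * t0 / (s0 + t0) <= t0.
    by rewrite ler_pdivrMr ?addr_gt0 // mulrC ler_wpM2l ?lerDl ?ltW.
  have le2 : s0 * t0 / (s0 + t0) <= s0.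
    by rewrite ler_pdivrMr ?addr_gt0 // ler_wpM2l ?lerDr ?ltW.
  move=> j; rewrite inE => /orP[/eqP ->|jl] s sgt0 sle.
    by apply: Ht => //; exact: le_trans le1.
  by apply: IH => //; exact: le_trans le2.
by exists s => // i; apply: Hs; rewrite ?mem_enum.
Qed.

(** The series of [F] may be centred at a point [b] other than [phi a]; with [phi] the identity this
    recentres a power series. Substituting series of norm [rho < r] keeps the double family of
    coefficients summable, and Fubini collects it by powers of [h]. *)
Theorem analytic_at_comp_powser m n c b r (F : 'rV[C]_n -> C) (phi : 'rV[C]_m -> 'rV[C]_n) a :
  powser c b r F -> (forall i, analytic_at (fun z => phi z 0 i) a) -> `|phi a - b| < r ->
  analytic_at (F \o phi) a.
Proof.
move=> HF Hphi phir.
pose rho := (`|phi a - b| + r) / 2.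
have r0 : 0 < r by exact: le_lt_trans phir.
have rho0 : 0 < rho by rewrite divr_gt0 // ltr_wpDl.
have rhor : rho < r by rewrite ltr_pdivrMr // mulr_natr mulr2n ltrD2r.
have phirho : `|phi a - b| < rho by rewrite ltr_pdivlMr // mulr_natr mulr2n ltrD2l.
have small i : exists2 s0, 0 < s0 & forall s, 0 < s -> s <= s0 ->
    series_on s rho (fun h => phi (a + h) 0 i - b 0 i).
  apply: series_on_small (Hphi i) (le_lt_trans _ phirho).
  by have := rV_norm_entry (phi a - b) i; rewrite !mxE.
have [s s0 Hs] := common_radius small.
have cs i : `|(const_mx s : 'rV[C]_m) 0 i| <= s by rewrite mxE ger0_norm // ltW.
pose w (h : 'rV[C]_m) : 'rV[C]_n := \row_i (phi (a + h) 0 i - b 0 i).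
have wE (h : 'rV[C]_m) : phi (a + h) = b + w h by apply/rowP => i; rewrite !mxE [RHS]addrC subrK.
have [E HE] := choice (fun alpha => series_on_prod alpha s0 Hs).
have [M HM] := powser_absum HF (ltW rho0) rhor.
have wr (h : 'rV[C]_m) : (forall i, `|h 0 i| <= s) -> `|w h| < r.
  move=> hs; apply: le_lt_trans (_ : _ <= rho) rhor.
  have wi i : `|w h 0 i| <= rho.
    rewrite mxE; have [d [dM Hd]] := Hs i.
    exact: has_sum_norm (Hd h hs) (absum_polydisc dM (ltW s0) hs).
  have [->|w0] := eqVneq `|w h| 0; first exact: ltW.
  have [[i j] /= ->] : exists ij : 'I_1 * 'I_n, `|w h| = `|w h ij.1 ij.2|.
    exact: mx_norm_neq0.
  by rewrite ord1.
have FM (h : 'rV[C]_m) : (forall i, `|h 0 i| <= s) ->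
    absum (fun x : {ffun 'I_n -> nat} * {ffun 'I_m -> nat} => c x.1 * E x.1 x.2 * monomial h x.2) M.
  move=> hs; apply: (@absum_pair _ _ _ _ (fun alpha => `|c alpha| * monomial (const_mx rho) alpha)).
    move=> alpha; have [eM _] := HE alpha.
    apply: absum_le (absumZ (c alpha) (absum_polydisc eM (ltW s0) hs)) => beta.
    by rewrite mulrA.
  by apply: absum_le HM => alpha; rewrite !normrM normr_id.
have rows (h : 'rV[C]_m) : (forall i, `|h 0 i| <= s) -> forall alpha,
    has_sum (fun beta => c alpha * E alpha beta * monomial h beta) (c alpha * monomial (w h) alpha).
  move=> hs alpha; have [_ /(_ h hs) /(has_sumZ (c alpha))] := HE alpha.
  by apply: has_sum_ext => beta; rewrite mulrA.
have col beta : exists S, has_sum (fun alpha => c alpha * E alpha beta) S.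
  have mb := gt_eqF (monomial_const_gt0 beta s0).
  apply: (@absum_has_sum _ _ _ (M / `|monomial (const_mx s : 'rV[C]_m) beta|)).
  move=> l ul; rewrite ler_pdivlMr ?normr_gt0 ?mb // mulr_suml.
  under eq_bigr do rewrite -normrM.
  have := FM _ cs [seq (alpha, beta) | alpha <- l]; rewrite big_map; apply.
  by rewrite map_inj_uniq // => ? ? [].
have [G HG] := choice col.
have key (h : 'rV[C]_m) : (forall i, `|h 0 i| <= s) ->
    absum (fun beta => G beta * monomial h beta) M /\
    has_sum (fun beta => G beta * monomial h beta) (F (phi (a + h))).
  move=> hs; rewrite wE; have [_ FS] := HF _ (wr h hs).
  apply: fubini_swap (FM h hs) (rows h hs) _ FS => beta.
  exact: (has_sum_ext _ (has_sumZr (monomial h beta) (HG beta))).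
apply/analytic_atP; exists G, s; split => // h hs.
have hs' i : `|h 0 i| <= s by apply: ltW; apply: le_lt_trans hs; exact: rV_norm_entry.
by have [K1 K2] := key h hs'; split; first by exists M.
Qed.

Lemma analytic_at_comp m n (F : 'rV[C]_n -> C) (phi : 'rV[C]_m -> 'rV[C]_n) a :
  analytic_at F (phi a) -> (forall i, analytic_at (fun z => phi z 0 i) a) ->
  analytic_at (F \o phi) a.
Proof.
move=> /analytic_atP[c [r [r0 HF]]] Hphi.
by apply: analytic_at_comp_powser HF Hphi _; rewrite subrr normr0.
Qed.

Lemma analytic_at_coord n (i : 'I_n) (a : 'rV[C]_n) : analytic_at (fun z : 'rV[C]_n => z 0 i) a.
Proof.
pose z : {ffun 'I_n -> nat} := [ffun=> 0%N]; pose e : {ffun 'I_n -> nat} := [ffun j => (j == i) : nat].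
have ez : e != z by apply/eqP => /ffunP/(_ i); rewrite !ffunE eqxx.
pose c alpha : C := if alpha == z then a 0 i else (alpha == e)%:R.
apply/analytic_atP; exists c, 1; split => // h _.
have c0 alpha : alpha \notin [:: z; e] -> c alpha * monomial h alpha = 0.
  by rewrite !inE negb_or /c => /andP[/negbTE -> /negbTE ->]; rewrite mul0r.
have uze : uniq [:: z; e] by rewrite /= inE eq_sym ez.
split; first by exists (\sum_(alpha <- [:: z; e]) `|c alpha * monomial h alpha|); exact: absum_fin.
have := has_sum_fin uze c0; rewrite big_cons big_seq1 /c eqxx (negbTE ez) eqxx mul1r.
have -> : monomial h z = 1 by rewrite /monomial big1 // => j _; rewrite ffunE.
have -> : monomial h e = h 0 i.
  rewrite /monomial (bigD1 i) //= big1 ?mulr1 => [|j /negbTE ji]; rewrite ffunE ?eqxx //.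
  by rewrite ji.
by rewrite mulr1 mxE.
Qed.

Lemma powser_near n c a r (F : 'rV[C]_n -> C) : powser c a r F ->
  forall b, `|b - a| < r -> analytic_at F b.
Proof.
move=> HF b br; apply: (@analytic_at_comp_powser n n c a r F id b HF) => // i.
exact: analytic_at_coord.
Qed.

Lemma analytic_at_near n (f : 'rV[C]_n -> C) a :
  analytic_at f a -> \forall b \near a, analytic_at f b.
Proof.
move=> /analytic_atP[c [r [r0 Hf]]].
apply/nbhs_ballP; exists r => //= b; rewrite -ball_normE /= => ab.
by apply: powser_near Hf _ _; rewrite distrC.
Qed.

Lemma analytic_at_eq n (f g : 'rV[C]_n -> C) a :
  (\forall z \near a, f z = g z) -> analytic_at f a -> analytic_at g a.
Proof.
move=> /nbhs_ballP[e /= e0 fg] /analytic_atP[c [r [r0 Hf]]].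
apply/analytic_atP; exists c, (r * e / (r + e)).
split; first by rewrite divr_gt0 ?mulr_gt0 ?addr_gt0.
move=> h hr.
have hlr : `|h| < r.
  by apply: lt_le_trans hr _; rewrite ler_pdivrMr ?addr_gt0 // ler_wpM2l ?lerDr ?ltW.
have hle : `|h| < e.
  by apply: lt_le_trans hr _; rewrite ler_pdivrMr ?addr_gt0 // mulrC ler_wpM2l ?lerDl ?ltW.
rewrite -fg; first exact: Hf.
by rewrite -ball_normE /= opprD addrA subrr sub0r normrN.
Qed.

End Composition.

(** * Termwise differentiation *)

Section Derivatives.
Variable R : realType.
Local Notation C := (Cx R).

(** The left side is one term of the binomial expansion of the [m]-th power of [x + eps]. *)
Lemma power_derivative_bound (x eps rho : C) m : 0 <= x -> 0 <= eps -> x + eps <= rho ->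
  m%:R * x ^+ m.-1 * eps <= rho ^+ m.
Proof.
move=> x0 e0 xe; have rho0 : 0 <= rho by apply: le_trans xe; exact: addr_ge0.
have xrho : x <= rho by apply: le_trans xe; rewrite lerDl.
case: m => [|m] /=; first by rewrite !mul0r expr0 ler01.
elim: m => [|m IH]; first by rewrite expr0 !mul1r expr1; apply: le_trans xe; rewrite lerDr.
rewrite (_ : _ * eps = x * (m.+1%:R * x ^+ m * eps) + eps * x ^+ m.+1); last first.
  by rewrite -[m.+2%:R]natr1 [x ^+ m.+1]exprS; ring.
apply: (@le_trans _ _ (x * rho ^+ m.+1 + eps * rho ^+ m.+1)).
  by apply: lerD; apply: ler_wpM2l => //; apply: lerXn2r; rewrite ?nnegrE.
by rewrite -mulrDl [leRHS]exprS ler_wpM2r // exprn_ge0.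
Qed.

(** The quadratic remainder of a single power, with [eps] and [rho] independent of [m], so that the
    remainders of all monomials can be added up. *)
Lemma power_taylor2 (x z eps rho : C) m : 0 <= eps -> `|x| + eps + eps <= rho -> `|z| <= eps ->
  exists2 q, (x + z) ^+ m = x ^+ m + m%:R * x ^+ m.-1 * z + z ^+ 2 * q &
    `|q| * eps ^+ 2 <= rho ^+ m.
Proof.
move=> e0 xe ze.
have rho0 : 0 <= rho by apply: le_trans xe; rewrite !addr_ge0.
elim: m => [|m [q E Hq]]; first by exists 0; rewrite ?normr0 ?mul0r ?expr0 ?ler01 //; ring.
exists ((x + z) * q + m%:R * x ^+ m.-1).
  have Em : m%:R * x ^+ m = m%:R * x ^+ m.-1 * x.
    by case: (m) => [|k]; rewrite ?mul0r //= exprSr mulrA.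
  rewrite exprS E /= -natr1 [x ^+ m.+1]exprS [(m%:R + 1) * _]mulrDl Em; ring.
apply: le_trans (ler_wpM2r _ (ler_normD _ _)) _; first exact: exprn_ge0.
rewrite mulrDl [leRHS]exprS; apply: le_trans (_ : (`|x| + eps) * rho ^+ m + rho ^+ m * eps <= _).
  apply: lerD.
    rewrite normrM -mulrA; apply: ler_pM => //; first by rewrite mulr_ge0 ?exprn_ge0.
    by apply: le_trans (ler_normD _ _) _; rewrite lerD2l.
  rewrite expr2 mulrA; apply: ler_wpM2r => //.
  rewrite normrM normr_nat normrX; apply: power_derivative_bound => //.
  by apply: le_trans xe; rewrite lerDl.
by rewrite mulrC -mulrDr mulrC ler_wpM2r // exprn_ge0.
Qed.

Section Fixed.
Variable n : nat.
Local Notation mi := {ffun 'I_n -> nat}.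
Implicit Types (c : mi -> C) (h a : 'rV[C]_n) (r s : C) (k : 'I_n).

Definition incr k (alpha : mi) : mi := [ffun j => (alpha j + (j == k))%N].

Lemma incr_inj k : injective (incr k).
Proof. by move=> alpha beta /ffunP E; apply/ffunP => j; have := E j; rewrite !ffunE => /addIn. Qed.

Lemma incr_image k (alpha : mi) : alpha k != 0%N -> exists beta, alpha = incr k beta.
Proof.
move=> ak; exists [ffun j => (alpha j - (j == k))%N]; apply/ffunP => j; rewrite !ffunE subnK //.
by case: eqP => // ->; rewrite lt0n.
Qed.

Definition dcoef k c (alpha : mi) : C := (alpha k).+1%:R * c (incr k alpha).

Definition dmonomial k h (alpha : mi) : C :=
  (alpha k)%:R * h 0 k ^+ (alpha k).-1 * \prod_(j | j != k) h 0 j ^+ alpha j.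

Lemma monomial_split k h (alpha : mi) :
  monomial h alpha = h 0 k ^+ alpha k * \prod_(j | j != k) h 0 j ^+ alpha j.
Proof. by rewrite /monomial (bigD1 k). Qed.

Lemma dmonomial_incr k h (alpha : mi) :
  dmonomial k h (incr k alpha) = (alpha k).+1%:R * monomial h alpha.
Proof.
rewrite /dmonomial (monomial_split k) !ffunE eqxx addn1 /= -mulrA; congr (_ * (_ * _)).
by apply: eq_bigr => j /negbTE jk; rewrite ffunE jk addn0.
Qed.

Lemma monomial_incr k h (alpha : mi) : monomial h (incr k alpha) = h 0 k * monomial h alpha.
Proof.
rewrite !(monomial_split k) !ffunE eqxx addn1 exprS -mulrA; congr (_ * (_ * _)).
by apply: eq_bigr => j /negbTE jk; rewrite ffunE jk addn0.
Qed.

Definition partial k (F : 'rV[C]_n -> C) (y : 'rV[C]_n) : C :=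
  derive1 (fun z : C => F (y + z *: delta_mx 0 k) : C^o) 0.

(** Term by term, [F] differs from its linear part by the square of [z] times a summable family.
    Hence the difference quotient tends to the sum [D] of the differentiated series. *)
Lemma powser_derive_at c a r F k h : powser c a r F -> `|h| < r ->
  exists D, [/\ exists M, absum (fun alpha => dcoef k c alpha * monomial h alpha) M,
    has_sum (fun alpha => dcoef k c alpha * monomial h alpha) D &
    is_derive (0 : C^o) 1 (fun z : C^o => F (a + h + (z : C) *: delta_mx 0 k) : C^o) D].
Proof.
move=> HF hr.
(* A third of the gap: two steps of size [eps] are spent inside [rho], and the third keeps
   [rho < r]. *)
pose eps := (r - `|h|) / 3; have eps0 : 0 < eps by rewrite divr_gt0 // subr_gt0.
pose rho := `|h| + eps + eps.
have rho0 : 0 <= rho by rewrite /rho !addr_ge0 // ltW.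
have rE : rho + eps = r by rewrite /rho /eps; field.
have rhor : rho < r by rewrite -rE ltrDl.
have hk : `|h 0 k| + eps + eps <= rho by rewrite /rho !lerD2r rV_norm_entry.
have hle j : `|h 0 j| <= rho.
  by apply: le_trans (rV_norm_entry h j) _; rewrite /rho -addrA lerDl addr_ge0 // ltW.
have [M HM] := powser_absum HF rho0 rhor.
have M0 := absum_ge0 HM.
have rest0 (alpha : mi) : 0 <= \prod_(j | j != k) rho ^+ alpha j.
  by apply: prodr_ge0 => j _; rewrite exprn_ge0.
have restle (alpha : mi) : `|\prod_(j | j != k) h 0 j ^+ alpha j| <= \prod_(j | j != k) rho ^+ alpha j.
  rewrite normr_prod; apply: ler_prod => j _; rewrite normr_ge0 normrX.
  by apply: lerXn2r; rewrite ?nnegrE.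
have rhoE (alpha : mi) : monomial (const_mx rho : 'rV_n) alpha =
    rho ^+ alpha k * \prod_(j | j != k) rho ^+ alpha j.
  by rewrite (monomial_split k) mxE; under eq_bigr do rewrite mxE.
have normE (alpha : mi) : `|c alpha * monomial (const_mx rho) alpha| =
    `|c alpha| * (rho ^+ alpha k * \prod_(j | j != k) rho ^+ alpha j).
  by rewrite normrM rhoE (ger0_norm (mulr_ge0 (exprn_ge0 _ rho0) (rest0 alpha))).
have dM : absum (fun alpha => c alpha * dmonomial k h alpha) (M / eps).
  move=> s us; rewrite ler_pdivlMr // mulr_suml; apply: le_trans (HM s us).
  apply: ler_sum => alpha _; rewrite normE normrM -mulrA ler_wpM2l //.
  rewrite normrM mulrAC; apply: ler_pM => //; first by rewrite mulr_ge0 ?(ltW eps0).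
  rewrite normrM normr_nat normrX; apply: power_derivative_bound; rewrite ?(ltW eps0) //.
  by apply: le_trans hk; rewrite lerDl ltW.
have [D HD] := absum_has_sum dM.
have coefE alpha : c (incr k alpha) * dmonomial k h (incr k alpha) =
    dcoef k c alpha * monomial h alpha.
  by rewrite dmonomial_incr /dcoef mulrCA mulrA.
exists D; split.
- exists (M / eps); apply: absum_le (absum_image (@incr_inj k) dM) => alpha.
  by rewrite coefE.
- apply: has_sum_ext (has_sum_image (@incr_inj k) _ HD) => [alpha|]; first exact: coefE.
  move=> alpha na; have -> : dmonomial k h alpha = 0; last by rewrite mulr0.
  rewrite /dmonomial; have [->|ak] := eqVneq (alpha k) 0%N; first by rewrite !mul0r.
  by case: na; have [b ->] := incr_image ak; exists b.
have quad z : `|z| <= eps ->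
    `|F (a + h + z *: delta_mx 0 k) - F (a + h) - z * D| <= `|z| ^+ 2 * (M / eps ^+ 2).
  move=> ze.
  have hz : `|h + z *: delta_mx 0 k| < r.
    apply: le_lt_trans rhor; apply: le_trans (ler_normD _ _) _.
    rewrite normrZ /rho -addrA lerD2l; apply: (@le_trans _ _ eps); last by rewrite lerDl ltW.
    apply: le_trans (_ : `|z| * 1 <= _); last by rewrite mulr1.
    apply: ler_wpM2l => //.
    have [->|d0] := eqVneq `|delta_mx 0 k : 'rV[C]_n| 0; first exact: ler01.
    have [[i j] /= ->] : exists ij : 'I_1 * 'I_n,
        `|delta_mx 0 k : 'rV[C]_n| = `|(delta_mx 0 k : 'rV[C]_n) ij.1 ij.2|.
      exact: mx_norm_neq0.
    by rewrite mxE normr_nat lern1 leq_b1.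
  have [_ S1] := HF _ hz; have [_ S2] := HF _ hr.
  have S := has_sumB (has_sumB S1 S2) (has_sumZ z HD); rewrite addrA in S.
  apply: has_sum_norm S _ => s us; rewrite mulrA ler_pdivlMr ?exprn_gt0 // mulr_suml.
  apply: le_trans (ler_wpM2l (exprn_ge0 2 (normr_ge0 z)) (HM s us)).
  rewrite mulr_sumr; apply: ler_sum => alpha _; rewrite normE.
  have [q E Hq] := @power_taylor2 (h 0 k) z eps rho (alpha k) (ltW eps0) hk ze.
  rewrite (monomial_split k (h + _)) (monomial_split k h) !mxE !eqxx mulr1 E.
  rewrite (eq_bigr (fun j => h 0 j ^+ alpha j)) => [|j /negbTE jk]; last first.
    by rewrite !mxE jk mulr0 addr0.
  rewrite /dmonomial; set P := \prod_(j | _) h 0 j ^+ _.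
  rewrite (_ : _ - _ - _ = z ^+ 2 * (c alpha * (q * P))); last by ring.
  rewrite normrM normrX -mulrA; apply: ler_wpM2l; first exact: exprn_ge0.
  rewrite normrM -mulrA; apply: ler_wpM2l => //.
  rewrite normrM mulrAC; apply: ler_pM => //; first by rewrite mulr_ge0 ?exprn_ge0 // ltW.
  exact: restle.
pose f (z : C^o) := F (a + h + (z : C) *: delta_mx 0 k) : C^o.
have cvgD : t^-1 *: (f (t *: (1 : C^o) + 0) - f 0) @[t --> (0:C)^'] --> (D : C^o).
  apply/cvgrPdist_lt => e e0; pose K := M / eps ^+ 2.
  have K0 : 0 <= K by rewrite /K divr_ge0 // exprn_ge0 // ltW.
  have K1 : 0 < K + 1 by rewrite ltr_wpDl.
  pose de := eps * (e / (K + 1)) / (eps + e / (K + 1)).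
  have eK : 0 < e / (K + 1) by rewrite divr_gt0.
  have de0 : 0 < de by apply: divr_gt0; [exact: mulr_gt0|exact: addr_gt0].
  have le1 : de <= eps.
    rewrite /de ler_pdivrMr ?addr_gt0 //; apply: ler_wpM2l; first exact: ltW.
    by rewrite lerDr ltW.
  have le2 : de <= e / (K + 1).
    rewrite /de ler_pdivrMr ?addr_gt0 // mulrC; apply: ler_wpM2l; first exact: ltW.
    by rewrite lerDl ltW.
  exists de => // t; rewrite /= sub0r normrN => tde t0.
  rewrite /f scale0r addr0 addr0.
  have -> : t *: (1 : C^o) = t by rewrite /GRing.scale /= mulr1.
  set A := F (a + h + t *: _) ; set B := F (a + h).
  have -> : D - t^-1 *: (A - B : C^o) = - (t^-1 * (A - B - t * D)).
    by rewrite /GRing.scale /= [in RHS]mulrBr mulKf // opprB.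
  rewrite normrN normrM normfV mulrC ltr_pdivrMr ?normr_gt0 //.
  apply: le_lt_trans (quad t (ltW (lt_le_trans tde le1))) _.
  rewrite expr2 -mulrA mulrC ltr_pM2r ?normr_gt0 //.
  apply: le_lt_trans (_ : _ <= de * K) _.
    by apply: ler_wpM2r => //; exact: ltW.
  apply: le_lt_trans (ler_wpM2r K0 le2) _.
  by rewrite mulrAC ltr_pdivrMr // ltr_pM2l // ltrDl.
apply: DeriveDef.
  by apply/cvg_ex; exists D.
by rewrite /derive; apply: (cvg_lim (@norm_hausdorff _ C^o)) cvgD.
Qed.

Lemma partialE F y k (D : C) :
  is_derive (0 : C^o) 1 (fun z : C^o => F (y + (z : C) *: delta_mx 0 k) : C^o) D ->
  partial k F y = D.
Proof. by move=> H; rewrite /partial derive1E; exact: (@derive_val _ _ _ _ _ _ _ H). Qed.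

Lemma powser_partial c a r F k : powser c a r F -> powser (dcoef k c) a r (partial k F).
Proof.
move=> HF h hr; have [D [HM HD Hd]] := powser_derive_at k HF hr.
by split => //; rewrite (partialE Hd).
Qed.

Lemma analytic_at_is_derive F y k : analytic_at F y ->
  is_derive (0 : C^o) 1 (fun z : C^o => F (y + (z : C) *: delta_mx 0 k) : C^o) (partial k F y).
Proof.
move=> /analytic_atP[c [r [r0 HF]]].
have z0 : `|0 : 'rV[C]_n| < r by rewrite normr0.
have [D [_ _ Hd]] := powser_derive_at k HF z0; rewrite addr0 in Hd.
by rewrite (partialE Hd).
Qed.

Lemma analytic_at_partial F y k : analytic_at F y -> analytic_at (partial k F) y.
Proof.
move=> /analytic_atP[c [r [r0 HF]]]; apply/analytic_atP.
by exists (dcoef k c), r; split => //; exact: powser_partial.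
Qed.

End Fixed.
End Derivatives.

(** * Flat germs and Hadamard's lemma *)

Section Hadamard.
Variable R : realType.
Local Notation C := (Cx R).

Section Fixed.
Variable n : nat.
Local Notation mi := {ffun 'I_n -> nat}.
Implicit Types (c : mi -> C) (h a y z : 'rV[C]_n) (k l : 'I_n).

Lemma powser0 c a r F : 0 < r -> powser c a r F -> c [ffun=> 0%N] = F a.
Proof.
move=> r0 /(_ 0); rewrite normr0 addr0 => /(_ r0)[_ HF].
apply: esym; apply: has_sum_inj HF _.
have := @has_sum_fin _ _ (fun alpha => c alpha * monomial (0 : 'rV[C]_n) alpha)
  [:: [ffun=> 0%N]] isT.
rewrite big_seq1 monomial0 eqxx mulr1; apply => alpha; rewrite inE => /negbTE az.
by rewrite monomial0 az mulr0.
Qed.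

(** Both sides are constant terms of a twice differentiated series, and the two increments of the
    multi-index commute. *)
Lemma partialC F y k l : analytic_at F y ->
  partial k (partial l F) y = partial l (partial k F) y.
Proof.
move=> /analytic_atP[c [r [r0 HF]]].
have H1 := powser_partial k (powser_partial l HF).
have H2 := powser_partial l (powser_partial k HF).
rewrite -(powser0 r0 H1) -(powser0 r0 H2) /dcoef.
rewrite mulrCA [RHS]mulrCA !mulrA.
have -> : incr l (incr k [ffun=> 0%N]) = incr k (incr l [ffun=> 0%N]).
  by apply/ffunP => j; rewrite !ffunE addnAC.
by rewrite !ffunE [l == k]eq_sym [_.+1%:R * _]mulrC.
Qed.

Lemma flat_coef c a r F : 0 < r -> powser c a r F ->
  (forall w, foldr (@partial R n) F w a = 0) -> forall alpha, c alpha = 0.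
Proof.
move=> r0 HF Hw alpha; move: {2}(\sum_i alpha i)%N (erefl (\sum_i alpha i)%N) => s.
elim: s c F HF Hw alpha => [|s IH] c F HF Hw alpha.
  move=> /eqP; rewrite sum_nat_eq0 => /forallP a0.
  have -> : alpha = [ffun=> 0%N] by apply/ffunP => i; rewrite ffunE; apply/eqP; exact: a0.
  by rewrite (powser0 r0 HF); exact: (Hw [::]).
move=> as1; have [k ak] : exists k, alpha k != 0%N.
  apply/existsP; apply: contra_eqT as1 => /existsPn H; rewrite big1 // => i _.
  by have := H i; rewrite negbK => /eqP.
have [beta bE] := incr_image ak.
have bs : (\sum_i beta i = s)%N.
  apply: succn_inj; rewrite -as1 bE; under [RHS]eq_bigr do rewrite ffunE.
  by rewrite big_split /= -big_mkcond /= big_pred1_eq addn1.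
have := IH _ _ (powser_partial k HF) _ beta bs; rewrite /dcoef -bE => H.
have /eqP : (beta k).+1%:R * c alpha = 0.
  by apply: H => w; have := Hw (rcons w k); rewrite -cats1 foldr_cat.
by rewrite mulf_eq0 pnatr_eq0 /= => /eqP.
Qed.

Lemma flat_eq0 F a : analytic_at F a -> (forall w, foldr (@partial R n) F w a = 0) ->
  \forall z \near a, F z = 0.
Proof.
move=> /analytic_atP[c [r [r0 HF]]] Hw.
apply/nbhs_ballP; exists r => //= z; rewrite -ball_normE /= => az.
have zr : `|z - a| < r by rewrite distrC.
have [_] := HF _ zr; rewrite [a + _]addrC subrK => /has_sum_inj; apply.
have := @has_sum_fin _ _ (fun alpha => c alpha * monomial (z - a) alpha) [::] isT.
by rewrite big_nil; apply => alpha _; rewrite (flat_coef r0 HF Hw) mul0r.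
Qed.

Definition reset (P : pred 'I_n) a z : 'rV[C]_n := \row_j if P j then a 0 j else z 0 j.

(** The quotient is the series with the exponent of coordinate [k] lowered by one. It converges
    because the [k]-th derivative has the same terms with an additional integer factor at least
    1. *)
Lemma hadamard1 F a k : analytic_at F a -> exists2 H, analytic_at H a &
  \forall z \near a, F z - F (reset (pred1 k) a z) = (z 0 k - a 0 k) * H z.
Proof.
move=> /analytic_atP[c [r [r0 HF]]].
have Hex z : exists S, `|z - a| < r ->
    has_sum (fun alpha => c (incr k alpha) * monomial (z - a) alpha) S.
  have [zr|] := boolP (`|z - a| < r); last by exists 0.
  have [D [[M HM] _ _]] := powser_derive_at k HF zr.
  have [|S HS] := @absum_has_sum _ _ (fun alpha => c (incr k alpha) * monomial (z - a) alpha) M.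
    apply: absum_le HM => alpha; rewrite /dcoef -mulrA [leRHS]normrM ler_peMl //.
    by rewrite normr_nat ler1n.
  by exists S.
have [H HH] := choice Hex; exists H.
  apply/analytic_atP; exists (fun alpha => c (incr k alpha)), r; split => // h hr.
  have [D [[M HM] _ _]] := powser_derive_at k HF hr.
  split; last by have := HH (a + h); rewrite addrAC subrr add0r; exact.
  exists M; apply: absum_le HM => alpha; rewrite /dcoef -mulrA [leRHS]normrM ler_peMl //.
  by rewrite normr_nat ler1n.
apply/nbhs_ballP; exists r => //= z; rewrite -ball_normE /= => az.
have zr : `|z - a| < r by rewrite distrC.
pose h := z - a; pose h' : 'rV[C]_n := \row_j if j == k then 0 else h 0 j.
have hr : `|h| < r by [].
have h'r : `|h'| < r.
  apply: rV_norm_lt => // j; rewrite mxE; case: eqP => _; first by rewrite normr0.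
  exact: le_lt_trans (rV_norm_entry _ _) hr.
have zE : z = a + h by rewrite /h addrC subrK.
have z'E : reset (pred1 k) a z = a + h'.
  by apply/rowP => j; rewrite !mxE /=; case: eqP => [->|_]; rewrite ?addr0 // addrC subrK.
have [_ S1] := HF _ hr; have [_ S2] := HF _ h'r.
rewrite z'E {1}zE (_ : z 0 k - a 0 k = h 0 k); last by rewrite !mxE.
have m'0 (alpha : mi) : alpha k != 0%N -> monomial h' alpha = 0.
  by move=> ak; rewrite (monomial_split k) mxE eqxx expr0n (negbTE ak) mul0r.
have mm' (alpha : mi) : alpha k = 0%N -> monomial h alpha = monomial h' alpha.
  move=> ak; rewrite !(monomial_split k) ak !expr0; congr (_ * _).
  by apply: eq_bigr => j /negbTE jk; rewrite !mxE jk.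
have Z alpha : ~ (exists beta, alpha = incr k beta) ->
    c alpha * monomial h alpha - c alpha * monomial h' alpha = 0.
  move=> na; have [ak|ak] := eqVneq (alpha k) 0%N; first by rewrite mm' // subrr.
  by case: na; have [b ->] := incr_image ak; exists b.
apply: has_sum_inj (has_sum_image (@incr_inj n k) Z (has_sumB S1 S2)) _.
apply: has_sum_ext (has_sumZ (h 0 k) (HH z zr)) => alpha.
by rewrite m'0 ?ffunE ?eqxx ?addn1 // mulr0 subr0 monomial_incr mulrCA.
Qed.

Lemma analytic_at_reset F a P : analytic_at F a -> analytic_at (F \o reset P a) a.
Proof.
move=> HF; apply: analytic_at_comp => [|i].
  by have -> : reset P a a = a by apply/rowP => j; rewrite mxE if_same.
have [Pi|Pi] := boolP (P i).
  rewrite (_ : (fun z => _) = fun=> a 0 i); first exact: analytic_at_cst.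
  by apply/funext => z; rewrite mxE Pi.
rewrite (_ : (fun z => _) = fun z => z 0 i); first exact: analytic_at_coord.
by apply/funext => z; rewrite mxE (negbTE Pi).
Qed.

(** Resetting the coordinates one at a time telescopes the difference. *)
Lemma hadamard_seq F a (s : seq 'I_n) : uniq s -> analytic_at F a ->
  exists H : 'I_n -> 'rV[C]_n -> C, (forall k, analytic_at (H k) a) /\
  \forall z \near a, F z - F (reset (mem s) a z) = \sum_(k <- s) (z 0 k - a 0 k) * H k z.
Proof.
elim: s F => [|k s IH] F => [_|/andP[ks us]] HF.
  exists (fun _ _ => 0); split => [k|]; first exact: analytic_at_cst.
  apply: (@filterE _ (nbhs a)) => z; rewrite big_nil (_ : reset _ a z = z) ?subrr //.
  by apply/rowP => j; rewrite mxE.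
have [H1 A1 E1] := hadamard1 k HF.
have [H [HA HE]] := IH _ us (analytic_at_reset (pred1 k) HF).
exists (fun j => if j == k then H1 else H j); split => [j|].
  by case: (j == k); [exact: A1|exact: HA].
near=> z; rewrite big_cons eqxx -(near E1 z) //.
rewrite [X in _ = _ + X](_ : _ = \sum_(j <- s) (z 0 j - a 0 j) * H j z); last first.
  rewrite big_seq [RHS]big_seq; apply: eq_bigr => j js.
  by case: eqP => // jk; rewrite -jk js in ks.
rewrite -(near HE z) //= addrA subrK; congr (_ - F _).
apply/rowP => j; rewrite !mxE /= inE; case: (j == k) => //.
Unshelve. all: by end_near.
Qed.

Lemma hadamard F a (P : pred 'I_n) : analytic_at F a ->
  exists H : 'I_n -> 'rV[C]_n -> C, (forall k, analytic_at (H k) a) /\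
  \forall z \near a, F z - F (reset P a z) = \sum_(k | P k) (z 0 k - a 0 k) * H k z.
Proof.
move=> HF; have [H [HA HE]] := hadamard_seq (enum_uniq P) HF.
exists H; split => //; near=> z.
rewrite (_ : \sum_(k | P k) _ = \sum_(k <- enum P) (z 0 k - a 0 k) * H k z); last first.
  by rewrite big_enum.
rewrite -(near HE z) //; congr (_ - F _).
by apply/rowP => j; rewrite !mxE /= mem_enum.
Unshelve. all: by end_near.
Qed.

End Fixed.

Lemma geometric_sum (q : C) : `|q| < 1 ->
  (exists M, absum (fun m : nat => q ^+ m) M) /\ has_sum (fun m : nat => q ^+ m) (1 - q)^-1.
Proof.
move=> q1; have q10 : 0 < 1 - `|q| by rewrite subr_gt0.
have qM : absum (fun m : nat => q ^+ m) (1 - `|q|)^-1.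
  move=> s us; have [N sN] : exists N, {subset s <= iota 0 N}.
    exists (\max_(i <- s) i).+1 => i is_; rewrite mem_iota /= add0n ltnS.
    by rewrite (big_rem i) //= leq_maxl.
  apply: (@le_trans _ _ (\sum_(m <- iota 0 N) `|q| ^+ m)).
    under eq_bigr do rewrite normrX.
    exact: (ler_sum_subset (fun m => exprn_ge0 m (normr_ge0 q)) us (iota_uniq 0 N) sN).
  have -> : \sum_(m <- iota 0 N) `|q| ^+ m = \sum_(m < N) `|q| ^+ m.
    by rewrite -(big_mkord xpredT (fun m => `|q| ^+ m)) /index_iota subn0.
  rewrite -[leRHS]mul1r ler_pdivlMr // mulrC -opprB mulNr -subrX1 opprB.
  by rewrite gerBl exprn_ge0.
split; first by eexists; exact: qM.
have [S HS] := absum_has_sum qM; suff -> : (1 - q)^-1 = S by [].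
have q1' : 1 - q != 0 by rewrite subr_eq0; apply: contraTneq q1 => <-; rewrite normr1 ltxx.
apply: (mulIf q1'); rewrite mulVf //; apply/eqP.
have d0 : has_sum (fun m : nat => (m == 0%N)%:R : C) 1.
  have := @has_sum_fin _ _ (fun m : nat => (m == 0%N)%:R : C) [:: 0%N] isT.
  by rewrite big_seq1; apply => m; rewrite inE => /negbTE ->.
(* Without its term of index 0 the geometric series is [q] times itself, so [S - 1 = q * S]. *)
have := has_sum_image succn_inj _ (has_sumB HS d0) => /=.
have -> : (fun m => q ^+ m.+1 - 0) = (fun m => q * q ^+ m).
  by apply/funext => m; rewrite subr0 exprS.
move=> H; have {}H := has_sum_inj (H _) (has_sumZ q HS).
rewrite mulrBr mulr1 [S * q]mulrC -H => [|[|m] nm]; first by rewrite opprB addrC subrK.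
  by rewrite expr0 subrr.
by case: nm; exists m.
Qed.

Lemma analytic_at_inv n (f : 'rV[C]_n -> C) a : analytic_at f a -> f a != 0 ->
  analytic_at (fun z => (f z)^-1) a.
Proof.
move=> Hf fa0; pose b : 'rV[C]_1 := const_mx (f a).
pose inv (z : 'rV[C]_1) : C := (z 0 0)^-1.
rewrite (_ : (fun z => _) = inv \o (fun z => const_mx (f z))); last first.
  by apply/funext => z; rewrite /inv /= mxE.
apply: analytic_at_comp => [|i]; last first.
  by rewrite (_ : (fun z => _) = f) //; apply/funext => z; rewrite mxE.
apply/analytic_atP; exists (fun alpha => (- (f a)^-1) ^+ alpha ord0 * (f a)^-1), `|f a|.
rewrite normr_gt0; split => // h hr.
pose q := - (h 0 0 / f a).
have q1 : `|q| < 1.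
  rewrite normrN normrM normfV ltr_pdivrMr ?normr_gt0 // mul1r.
  exact: le_lt_trans (rV_norm_entry _ _) hr.
have [[M HM] HS] := geometric_sum q1.
pose ev (alpha : {ffun 'I_1 -> nat}) := alpha ord0.
have evI : injective ev.
  by move=> u v E; apply/ffunP => i; rewrite ord1.
have tE (alpha : {ffun 'I_1 -> nat}) : q ^+ ev alpha * (f a)^-1 =
    (- (f a)^-1) ^+ alpha ord0 * (f a)^-1 * monomial h alpha.
  rewrite /monomial big_ord1 mulrAC -exprMn; congr (_ ^+ _ * _).
  by rewrite mulNr mulrC.
split.
  exists (M * `|(f a)^-1|); apply: absum_le (absumZr (f a)^-1 (absum_image evI HM)) => alpha.
  by rewrite tE.
have -> : inv (const_mx (f a) + h) = (1 - q)^-1 * (f a)^-1.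
  rewrite /inv !mxE -invfM; congr (_^-1).
  by rewrite /q opprK mulrDl mul1r divfK // mulrC.
apply: has_sum_ext (has_sumZr _ (has_sum_image evI _ HS)) => // m nm.
by case: nm; exists [ffun=> m]; rewrite /ev ffunE.
Qed.

End Hadamard.

Section PartialRules.
Variables (R : realType) (n : nat).
Local Notation C := (Cx R).
Implicit Types (F G : 'rV[C]_n -> C) (y z : 'rV[C]_n) (k l : 'I_n).

Lemma delta_mx_norm_le k (s : C) : `|s *: (delta_mx 0 k : 'rV[C]_n)| <= `|s|.
Proof.
rewrite normrZ ler_piMr //.
have [->|d0] := eqVneq `|delta_mx 0 k : 'rV[C]_n| 0; first exact: ler01.
have [[i j] /= ->] : exists ij : 'I_1 * 'I_n,
    `|delta_mx 0 k : 'rV[C]_n| = `|(delta_mx 0 k : 'rV[C]_n) ij.1 ij.2|.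
  exact: mx_norm_neq0.
by rewrite mxE normr_nat lern1 leq_b1.
Qed.

Lemma partial_near F G y k : (\forall z \near y, F z = G z) ->
  partial k F y = partial k G y.
Proof.
move=> /nbhs_ballP[e /= e0 FG]; rewrite /partial !derive1E; apply: (@near_eq_derive C C^o C^o _ _ (0 : C^o)).
apply/nbhs_ballP; exists e => //= s; rewrite -ball_normE /= sub0r normrN => se.
apply: FG; rewrite -ball_normE /= opprD addrA subrr sub0r normrN.
exact: le_lt_trans (delta_mx_norm_le k s) se.
Qed.

Lemma partialD F G y k : analytic_at F y -> analytic_at G y ->
  partial k (fun z => F z + G z) y = partial k F y + partial k G y.
Proof.
move=> /(analytic_at_is_derive k) HF /(analytic_at_is_derive k) HG.
exact: partialE (is_deriveD HF HG).
Qed.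

Lemma partialM F G y k : analytic_at F y -> analytic_at G y ->
  partial k (fun z => F z * G z) y = partial k F y * G y + F y * partial k G y.
Proof.
move=> /(analytic_at_is_derive k) HF /(analytic_at_is_derive k) HG.
have H := is_deriveM HF HG; rewrite (partialE H) /= scale0r addr0.
by rewrite addrC mulrC; congr (_ + _); rewrite mulrC.
Qed.

Lemma partial_cst (c : C) y k : partial k (fun=> c) y = 0.
Proof. exact: partialE (is_derive_cst (c : C^o) (0 : C^o) 1). Qed.

Lemma partial_coord y k l : partial k (fun z => z 0 l) y = (k == l)%:R.
Proof.
apply: partialE; have [<-|kl] := eqVneq k l.
  rewrite (_ : (fun s => _) = (fun s : C^o => y 0 k + s)).
    have := is_deriveD (is_derive_cst (y 0 k : C^o) (0 : C^o) 1) (is_derive_id (0 : C^o) 1).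
    by rewrite add0r.
  by apply/funext => s; rewrite !mxE !eqxx mulr1.
rewrite (_ : (fun s => _) = cst (y 0 l : C^o)); first exact: is_derive_cst.
by apply/funext => s; rewrite !mxE [l == k]eq_sym (negbTE kl) andbF mulr0 addr0.
Qed.

Lemma analytic_at_continuous F y : analytic_at F y -> {for y, continuous (F : 'rV[C]_n -> C^o)}.
Proof.
move=> HF; have nF := nbhs_filter y; apply/cvgrPdist_lt => e e0.
have e2 : 0 < e / 2 by rewrite divr_gt0.
have [|s s0 Hs] := @series_on_small _ _ F y (F y) (e / 2) HF; first by rewrite subrr normr0.
have [c [cM Hc]] := Hs s s0 (lexx s).
suff: \forall t \near y, `|F y - F t| < e by [].
apply/nbhs_ballP; exists s => //= z; rewrite -ball_normE /= => yz.
have zs i : `|(z - y) 0 i| <= s.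
  by apply: le_trans (rV_norm_entry _ _) _; rewrite distrC ltW.
rewrite distrC; apply: le_lt_trans (_ : _ <= e / 2) _; last first.
  by rewrite [ltRHS]splitr ltrDl.
have := Hc _ zs; rewrite [y + _]addrC subrK => Hz.
exact: has_sum_norm Hz (absum_polydisc cM (ltW s0) zs).
Qed.

End PartialRules.

Lemma analytic_map_continuous (R : realType) m n (psi : 'rV[Cx R]_m -> 'rV[Cx R]_n) a :
  (forall i, analytic_at (fun z => psi z 0 i) a) -> {for a, continuous psi}.
Proof.
move=> H; have nF := nbhs_filter a; apply/cvgrPdist_lt => e e0.
have Hi i : \forall z \near a, `|psi a 0 i - psi z 0 i| < e.
  by have /cvgrPdist_lt/(_ e e0) := analytic_at_continuous (H i).
have {}Hi : \forall z \near a, forall i, `|psi a 0 i - psi z 0 i| < e.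
  exact: (filter_forall nF Hi).
suff: \forall z \near a, `|psi a - psi z| < e by [].
near=> z; apply: rV_norm_lt => // i; rewrite !mxE.
exact: (near Hi z).
Unshelve. all: by end_near.
Qed.

(** * Germs of holomorphic functions in a chart *)

Section Charts.
Variables (R : realType) (n : nat) (T : topologicalType) (A : atlas R n T).
Local Notation C := (Cx R).

(* The axioms of complexManifold apart from the Hausdorff one. *)
Definition compatible :=
  [/\ forall x, exists i, chart_dom A i x,
      forall i, open (chart_dom A i),
      forall i, open (chart A i @` chart_dom A i),
      forall i x, chart_dom A i x ->
        [/\ chart_inv A i (chart A i x) = x, {for x, continuous (chart A i)} &
            {for chart A i x, continuous (chart_inv A i)}] &
      forall i j x, chart_dom A i x -> chart_dom A j x ->
        forall k, analytic_at (fun z => chart A j (chart_inv A i z) 0 k) (chart A i x)].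

Hypothesis AC : compatible.

Section OneChart.
Variables (i : chart_index A) (x : T).
Hypothesis xi : chart_dom A i x.
Local Notation a := (chart A i x).

Lemma chartK : chart_inv A i a = x.
Proof. by case: AC => _ _ _ /(_ i x xi)[]. Qed.

Lemma near_chart_dom : \forall y \near x, chart_dom A i y.
Proof. by apply: open_nbhs_nbhs; split => //; case: AC. Qed.

Lemma near_chart_inv (P : T -> Prop) :
  (\forall y \near x, P y) -> \forall z \near a, P (chart_inv A i z).
Proof.
move=> H; have [_ _ /(_ P)] : [/\ chart_inv A i a = x, {for x, continuous (chart A i)} &
    {for a, continuous (chart_inv A i)}] by case: AC => _ _ _ /(_ i x xi).
by rewrite chartK; exact.
Qed.

Lemma near_chart (P : 'rV[C]_n -> Prop) :
  (\forall z \near a, P z) -> \forall y \near x, P (chart A i y).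
Proof. by move=> H; case: AC => _ _ _ /(_ i x xi)[_ /(_ P)] + _ _; exact. Qed.

Lemma near_chart_invK : \forall y \near x, chart_inv A i (chart A i y) = y.
Proof.
apply: filterS near_chart_dom => y yi.
by case: AC => _ _ _ /(_ i y yi)[].
Qed.

Lemma near_chartK : \forall z \near a, chart A i (chart_inv A i z) = z.
Proof.
have H : \forall z \near a, (chart A i @` chart_dom A i) z.
  by apply: open_nbhs_nbhs; split; [case: AC|exists x].
apply: filterS H => _ [y yi <-].
by congr chart; case: AC => _ _ _ /(_ i y yi)[].
Qed.

End OneChart.

Lemma hol_at_chart i x f : chart_dom A i x ->
  analytic_at (f \o chart_inv A i) (chart A i x) -> hol_at A f x.
Proof.
move=> xi Hf j xj.
have tr k : analytic_at (fun z => chart A i (chart_inv A j z) 0 k) (chart A j x).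
  by case: AC => _ _ _ _ /(_ j i x xj xi k).
have Hc : analytic_at ((f \o chart_inv A i) \o (fun z => chart A i (chart_inv A j z))) (chart A j x).
  by apply: analytic_at_comp tr; rewrite (chartK xj); exact: Hf.
apply: analytic_at_eq Hc; apply: (near_chart_inv xj (P := fun y => f (chart_inv A i (chart A i y)) = f y)).
by apply: filterS (near_chart_invK xi) => y ->.
Qed.

Lemma hol_at_eq x f g : (\forall y \near x, f y = g y) -> hol_at A f x -> hol_at A g x.
Proof.
move=> fg Hf i xi; apply: analytic_at_eq (Hf i xi).
exact: (near_chart_inv xi (P := fun y => f y = g y)).
Qed.

Lemma hol_at_near x f : hol_at A f x -> \forall y \near x, hol_at A f y.
Proof.
have [i xi] : exists i, chart_dom A i x by case: AC.
move=> /(_ i xi)/analytic_at_near/(near_chart xi) H.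
near=> y; apply: (@hol_at_chart i); first by near: y; exact: near_chart_dom.
by near: y.
Unshelve. all: by end_near.
Qed.

End Charts.

Section GermTheory.
Variables (R : realType) (n : nat) (T : topologicalType) (A : atlas R n T).
Local Notation C := (Cx R).
Hypothesis AC : compatible A.
Variable x : T.
Implicit Types (f h : T -> C) (g : ostalk A x).

Lemma germE f (Hf : f \in @loc_hol _ _ _ A x) :
  germ A f x = \pi_(ostalk A x)%qT (Sub f Hf : hol_near A x).
Proof. by congr (\pi_ _ _)%qT; apply: val_inj; rewrite insubdK. Qed.

Lemma germ_rep_hol g : hol_at A (germ_rep g) x.
Proof. by have /asboolP/nbhs_singleton := valP (repr g). Qed.

Lemma loc_holP f : hol_at A f x -> f \in @loc_hol _ _ _ A x.
Proof. by move=> Hf; apply/asboolP; exact: hol_at_near. Qed.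

Lemma germ_repK g : germ A (germ_rep g) x = g.
Proof.
rewrite (germE (valP (repr g))); have -> : Sub _ (valP (repr g)) = repr g by exact: val_inj.
exact: reprK.
Qed.

Lemma germ_eqP f h : hol_at A f x -> hol_at A h x ->
  germ A f x = germ A h x <-> \forall y \near x, f y = h y.
Proof.
move=> /loc_holP Hf /loc_holP Hh; rewrite (germE Hf) (germE Hh).
split=> [/eqP|fh]; last apply/eqP.
  rewrite -Quotient.idealrBE => /asboolP; apply: filterS => y /= /eqP.
  by rewrite subr_eq0 => /eqP.
rewrite -Quotient.idealrBE; apply/asboolP; apply: filterS fh => y /= E.
by rewrite !fctE E subrr.
Qed.

Lemma germ_repE f : hol_at A f x -> \forall y \near x, germ_rep (germ A f x) y = f y.
Proof. by move=> Hf; apply/(germ_eqP (germ_rep_hol _) Hf); exact: germ_repK. Qed.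

Lemma germ_addE f h : hol_at A f x -> hol_at A h x ->
  germ A (fun y => f y + h y) x = germ A f x + germ A h x.
Proof.
move=> /loc_holP Hf /loc_holP Hh; rewrite (germE Hf) (germE Hh) -[RHS]Quotient.pi_add.
by rewrite (germE (rpredD Hf Hh)); congr (\pi_ _ _)%qT; apply: val_inj.
Qed.

Lemma germ_mulE f h : hol_at A f x -> hol_at A h x ->
  germ A (fun y => f y * h y) x = germ A f x * germ A h x.
Proof.
move=> /loc_holP Hf /loc_holP Hh; rewrite (germE Hf) (germE Hh) -[RHS]Quotient.pi_mul.
by rewrite (germE (rpredM Hf Hh)); congr (\pi_ _ _)%qT; apply: val_inj.
Qed.

Lemma germ_cst0 : germ A (fun=> 0) x = 0.
Proof.
have H : hol_at A (fun=> 0) x by move=> i _; exact: analytic_at_cst.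
apply: (addIr (germ A (fun=> 0) x)); rewrite add0r -(germ_addE H H).
by congr (germ A _ x); apply/funext => y; rewrite addr0.
Qed.

Lemma germ_cst1 : germ A (fun=> 1) x = 1.
Proof.
have H : hol_at A (fun=> 1) x by move=> i _; exact: analytic_at_cst.
rewrite -[LHS]mulr1 -{1}(germ_repK 1) -(germ_mulE H (germ_rep_hol 1)).
rewrite -[RHS]germ_repK; congr (germ A _ x); apply/funext => y.
by rewrite mul1r.
Qed.

End GermTheory.

Lemma morphD0 (V V' : zmodType) (phi : V -> V') : {morph phi : u v / u + v} -> phi 0 = 0.
Proof. by move=> phiD; apply: (addIr (phi 0)); rewrite add0r -phiD addr0. Qed.

Lemma sum_delta (B : pzRingType) d (h : 'I_d -> B) j : \sum_k (k == j)%:R * h k = h j.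
Proof.
rewrite (bigD1 j) //= eqxx mul1r big1 ?addr0 // => k /negbTE ->.
by rewrite mul0r.
Qed.

(** * Derivations of a ring with coordinates *)

Section CoordinateDerivations.
Variables (B : comNzRingType) (n : nat) (c : 'I_n -> B) (D : 'I_n -> B -> B) (K : B -> Prop).
Implicit Types (g h : B) (k l : 'I_n).

(** The powers of the ideal generated by the [c k]: with all coordinates, those of the maximal ideal
    at a point; later, with the fibre coordinates alone, those of the ideal of the zero section. *)
Fixpoint coord_expn (N : nat) g : Prop :=
  if N is N'.+1 then exists2 H : 'I_n -> B, forall k, coord_expn N' (H k) &
    g = \sum_k c k * H k
  else True.

Lemma coord_expnD N g h : coord_expn N g -> coord_expn N h -> coord_expn N (g + h).
Proof.
elim: N g h => // N IH g h [H HH ->] [H' HH' ->]; exists (fun k => H k + H' k).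
  by move=> k; exact: IH (HH k) (HH' k).
by rewrite -big_split; apply: eq_bigr => k _; rewrite mulrDr.
Qed.

Lemma coord_expn0 N : coord_expn N 0.
Proof.
elim: N => // N IH; exists (fun=> 0) => //.
by rewrite big1 // => k _; rewrite mulr0.
Qed.

Lemma coord_expn_sum N (H : 'I_n -> B) : (forall k, coord_expn N (H k)) -> coord_expn N (\sum_k H k).
Proof.
by move=> HH; elim/big_ind: _ => //; [exact: coord_expn0|exact: coord_expnD].
Qed.

Hypothesis DD : forall k g h, D k (g + h) = D k g + D k h.
Hypothesis DM : forall k g h, D k (g * h) = D k g * h + g * D k h.
Hypothesis Dc : forall k l, D k (c l) = (k == l)%:R.

Lemma coord_expn_deriv N g k : coord_expn N.+1 g -> coord_expn N (D k g).
Proof.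
have D0 := morphD0 (DD k).
elim: N g => // N IH g [H HH ->]; rewrite (big_morph (D k) (DD k) D0).
apply: coord_expn_sum => l; rewrite DM Dc; apply: coord_expnD.
  by case: eqP => _; rewrite ?mul1r ?mul0r; [exact: HH|exact: coord_expn0].
exists (fun j => if j == l then D k (H l) else 0).
  by move=> j; case: (j == l); [exact: IH (HH l)|exact: coord_expn0].
by rewrite (bigD1 l) //= eqxx big1 ?addr0 // => j /negbTE ->; rewrite mulr0.
Qed.

Hypothesis DK : forall k z, K z -> D k z = 0.
Hypothesis taylor : forall g, exists z (H : 'I_n -> B), K z /\ g = z + \sum_k c k * H k.
Hypothesis separated : forall g, (forall N, coord_expn N g) -> g = 0.

Variable xi : B -> B.
Hypothesis xiD : forall g h, xi (g + h) = xi g + xi h.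
Hypothesis xiM : forall g h, xi (g * h) = xi g * h + g * xi h.
Hypothesis xiK : forall z, K z -> xi z = 0.

(** The difference [eta] of the two sides is a derivation that kills [K] and every [c k]. Expanding
    [g] by [taylor] gives [eta g] as the sum of the [c k * eta (H k)], so by induction [eta g] lies
    in all powers of the ideal. *)
Lemma coordinate_derivation g : xi g = \sum_k xi (c k) * D k g.
Proof.
pose eta g := xi g - \sum_k xi (c k) * D k g.
suff : eta g = 0 by move=> /eqP; rewrite subr_eq0 => /eqP.
have etaD g1 g2 : eta (g1 + g2) = eta g1 + eta g2.
  rewrite /eta xiD; under eq_bigr do rewrite DD mulrDr.
  by rewrite big_split /= opprD addrACA.
have etaM g1 g2 : eta (g1 * g2) = eta g1 * g2 + g1 * eta g2.
  rewrite /eta xiM; under eq_bigr do rewrite DM mulrDr.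
  rewrite big_split /= opprD mulrBl mulrBr addrACA; congr (_ - _ + (_ - _)).
    by rewrite mulr_suml; apply: eq_bigr => k _; rewrite mulrA.
  by rewrite mulr_sumr; apply: eq_bigr => k _; rewrite mulrCA.
have etaK z : K z -> eta z = 0.
  by move=> Kz; rewrite /eta xiK // big1 ?subr0 // => k _; rewrite DK ?mulr0.
have eta_c k : eta (c k) = 0.
  rewrite /eta (bigD1 k) //= Dc eqxx mulr1 big1 ?addr0 ?subrr //.
  by move=> l /negbTE lk; rewrite Dc lk mulr0.
have eta0 := morphD0 etaD.
apply: separated => N; elim: N g => // N IH g.
have [z [H [Kz ->]]] := taylor g; exists (fun k => eta (H k)) => [k|]; first exact: IH.
rewrite etaD etaK // add0r (big_morph eta etaD eta0); apply: eq_bigr => k _.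
by rewrite etaM eta_c mul0r add0r.
Qed.

End CoordinateDerivations.

Section LocalRing.
Variables (R : realType) (n : nat) (T : topologicalType) (A : atlas R n T).
Local Notation C := (Cx R).
Variables (i : chart_index A) (x : T).
Local Notation a := (chart A i x).
Local Notation O := (ostalk A x).
Implicit Types (F G : 'rV[C]_n -> C) (g h : O) (k l : 'I_n).

(* Sealed, as unification would otherwise unfold germs down to power series. *)
Fact mkgerm_key : unit. Proof. exact: tt. Qed.
Fact lrep_key : unit. Proof. exact: tt. Qed.
Fact dgerm_key : unit. Proof. exact: tt. Qed.

Definition mkgerm F : O := locked_with mkgerm_key (germ A (F \o chart A i) x).

Definition lrep g : 'rV[C]_n -> C := locked_with lrep_key (germ_rep g \o chart_inv A i).

Definition dgerm k g : O := locked_with dgerm_key (mkgerm (partial k (lrep g))).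

Lemma mkgermE F : mkgerm F = germ A (F \o chart A i) x.
Proof. exact: locked_withE. Qed.

Lemma lrepE g : lrep g = germ_rep g \o chart_inv A i.
Proof. exact: locked_withE. Qed.

Lemma dgermE k g : dgerm k g = mkgerm (partial k (lrep g)).
Proof. exact: locked_withE. Qed.

Definition cgerm k : O := mkgerm (fun z => z 0 k - a 0 k).

Hypothesis AC : compatible A.
Hypothesis xi : chart_dom A i x.

Lemma mkgerm_hol F : analytic_at F a -> hol_at A (F \o chart A i) x.
Proof.
move=> HF; apply: (hol_at_chart AC xi); apply: analytic_at_eq HF.
by apply: filterS (near_chartK AC xi) => z /= ->.
Qed.

Lemma lrep_analytic g : analytic_at (lrep g) a.
Proof. by rewrite lrepE; exact: (germ_rep_hol g xi). Qed.

Lemma lrepK g : mkgerm (lrep g) = g.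
Proof.
rewrite mkgermE -[RHS](germ_repK g).
apply/(germ_eqP AC (mkgerm_hol (lrep_analytic g)) (germ_rep_hol g)).
by apply: filterS (near_chart_invK AC xi) => y; rewrite /= lrepE /= => ->.
Qed.

Lemma mkgerm_eq F G : analytic_at F a -> analytic_at G a ->
  (\forall z \near a, F z = G z) -> mkgerm F = mkgerm G.
Proof.
move=> HF HG FG; rewrite !mkgermE; apply/(germ_eqP AC (mkgerm_hol HF) (mkgerm_hol HG)).
exact: (near_chart AC xi (P := fun z => F z = G z)).
Qed.

Lemma mkgermK F : analytic_at F a -> \forall z \near a, lrep (mkgerm F) z = F z.
Proof.
move=> HF; have H := near_chart_inv AC xi (germ_repE AC (mkgerm_hol HF)).
by apply: filterS2 H (near_chartK AC xi) => z; rewrite lrepE mkgermE /= => -> ->.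
Qed.

Lemma germP g : exists2 F, analytic_at F a & g = mkgerm F.
Proof. by exists (lrep g); [exact: lrep_analytic|rewrite lrepK]. Qed.

Lemma mkgermD F G : analytic_at F a -> analytic_at G a ->
  mkgerm (fun z => F z + G z) = mkgerm F + mkgerm G.
Proof. by move=> HF HG; rewrite !mkgermE -(germ_addE AC (mkgerm_hol HF) (mkgerm_hol HG)). Qed.

Lemma mkgermM F G : analytic_at F a -> analytic_at G a ->
  mkgerm (fun z => F z * G z) = mkgerm F * mkgerm G.
Proof. by move=> HF HG; rewrite !mkgermE -(germ_mulE AC (mkgerm_hol HF) (mkgerm_hol HG)). Qed.

Lemma mkgerm_cst (c : C) : mkgerm (fun=> c) = germ A (fun=> c) x.
Proof. exact: mkgermE. Qed.

Lemma mkgerm0 : mkgerm (fun=> 0) = 0.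
Proof. by rewrite mkgerm_cst germ_cst0. Qed.

Lemma mkgerm1 : mkgerm (fun=> 1) = 1.
Proof. by rewrite mkgerm_cst germ_cst1. Qed.

Lemma analytic_atD F G y : analytic_at F y -> analytic_at G y ->
  analytic_at (fun z => F z + G z) y.
Proof.
move=> HF HG; have H0 := analytic_at_cst (0 : C) y.
have H := analytic_atB HF (analytic_atB H0 HG).
rewrite (_ : (fun z => F z + G z) = F - ((fun=> 0) - G)); first exact: H.
by apply/funext => z; rewrite !fctE sub0r opprK.
Qed.

Lemma analytic_at_sum (I : Type) (s : seq I) (P : pred I) (F : I -> 'rV[C]_n -> C) y :
  (forall j, analytic_at (F j) y) -> analytic_at (fun z => \sum_(j <- s | P j) F j z) y.
Proof.
move=> HF; elim: s => [|j s IH].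
  rewrite (_ : (fun z => _) = fun=> 0); first exact: analytic_at_cst.
  by apply/funext => z; rewrite big_nil.
rewrite (_ : (fun z => _) = if P j then fun z => F j z + \sum_(j <- s | P j) F j z
  else fun z => \sum_(j <- s | P j) F j z); last first.
  by apply/funext => z; rewrite big_cons; case: (P j).
by case: (P j); [exact: (analytic_atD (HF j) IH)|exact: IH].
Qed.

Lemma mkgerm_sum (I : Type) (s : seq I) (P : pred I) (F : I -> 'rV[C]_n -> C) :
  (forall j, analytic_at (F j) a) ->
  mkgerm (fun z => \sum_(j <- s | P j) F j z) = \sum_(j <- s | P j) mkgerm (F j).
Proof.
move=> HF; elim: s => [|j s IH].
  by rewrite big_nil -[RHS]mkgerm0; congr mkgerm; apply/funext => z; rewrite big_nil.
rewrite big_cons -IH; case: ifP => Pj; last first.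
  by congr mkgerm; apply/funext => z; rewrite big_cons Pj.
rewrite -(mkgermD (HF j) (analytic_at_sum s P HF)).
by congr mkgerm; apply/funext => z; rewrite big_cons Pj.
Qed.

Lemma near_nbhs (P : 'rV[C]_n -> Prop) : (\forall z \near a, P z) ->
  \forall z \near a, \forall w \near z, P w.
Proof. by move=> /nbhs_interior. Qed.

Lemma dgerm_mkgerm k F : analytic_at F a -> dgerm k (mkgerm F) = mkgerm (partial k F).
Proof.
move=> HF; rewrite dgermE; apply: mkgerm_eq.
- exact: (analytic_at_partial k (lrep_analytic _)).
- exact: (analytic_at_partial k HF).
by apply: filterS (near_nbhs (mkgermK HF)) => z; exact: partial_near.
Qed.

Lemma lrepD g h : \forall z \near a, lrep (g + h) z = lrep g z + lrep h z.
Proof.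
have := mkgermK (analytic_atD (lrep_analytic g) (lrep_analytic h)).
by rewrite (mkgermD (lrep_analytic g) (lrep_analytic h)) !lrepK.
Qed.

Lemma lrepM g h : \forall z \near a, lrep (g * h) z = lrep g z * lrep h z.
Proof.
have := mkgermK (analytic_atM (lrep_analytic g) (lrep_analytic h)).
by rewrite (mkgermM (lrep_analytic g) (lrep_analytic h)) !lrepK.
Qed.

Lemma dgermD k g h : dgerm k (g + h) = dgerm k g + dgerm k h.
Proof.
have [Hg Hh] := (lrep_analytic g, lrep_analytic h).
have [dg dh] := (analytic_at_partial k Hg, analytic_at_partial k Hh).
rewrite !dgermE -(mkgermD dg dh); apply: mkgerm_eq.
- exact: (analytic_at_partial k (lrep_analytic (g + h))).
- exact: (analytic_atD dg dh).
apply: filterS3 (near_nbhs (lrepD g h)) (analytic_at_near Hg) (analytic_at_near Hh) => z E Hgz Hhz.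
exact: (etrans (partial_near k E) (partialD k Hgz Hhz)).
Qed.

Lemma dgermM k g h : dgerm k (g * h) = dgerm k g * h + g * dgerm k h.
Proof.
have [Hg Hh] := (lrep_analytic g, lrep_analytic h).
have [dg dh] := (analytic_at_partial k Hg, analytic_at_partial k Hh).
have E1 : mkgerm (fun z => partial k (lrep g) z * lrep h z) = dgerm k g * h.
  by rewrite (mkgermM dg Hh) lrepK dgermE.
have E2 : mkgerm (fun z => lrep g z * partial k (lrep h) z) = g * dgerm k h.
  by rewrite (mkgermM Hg dh) lrepK dgermE.
rewrite dgermE -E1 -E2 -(mkgermD (analytic_atM dg Hh) (analytic_atM Hg dh)); apply: mkgerm_eq.
- exact: (analytic_at_partial k (lrep_analytic (g * h))).
- exact: (analytic_atD (analytic_atM dg Hh) (analytic_atM Hg dh)).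
apply: filterS3 (near_nbhs (lrepM g h)) (analytic_at_near Hg) (analytic_at_near Hh) => z E Hgz Hhz.
exact: (etrans (partial_near k E) (partialM k Hgz Hhz)).
Qed.

Lemma dgerm_cst k (c : C) : dgerm k (germ A (fun=> c) x) = 0.
Proof.
have Hc := @analytic_at_cst C n c a.
rewrite -mkgerm_cst (dgerm_mkgerm k Hc) -mkgerm0.
by congr mkgerm; apply/funext => z; rewrite partial_cst.
Qed.

Lemma dgerm_derivation k : derivation (dgerm k).
Proof. by split; [exact: dgermD|exact: dgermM|exact: dgerm_cst]. Qed.

Lemma dgermC k l g : dgerm k (dgerm l g) = dgerm l (dgerm k g).
Proof.
have Hg := lrep_analytic g.
have [dk dl] := (analytic_at_partial k Hg, analytic_at_partial l Hg).
have E j m : dgerm j (dgerm m g) = mkgerm (partial j (partial m (lrep g))).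
  by rewrite [dgerm m g]dgermE (dgerm_mkgerm j (analytic_at_partial m Hg)).
rewrite !E; apply: mkgerm_eq.
- exact: (analytic_at_partial k dl).
- exact: (analytic_at_partial l dk).
by apply: filterS (analytic_at_near Hg) => z; exact: partialC.
Qed.

Lemma cgerm_analytic k y : analytic_at (fun z : 'rV[C]_n => z 0 k - a 0 k) y.
Proof. exact: (analytic_atB (analytic_at_coord k y) (analytic_at_cst (a 0 k) y)). Qed.

Lemma dgerm_cgerm k l : dgerm k (cgerm l) = (k == l)%:R.
Proof.
rewrite (dgerm_mkgerm k (@cgerm_analytic l a)).
have -> : (k == l)%:R = mkgerm (fun=> (k == l)%:R).
  by case: (k == l); [exact: esym mkgerm1|exact: esym mkgerm0].
congr mkgerm; apply/funext => z.
have H := partialD k (analytic_at_coord l z) (analytic_at_cst (- a 0 l) z).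
by rewrite /= in H; rewrite H partial_coord partial_cst addr0.
Qed.

Lemma germ_hadamard (P : pred 'I_n) g : exists H : 'I_n -> O,
  g = mkgerm (lrep g \o reset P a) + \sum_(k | P k) cgerm k * H k.
Proof.
have [H [HA HE]] := hadamard P (lrep_analytic g).
exists (fun k => mkgerm (H k)).
have SA : analytic_at (fun z : 'rV[C]_n => \sum_(k | P k) (z 0 k - a 0 k) * H k z) a.
  by apply: analytic_at_sum => k; exact: analytic_atM (@cgerm_analytic k a) (HA k).
have -> : \sum_(k | P k) cgerm k * mkgerm (H k) =
    mkgerm (fun z => \sum_(k | P k) (z 0 k - a 0 k) * H k z).
  rewrite mkgerm_sum => [|k]; last exact: analytic_atM (@cgerm_analytic k a) (HA k).
  by apply: eq_bigr => k _; rewrite (mkgermM (@cgerm_analytic k a) (HA k)).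
have RA := analytic_at_reset P (lrep_analytic g).
rewrite -(mkgermD RA SA) -{1}(lrepK g); apply: mkgerm_eq.
- exact: lrep_analytic.
- exact: analytic_atD RA SA.
by apply: filterS HE => z <-; rewrite /= addrC subrK.
Qed.

Lemma coord_expn1_root F : analytic_at F a -> coord_expn cgerm 1 (mkgerm F) -> F a = 0.
Proof.
move=> HF [H _ E].
have HA k := analytic_atM (@cgerm_analytic k a) (lrep_analytic (H k)).
have E' : mkgerm F = mkgerm (fun z => \sum_k (z 0 k - a 0 k) * lrep (H k) z).
  rewrite (mkgerm_sum _ _ HA) E; apply: eq_bigr => k _.
  by rewrite (mkgermM (@cgerm_analytic k a) (lrep_analytic (H k))) lrepK.
have SA := analytic_at_sum (index_enum _) xpredT HA.
rewrite !mkgermE in E'.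
have [/(_ E') /nbhs_singleton E0 _] := germ_eqP AC (mkgerm_hol HF) (mkgerm_hol SA).
rewrite -[LHS]/((F \o chart A i) x) E0; apply: big1 => k _.
have E2 : (a 0 k - a 0 k) * lrep (H k) a = 0 by rewrite subrr mul0r.
exact: E2.
Qed.

(** Derivatives of an element of all powers of the maximal ideal are again of this kind. All of them
    therefore vanish at the point, and the germ is flat. *)
Lemma krull g : (forall N, coord_expn cgerm N g) -> g = 0.
Proof.
move=> Hg; have [F HF gF] := germP g.
have flat w : analytic_at (foldr (@partial R n) F w) a /\
    forall N, coord_expn cgerm N (mkgerm (foldr (@partial R n) F w)).
  elim: w => [|k w [HA Hm]] /=; first by split => [|N]; [exact: HF|rewrite -gF].
  split; first exact: analytic_at_partial HA.
  by move=> N; rewrite -(dgerm_mkgerm k HA); apply: (coord_expn_deriv dgermD dgermM dgerm_cgerm).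
rewrite gF -mkgerm0; apply: mkgerm_eq; [exact: HF|exact: analytic_at_cst|].
apply: flat_eq0; first exact: HF.
by move=> w; have [HA Hm] := flat w; exact: coord_expn1_root HA (Hm 1%N).
Qed.

Lemma derivationE (dlt : O -> O) : derivation dlt ->
  forall g, dlt g = \sum_k dlt (cgerm k) * dgerm k g.
Proof.
move=> [dD dM dc]; apply: (@coordinate_derivation O n cgerm dgerm
  (fun z => exists c, z = germ A (fun=> c) x) dgermD dgermM dgerm_cgerm _ _ krull dlt dD dM).
- by move=> k _ [c ->]; exact: dgerm_cst.
- move=> g; have [H E] := germ_hadamard xpredT g.
  exists (germ A (fun=> lrep g a) x), H; split; first by exists (lrep g a).
  rewrite [LHS]E -mkgerm_cst; apply: (congr1 (fun y => y + _)); apply: (congr1 mkgerm).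
  apply/funext => y; apply: (congr1 (lrep g)); apply/rowP => j.
  exact: mxE.
- by move=> _ [c ->]; exact: dc.
Qed.

Lemma germ_unit g : lrep g a != 0 -> exists h, h * g = 1.
Proof.
move=> g0; have HI := analytic_at_inv (lrep_analytic g) g0.
exists (mkgerm (fun z => (lrep g z)^-1)); rewrite -{2}(lrepK g) -(mkgermM HI (lrep_analytic g)).
rewrite -mkgerm1; apply: mkgerm_eq.
- exact: analytic_atM HI (lrep_analytic g).
- exact: analytic_at_cst.
have nF := nbhs_filter a; have /cvgrPdist_lt/(_ `|lrep g a|) := analytic_at_continuous (lrep_analytic g).
rewrite normr_gt0 => /(_ g0); apply: filterS => z gz; apply: mulVf.
by apply: contraTneq gz => ->; rewrite subr0 ltxx.
Qed.

End LocalRing.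

(** * Germs on the product with C^d *)

Section Pull.
Variables (R : realType) (n1 n2 : nat) (T1 T2 : topologicalType).
Variables (A1 : atlas R n1 T1) (A2 : atlas R n2 T2).
Local Notation C := (Cx R).
Variables (i1 : chart_index A1) (x1 : T1) (i2 : chart_index A2) (x2 : T2).
Local Notation a1 := (chart A1 i1 x1).
Local Notation a2 := (chart A2 i2 x2).
Local Notation O1 := (ostalk A1 x1).
Local Notation O2 := (ostalk A2 x2).

Fact pull_key : unit. Proof. exact: tt. Qed.

Definition pull (psi : 'rV[C]_n1 -> 'rV[C]_n2) (g : O2) : O1 :=
  locked_with pull_key (mkgerm i1 x1 (lrep i2 g \o psi)).

Lemma pullE psi g : pull psi g = mkgerm i1 x1 (lrep i2 g \o psi).
Proof. exact: locked_withE. Qed.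

Hypothesis AC1 : compatible A1.
Hypothesis AC2 : compatible A2.
Hypothesis xi1 : chart_dom A1 i1 x1.
Hypothesis xi2 : chart_dom A2 i2 x2.

Definition chart_map (psi : 'rV[C]_n1 -> 'rV[C]_n2) :=
  psi a1 = a2 /\ forall k, analytic_at (fun z => psi z 0 k) a1.

Variable psi : 'rV[C]_n1 -> 'rV[C]_n2.
Hypothesis Hpsi : chart_map psi.

Lemma analytic_at_pull F : analytic_at F a2 -> analytic_at (F \o psi) a1.
Proof.
case: Hpsi => psia psiA HF; apply: analytic_at_comp psiA.
by rewrite psia; exact: HF.
Qed.

Lemma near_pull (P : 'rV[C]_n2 -> Prop) :
  (\forall z \near a2, P z) -> \forall z \near a1, P (psi z).
Proof.
case: Hpsi => psia psiA HP.
by have /(_ P) := analytic_map_continuous psiA; rewrite psia; exact.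
Qed.

Lemma pull_mkgerm F : analytic_at F a2 -> pull (psi) (mkgerm i2 x2 F) = mkgerm i1 x1 (F \o psi).
Proof.
move=> HF; rewrite pullE; apply: (mkgerm_eq AC1 xi1).
- exact: analytic_at_pull (lrep_analytic xi2 _).
- exact: (analytic_at_pull HF).
exact: (near_pull (mkgermK AC2 xi2 HF)).
Qed.

Lemma pullD g h : pull psi (g + h) = pull psi g + pull psi h.
Proof.
have [Hg Hh] := (lrep_analytic xi2 g, lrep_analytic xi2 h).
rewrite !pullE -(mkgermD AC1 xi1 (analytic_at_pull Hg) (analytic_at_pull Hh)).
apply: (mkgerm_eq AC1 xi1).
- exact: (analytic_at_pull (lrep_analytic xi2 (g + h))).
- exact: (analytic_atD (analytic_at_pull Hg) (analytic_at_pull Hh)).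
exact: (near_pull (lrepD AC2 xi2 g h)).
Qed.

Lemma pullM g h : pull psi (g * h) = pull psi g * pull psi h.
Proof.
have [Hg Hh] := (lrep_analytic xi2 g, lrep_analytic xi2 h).
rewrite !pullE -(mkgermM AC1 xi1 (analytic_at_pull Hg) (analytic_at_pull Hh)).
apply: (mkgerm_eq AC1 xi1).
- exact: (analytic_at_pull (lrep_analytic xi2 (g * h))).
- exact: (analytic_atM (analytic_at_pull Hg) (analytic_at_pull Hh)).
exact: (near_pull (lrepM AC2 xi2 g h)).
Qed.

Lemma pull_cst (c : C) : pull psi (germ A2 (fun=> c) x2) = germ A1 (fun=> c) x1.
Proof.
rewrite -(mkgerm_cst i2) (pull_mkgerm (analytic_at_cst c a2)).
exact: mkgerm_cst.
Qed.

Lemma pull1 : pull psi 1 = 1.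
Proof. by rewrite -(germ_cst1 AC2) pull_cst germ_cst1. Qed.

End Pull.

Section PullMore.
Variables (R : realType) (n1 n2 n3 : nat) (T1 T2 T3 : topologicalType).
Variables (A1 : atlas R n1 T1) (A2 : atlas R n2 T2) (A3 : atlas R n3 T3).
Variables (i1 : chart_index A1) (x1 : T1) (i2 : chart_index A2) (x2 : T2)
  (i3 : chart_index A3) (x3 : T3).
Hypotheses (AC1 : compatible A1) (AC2 : compatible A2).
Hypotheses (xi1 : chart_dom A1 i1 x1) (xi2 : chart_dom A2 i2 x2) (xi3 : chart_dom A3 i3 x3).

Lemma pull_comp psi chi (g : ostalk A3 x3) : chart_map i1 x1 i2 x2 psi ->
  chart_map i2 x2 i3 x3 chi ->
  pull i1 x1 i2 (x2 := x2) psi (pull i2 x2 i3 chi g) = pull i1 x1 i3 (chi \o psi) g.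
Proof.
move=> Hpsi Hchi; rewrite (pullE i2 x2).
rewrite (pull_mkgerm AC1 AC2 xi1 xi2 Hpsi (analytic_at_pull Hchi (lrep_analytic xi3 g))).
by rewrite pullE.
Qed.

End PullMore.

Lemma pull_id (R : realType) n (T : topologicalType) (A : atlas R n T) i x (psi : 'rV[Cx R]_n -> 'rV[Cx R]_n)
  (g : ostalk A x) : compatible A -> chart_dom A i x -> (forall z, psi z = z) -> pull i x i psi g = g.
Proof.
move=> cA xi psiE; rewrite pullE -[RHS](lrepK cA xi); apply: (congr1 (mkgerm i x)).
by apply/funext => z; rewrite /= psiE.
Qed.

Section ProductAtlas.
Variables (R : realType) (n d : nat) (T : topologicalType) (A : atlas R n T).
Local Notation C := (Cx R).
Hypothesis AC : compatible A.
Local Notation AW := (prod_atlas d A).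

Lemma analytic_at_lsubmx (z : 'rV[C]_(n + d)) k :
  analytic_at (fun y : 'rV[C]_(n + d) => (lsubmx y : 'rV[C]_n) 0 k) z.
Proof.
rewrite (_ : (fun y => _) = fun y : 'rV[C]_(n + d) => y 0 (lshift d k)).
  exact: analytic_at_coord.
by apply/funext => y; rewrite mxE.
Qed.

Lemma analytic_at_rsubmx (z : 'rV[C]_(n + d)) k :
  analytic_at (fun y : 'rV[C]_(n + d) => (rsubmx y : 'rV[C]_d) 0 k) z.
Proof.
rewrite (_ : (fun y => _) = fun y : 'rV[C]_(n + d) => y 0 (rshift n k)).
  exact: analytic_at_coord.
by apply/funext => y; rewrite mxE.
Qed.

Lemma lsubmx_continuous : continuous (lsubmx : 'rV[C]_(n + d) -> 'rV[C]_n).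
Proof. by move=> z; apply: analytic_map_continuous => k; exact: analytic_at_lsubmx. Qed.

Lemma rsubmx_continuous : continuous (rsubmx : 'rV[C]_(n + d) -> 'rV[C]_d).
Proof. by move=> z; apply: analytic_map_continuous => k; exact: analytic_at_rsubmx. Qed.

Lemma analytic_at_row_mx m (phi : 'rV[C]_m -> 'rV[C]_n) (chi : 'rV[C]_m -> 'rV[C]_d) z :
  (forall k, analytic_at (fun y => phi y 0 k) z) ->
  (forall k, analytic_at (fun y => chi y 0 k) z) ->
  forall k, analytic_at (fun y => row_mx (phi y) (chi y) 0 k) z.
Proof.
move=> Hphi Hchi k; case: (split_ordP k) => k' ->.
  rewrite (_ : (fun y => _) = fun y => phi y 0 k'); first exact: Hphi.
  by apply/funext => y; rewrite row_mxEl.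
rewrite (_ : (fun y => _) = fun y => chi y 0 k'); first exact: Hchi.
by apply/funext => y; rewrite row_mxEr.
Qed.

Lemma compatible_prod : compatible AW.
Proof.
case: AC => cover odom ochart local trans; split.
- by move=> [y t]; have [i yi] := cover y; exists i.
- move=> i; apply: (@open_comp _ _ (fun w : T * 'rV[C]_d => w.1) (chart_dom A i)) => [w _|].
    exact: cvg_fst.
  exact: odom.
- move=> i; rewrite (_ : _ @` _ = lsubmx @^-1` (chart A i @` chart_dom A i)).
    by apply: open_comp (ochart i) => z _; exact: lsubmx_continuous.
  apply/seteqP; split=> [_ [[y t] yi <-]|z [y yi yz]]; rewrite /= ?row_mxKl.
    by exists y.
  by exists (y, rsubmx z) => //=; rewrite yz hsubmxK.
- move=> i [y t] yi; have [yK cy ciy] := local i y yi; split.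
  + by rewrite /= row_mxKl row_mxKr yK.
  + apply/cvgrPdist_lt => e e0.
    have H1 : \forall w \near (y, t), `|chart A i y - chart A i w.1| < e.
      have H : \forall z \near y, `|chart A i y - chart A i z| < e.
        by have nF := nbhs_filter y; have /cvgrPdist_lt/(_ e e0) := cy.
      exact: (cvg_fst H).
    have H2 : \forall w \near (y, t), `|t - w.2| < e.
      have H : \forall s \near t, `|t - s| < e.
        by apply/nbhs_ballP; exists e => // s; rewrite -ball_normE.
      exact: (cvg_snd H).
    apply: filterS2 H1 H2 => -[z s] /= H1 H2; apply: rV_norm_lt => // k.
    case: (split_ordP k) => k' ->.
      rewrite opp_row_mx add_row_mx row_mxEl.
      exact: le_lt_trans (rV_norm_entry _ _) H1.
    rewrite opp_row_mx add_row_mx row_mxEr.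
    exact: le_lt_trans (rV_norm_entry _ _) H2.
  pose z0 : 'rV[C]_(n + d) := row_mx (chart A i y) t.
  rewrite -[chart AW i (y, t)]/z0.
  have z0F := nbhs_filter z0.
  apply: (@cvg_pair _ _ _ (nbhs z0) (nbhs (chart_inv A i (lsubmx z0))) (nbhs (rsubmx z0))).
    apply: (@cvg_comp _ _ _ _ _ _ (nbhs (lsubmx z0))); first exact: lsubmx_continuous.
    by rewrite row_mxKl; exact: ciy.
  exact: rsubmx_continuous.
move=> i j [y t] yi yj k; apply: analytic_at_row_mx => {}k; last exact: analytic_at_rsubmx.
apply: (analytic_at_comp (F := fun z => chart A j (chart_inv A i z) 0 k)) => [|l].
  by rewrite /= row_mxKl; exact: trans.
exact: analytic_at_lsubmx.
Qed.

End ProductAtlas.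

Lemma compatible_charts (R : realType) n (X : complexManifold R n) : compatible (charts X).
Proof. by case: X. Qed.

(** * Restriction to the zero section and to a graph *)

Section ZeroSection.
Variables (R : realType) (n d : nat) (T : topologicalType) (A : atlas R n T).
Local Notation C := (Cx R).
Variables (i : chart_index A) (p : T).
Hypothesis CA : compatible A.
Hypothesis pi : chart_dom A i p.
Local Notation AW := (prod_atlas d A).
Local Notation W := (T * 'rV[C]_d)%type.
Local Notation q := ((p, 0) : W).
Local Notation OX := (ostalk A p).
Local Notation OW := (ostalk AW q).
Local Notation a := (chart A i p).
Local Notation iW := (i : chart_index AW).
Local Notation aW := (chart AW iW q).

Local Notation pb := (@pullback R n T A d p).

Let CW : compatible AW := compatible_prod d CA.
Let qi : chart_dom AW iW q := pi.

Definition zero_section (y : 'rV[C]_n) : 'rV[C]_(n + d) := row_mx y 0.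

Lemma chart_map_lsubmx : chart_map (A1 := AW) (A2 := A) iW q i p (lsubmx : 'rV[C]_(n + d) -> 'rV[C]_n).
Proof. by split => [|k]; [exact: row_mxKl|exact: analytic_at_lsubmx]. Qed.

Lemma chart_map_zero_section : chart_map (A1 := A) (A2 := AW) i p iW q zero_section.
Proof.
split=> [//|k]; apply: analytic_at_row_mx => {}k; first exact: analytic_at_coord.
exact: analytic_at_cst.
Qed.

Lemma germ_near_eq (T' : topologicalType) n' (A' : atlas R n' T') x (f h : T' -> C) :
  compatible A' -> hol_at A' f x -> (\forall y \near x, f y = h y) -> germ A' f x = germ A' h x.
Proof. by move=> CA' Hf fh; apply/(germ_eqP CA' Hf (hol_at_eq CA' fh Hf)). Qed.

Lemma pullback_pull (g : OX) : pb g = pull (A1 := AW) iW q i (lsubmx : 'rV[C]_(n + d) -> 'rV[C]_n) g.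
Proof.
have LA := analytic_at_pull chart_map_lsubmx (lrep_analytic pi g).
rewrite pullE mkgermE; apply: esym; apply: (germ_near_eq CW (mkgerm_hol CW qi LA)).
have H : \forall w \near q, chart_inv A i (chart A i w.1) = w.1.
  exact: (cvg_fst (near_chart_invK CA pi)).
apply: filterS H => -[y t] /= yK; rewrite lrepE /=.
by rewrite row_mxKl yK.
Qed.

Lemma tcoordE j : tcoord A p j = cgerm (A := AW) iW q (rshift n j).
Proof.
rewrite /cgerm mkgermE; apply: (congr1 (fun F => germ AW F q)); apply/funext => -[y t] /=.
by rewrite !row_mxEr mxE subr0.
Qed.

Lemma dtE j (g : OW) : dt j g = dgerm iW (rshift n j) g.
Proof.
have LA := analytic_at_partial (rshift n j) (lrep_analytic qi g).
rewrite dgermE mkgermE; apply: esym; apply: (germ_near_eq CW (mkgerm_hol CW qi LA)).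
have H : \forall w \near q, chart_inv A i (chart A i w.1) = w.1.
  exact: (cvg_fst (near_chart_invK CA pi)).
apply: filterS H => -[y t] /= yK; rewrite /partial; apply: (congr1 (fun F : C -> C^o => derive1 F (0 : C))).
apply/funext => s; rewrite lrepE /= linearD /= linearD /= row_mxKl row_mxKr.
have -> : lsubmx (s *: delta_mx 0 (rshift n j) : 'rV[C]_(n + d)) = 0.
  by apply/rowP => k; rewrite !mxE eq_lrshift andbF mulr0.
have -> : rsubmx (s *: delta_mx 0 (rshift n j) : 'rV[C]_(n + d)) = s *: delta_mx 0 j.
  by apply/rowP => k; rewrite !mxE eq_rshift.
by rewrite addr0 yK.
Qed.

Lemma partial_lsubmx_l (F : 'rV[C]_n -> C) k :
  partial (lshift d k) (F \o (lsubmx : 'rV[C]_(n + d) -> 'rV[C]_n)) = partial k F \o lsubmx.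
Proof.
apply/funext => z; apply: (congr1 (fun F : C -> C^o => derive1 F (0 : C))).
apply/funext => s; rewrite /= linearD /=; apply: (congr1 (fun y => F (_ + y))).
by apply/rowP => l; rewrite !mxE eq_lshift.
Qed.

Lemma partial_lsubmx_r (F : 'rV[C]_n -> C) j :
  partial (rshift n j) (F \o (lsubmx : 'rV[C]_(n + d) -> 'rV[C]_n)) = fun=> 0.
Proof.
apply/funext => z; rewrite -[RHS](partial_cst (F (lsubmx z)) 0 (rshift n j)).
apply: (congr1 (fun F : C -> C^o => derive1 F (0 : C))); apply/funext => s /=.
rewrite linearD /= (_ : lsubmx (s *: _) = 0) ?addr0 //.
by apply/rowP => k; rewrite !mxE eq_lrshift andbF mulr0.
Qed.

Lemma dgerm_pullback_l k (g : OX) :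
  dgerm iW (lshift d k) (pb g) = pb (dgerm i k g).
Proof.
have Hg := lrep_analytic pi g; rewrite !pullback_pull pullE.
rewrite (dgerm_mkgerm CW qi _ (analytic_at_pull chart_map_lsubmx Hg)) partial_lsubmx_l dgermE.
by rewrite (pull_mkgerm CW CA qi pi chart_map_lsubmx (analytic_at_partial k Hg)).
Qed.

Lemma dgerm_pullback_r j (g : OX) : dgerm iW (rshift n j) (pb g) = 0.
Proof.
have Hg := lrep_analytic pi g; rewrite !pullback_pull pullE.
rewrite (dgerm_mkgerm CW qi _ (analytic_at_pull chart_map_lsubmx Hg)) partial_lsubmx_r.
exact: mkgerm0.
Qed.

Definition restr0 (g : OW) : OX := pull i p iW zero_section g.

Lemma restr0E (g : OW) : restr0 g = germ A (fun x => germ_rep g (x, 0)) p.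
Proof.
have LA := analytic_at_pull chart_map_zero_section (lrep_analytic qi g).
rewrite /restr0 pullE mkgermE; apply: (germ_near_eq CA (mkgerm_hol CA pi LA)).
apply: filterS (near_chart_invK CA pi) => y yK; rewrite lrepE /=.
by rewrite row_mxKl row_mxKr yK.
Qed.

Lemma restr0_hol (g : OW) : hol_at A (fun x => germ_rep g (x, 0)) p.
Proof.
have LA := analytic_at_pull chart_map_zero_section (lrep_analytic qi g).
apply: (hol_at_eq CA _ (mkgerm_hol CA pi LA)).
apply: filterS (near_chart_invK CA pi) => y yK; rewrite lrepE /=.
by rewrite row_mxKl row_mxKr yK.
Qed.

Lemma near_zero_section (P : W -> Prop) :
  (\forall w \near q, P w) -> \forall x \near p, P (x, 0).
Proof.
move=> H; have c0 : (fun x : T => (x, 0 : 'rV[C]_d)) @ p --> q.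
  apply: (@cvg_pair _ _ _ (nbhs p) (nbhs p) (nbhs (0 : 'rV[C]_d))); first exact: cvg_id.
  exact: cvg_cst.
exact: c0 H.
Qed.

Lemma ideal_YP (g : OW) : ideal_Y g <-> restr0 g = 0.
Proof.
have Hc : hol_at A (fun=> 0 : C) p by move=> j _; exact: analytic_at_cst.
rewrite restr0E -(germ_cst0 CA p); split.
  move=> [V [F [oV Vq hF -> F0]]]; apply/(germ_eqP CA (restr0_hol _) Hc).
  have H1 := near_zero_section (germ_repE CW (hF q Vq)).
  have H2 : \forall x \near p, V (x, 0).
    by apply: near_zero_section; apply: open_nbhs_nbhs.
  by apply: filterS2 H1 H2 => x -> /F0.
move=> /(germ_eqP CA (restr0_hol g) Hc) g0.
pose V := [set w : W | hol_at AW (germ_rep g) w /\ germ_rep g (w.1, 0) = 0].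
have Vq : nbhs q V.
  exact: filterI (hol_at_near CW (germ_rep_hol g)) (cvg_fst g0).
exists V°, (germ_rep g); split.
- exact: open_interior.
- exact: Vq.
- by move=> w /interior_subset[].
- by rewrite germ_repK.
- by move=> x /interior_subset[].
Qed.

Lemma restr0_tcoord j : restr0 (tcoord A p j) = 0.
Proof.
apply/ideal_YP; exists setT, (fun w : W => w.2 0 j); split => //; first exact: openT.
  move=> w _ k wk; rewrite (_ : _ \o _ = fun z : 'rV[C]_(n + d) => (rsubmx z : 'rV[C]_d) 0 j) //.
  exact: analytic_at_rsubmx.
by move=> x _; rewrite mxE.
Qed.

(** Only the fibre coordinates are reset, so the leading part is the restriction to the zero
    section, pulled back along the projection. *)
Lemma hadamard0 (g : OW) : exists b : 'I_d -> OW,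
  g = pb (restr0 g) + \sum_j tcoord A p j * b j.
Proof.
have [H E] := germ_hadamard CW qi (fun k => n <= k)%N g.
exists (fun j => H (rshift n j)); rewrite [LHS]E pullback_pull /restr0.
rewrite (pull_comp CW CA qi pi qi _ chart_map_lsubmx chart_map_zero_section) pullE.
have -> : reset (fun k : 'I_(n + d) => (n <= k)%N) aW = zero_section \o lsubmx.
  apply/funext => z; apply/rowP => k; rewrite mxE /=.
  case: (split_ordP k) => l ->; rewrite /= ?row_mxEl ?row_mxEr.
    by rewrite leqNgt ltn_ord mxE.
  by rewrite leq_addr.
apply: (congr1 (fun y => _ + y)); rewrite big_mkcond big_split_ord /=.
rewrite big1 => [|k _]; last by rewrite leqNgt ltn_ord.
rewrite add0r; apply: eq_bigr => j _.
by rewrite leq_addr tcoordE.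
Qed.

Section Graph.
Variable f : 'I_d -> OX.
Hypothesis f0 : forall j, lrep i (f j) a = 0.

Definition frow (y : 'rV[C]_n) : 'rV[C]_d := \row_j lrep i (f j) y.

Definition graph_map (y : 'rV[C]_n) : 'rV[C]_(n + d) := row_mx y (frow y).

(** The map (x, t) to (x, t + s f(x)). For s = 1 it carries the zero section onto the graph of [f],
    and s = -1 gives its inverse. *)
Definition translation (s : C) (z : 'rV[C]_(n + d)) : 'rV[C]_(n + d) :=
  row_mx (lsubmx z) (rsubmx z + s *: frow (lsubmx z)).

Lemma frow0 : frow a = 0.
Proof. by apply/rowP => j; rewrite !mxE f0. Qed.

Lemma frow_analytic k : analytic_at (fun y => frow y 0 k) a.
Proof.
rewrite (_ : (fun y => _) = lrep i (f k)); first exact: lrep_analytic.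
by apply/funext => y; rewrite mxE.
Qed.

Lemma chart_map_graph : chart_map (A1 := A) (A2 := AW) i p iW q graph_map.
Proof.
split=> [|k]; first by rewrite /graph_map frow0.
apply: analytic_at_row_mx => {}k; first exact: analytic_at_coord.
exact: frow_analytic.
Qed.

Lemma chart_map_translation s : chart_map (A1 := AW) (A2 := AW) iW q iW q (translation s).
Proof.
split=> [|k]; first by rewrite /translation row_mxKl row_mxKr frow0 scaler0 addr0.
apply: analytic_at_row_mx => {}k; first exact: analytic_at_lsubmx.
pose F k (z : 'rV[C]_(n + d)) := lrep i (f k) (lsubmx z).
have HF : analytic_at (F k) aW := analytic_at_pull chart_map_lsubmx (lrep_analytic pi (f k)).
rewrite (_ : (fun y => _) = fun y : 'rV[C]_(n + d) => (rsubmx y : 'rV[C]_d) 0 k + s * F k y).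
  apply: analytic_atD; first exact: analytic_at_rsubmx.
  exact: (analytic_atM (analytic_at_cst s aW) HF).
by apply/funext => y; rewrite !mxE.
Qed.

Definition graph_restr (g : OW) : OX := pull i p iW graph_map g.

Lemma graph_restr_pullback g : graph_restr (pb g) = g.
Proof.
rewrite pullback_pull /graph_restr (pull_comp CA CW pi qi pi _ chart_map_graph chart_map_lsubmx).
by apply: (pull_id _ CA pi) => y; exact: row_mxKl.
Qed.

Lemma pull_tcoord (T' : topologicalType) n' (A' : atlas R n' T') i' x' psi j :
  compatible A' -> chart_dom A' i' x' -> chart_map (A1 := A') (A2 := AW) i' x' iW q psi ->
  pull i' x' iW psi (tcoord A p j) = mkgerm i' x' (fun z => psi z 0 (rshift n j)).
Proof.
move=> CA' xi' Hpsi; rewrite tcoordE.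
rewrite /cgerm (pull_mkgerm CA' CW xi' qi Hpsi (@cgerm_analytic _ _ _ _ iW q (rshift n j) aW)).
apply: (congr1 (mkgerm i' x')); apply/funext => z.
by rewrite /= row_mxEr mxE subr0.
Qed.

Lemma graph_restr_tcoord j : graph_restr (tcoord A p j) = f j.
Proof.
rewrite /graph_restr (pull_tcoord _ CA pi chart_map_graph) -[RHS](lrepK CA pi).
apply: (congr1 (mkgerm i p)); apply/funext => z.
by rewrite row_mxEr mxE.
Qed.

(** This is [hadamard0] conjugated by the translation that straightens the graph. It shows that
    modulo the equations of the graph every function comes from the base. *)
Lemma hadamard_graph (g : OW) : exists b : 'I_d -> OW,
  g = pb (graph_restr g) + \sum_j (tcoord A p j - pb (f j)) * b j.
Proof.
have Ht := chart_map_translation.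
have [b E] := hadamard0 (pull iW q iW (translation 1) g).
pose tr := pull (A1 := AW) iW q iW (translation (-1)) (x2 := q).
exists (fun j => tr (b j)).
have gE : g = tr (pull iW q iW (translation 1) g).
  rewrite /tr (pull_comp CW CW qi qi qi _ (Ht _) (Ht _)) pull_id //.
  move=> z; rewrite /= /translation row_mxKl row_mxKr scale1r scaleN1r subrK.
  by rewrite hsubmxK.
have L1 : tr (pb (restr0 (pull iW q iW (translation 1) g))) = pb (graph_restr g).
  apply: etrans (congr1 tr (pullback_pull _)) (esym (etrans (pullback_pull _) (esym _))).
  apply: etrans (pull_comp CW CW qi qi pi _ (Ht (-1)) chart_map_lsubmx) _.
  have -> : (lsubmx : 'rV[C]_(n + d) -> 'rV[C]_n) \o translation (-1) = lsubmx.
    by apply/funext => z; rewrite /= row_mxKl.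
  apply: congr1; apply: etrans (pull_comp CA CW pi qi qi g chart_map_zero_section (Ht 1)) _.
  rewrite /graph_restr (_ : translation 1 \o zero_section = graph_map); first by [].
  apply/funext => y; rewrite /= /translation row_mxKl row_mxKr.
  by rewrite scale1r add0r.
have trD : {morph tr : y z / y + z} := pullD CW CW qi qi (Ht (-1)).
have L2 : tr (\sum_j tcoord A p j * b j) = \sum_j (tcoord A p j - pb (f j)) * tr (b j).
  rewrite (big_morph _ trD (morphD0 trD)); apply: eq_bigr => j _.
  rewrite /tr (pullM CW CW qi qi (Ht (-1))); apply: (congr1 (fun y => y * _)).
  have H1 := (Ht (-1)).2 (rshift n j).
  have H2 := analytic_at_pull chart_map_lsubmx (lrep_analytic pi (f j)).
  rewrite (pull_tcoord _ CW qi (Ht (-1))); apply: (addIr (pb (f j))); rewrite [RHS]subrK.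
  rewrite pullback_pull pullE tcoordE -(mkgermD CW qi H1 H2).
  apply: (congr1 (mkgerm _ _)); apply/funext => z.
  by rewrite /translation !row_mxEr !mxE mulN1r subrK subr0.
exact: etrans gE (etrans (congr1 tr E) (etrans (trD _ _) (f_equal2 (@GRing.add _) L1 L2))).
Qed.

End Graph.

End ZeroSection.

(** * The filtration V u on a direct image *)

Section IdealPowers.
Variables (B : comNzRingType) (F : B -> Prop).

Inductive ideal_pow : nat -> B -> Prop :=
| Ideal_pow0 h : ideal_pow 0 h
| Ideal_powS k a h : F a -> ideal_pow k h -> ideal_pow k.+1 (a * h)
| Ideal_powD k g h : ideal_pow k g -> ideal_pow k h -> ideal_pow k (g + h).

Lemma ideal_powM k a h : ideal_pow k h -> ideal_pow k (a * h).
Proof.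
elim=> [g|k' b g Fb _ IH|k' g g' _ IH _ IH']; first exact: Ideal_pow0.
  by rewrite mulrCA; exact: Ideal_powS.
by rewrite mulrDr; exact: Ideal_powD.
Qed.

Lemma ideal_pow_mono k h : ideal_pow k.+1 h -> ideal_pow k h.
Proof.
move E: k.+1 => k1 H; elim: H k E => {k1 h} [//|k a h _ Hh _ k' [->]|k g h _ IH _ IH' k' E].
  exact: ideal_powM.
by apply: Ideal_powD; [exact: IH|exact: IH'].
Qed.

Lemma ideal_pow_zero k : F 0 -> ideal_pow k 0.
Proof.
move=> F0; case: k => [|k]; first exact: Ideal_pow0.
elim: k => [|k IH]; rewrite -(mul0r (0 : B)); apply: Ideal_powS => //.
exact: Ideal_pow0.
Qed.

Lemma ideal_pow_sum k (I : Type) (s : seq I) (h : I -> B) : F 0 ->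
  (forall i, ideal_pow k (h i)) -> ideal_pow k (\sum_(i <- s) h i).
Proof.
move=> F0 H; elim/big_ind: _ => //; first exact: ideal_pow_zero.
by move=> *; exact: Ideal_powD.
Qed.
End IdealPowers.

(** * The algebra of a direct image under a graph embedding *)

Section GraphModules.
Variables (OX : comNzRingType) (n : nat) (X : 'I_n -> OX -> OX).
Variables (M : zmodType) (mf : OX -> M -> M) (mX : 'I_n -> M -> M).

(* The algebra of the direct image of a module M under the graph embedding of
   f_1, ..., f_d: gO and gD are the stalks of functions and of differential
   operators on the product, gfo, gdo and gYo the operators attached to a function,
   to t_j and to the k-th coordinate field, and gv m is m (x) delta. *)
Record graph_module (d : nat) (f : 'I_d -> OX) := GraphModule {
  gO : comNzRingType;
  gD : pzRingType;
  gN : lmodType gD;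
  gpb : OX -> gO;
  gt : 'I_d -> gO;
  gdt : 'I_d -> gO -> gO;
  gY : 'I_n -> gO -> gO;
  gfo : gO -> gD;
  gdo : 'I_d -> gD;
  gYo : 'I_n -> gD;
  gv : M -> gN;
  gpbD : {morph gpb : a b / a + b};
  gpbM : {morph gpb : a b / a * b};
  gpb1 : gpb 1 = 1;
  gdtD : forall j, {morph gdt j : a b / a + b};
  gdtM : forall j a b, gdt j (a * b) = gdt j a * b + a * gdt j b;
  gdt_pb : forall j a, gdt j (gpb a) = 0;
  gdt_t : forall j l, gdt j (gt l) = (j == l)%:R;
  gYD : forall k, {morph gY k : a b / a + b};
  gYM : forall k a b, gY k (a * b) = gY k a * b + a * gY k b;
  gY_pb : forall k a, gY k (gpb a) = gpb (X k a);
  gY_t : forall k j, gY k (gt j) = 0;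
  gfoD : {morph gfo : a b / a + b};
  gfoM : {morph gfo : a b / a * b};
  gfo1 : gfo 1 = 1;
  gdo_fo : forall j a, gdo j * gfo a = gfo (gdt j a) + gfo a * gdo j;
  gYo_fo : forall k a, gYo k * gfo a = gfo (gY k a) + gfo a * gYo k;
  gdoC : forall i j, gdo i * gdo j = gdo j * gdo i;
  gYo_do : forall k j, gYo k * gdo j = gdo j * gYo k;
  gvD : {morph gv : m m' / m + m'};
  gpb_v : forall a m, gfo (gpb a) *: gv m = gv (mf a m);
  gt_v : forall j m, gfo (gt j) *: gv m = gv (mf (f j) m);
  gY_v : forall k m, gYo k *: gv m =
    gv (mX k m) - \sum_j gdo j *: gv (mf (X k (f j)) m)
}.

Section OneModule.
Variables (d : nat) (f : 'I_d -> OX) (G : graph_module f).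
Local Notation pb := (@gpb _ _ G).
Local Notation t := (@gt _ _ G).
Local Notation fo := (@gfo _ _ G).
Local Notation do := (@gdo _ _ G).
Local Notation Yo := (@gYo _ _ G).
Local Notation v := (@gv _ _ G).
Implicit Types (a : OX) (m : M) (x y : gN G).

Definition gfp a : gD G := fo (pb a).

Lemma gfpD : {morph gfp : a b / a + b}.
Proof. by move=> a b; rewrite /gfp gpbD gfoD. Qed.

Lemma gfpM : {morph gfp : a b / a * b}.
Proof. by move=> a b; rewrite /gfp gpbM gfoM. Qed.

Lemma gfp1 : gfp 1 = 1.
Proof. by rewrite /gfp gpb1 gfo1. Qed.

Lemma gfp_nat s : gfp s%:R = s%:R.
Proof.
elim: s => [|s IH]; first exact: morphD0 gfpD.
by rewrite -!natr1 gfpD IH gfp1.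
Qed.

Lemma gdo_fp j a : do j * gfp a = gfp a * do j.
Proof. by rewrite gdo_fo gdt_pb (morphD0 (@gfoD _ _ G)) add0r. Qed.

Lemma gfpC a b : gfp a * gfp b = gfp b * gfp a.
Proof. by rewrite -!gfpM mulrC. Qed.

Lemma gdo_t j l : do j * fo (t l) = (j == l)%:R + fo (t l) * do j.
Proof.
rewrite gdo_fo gdt_t; congr (_ + _).
by case: (j == l); [exact: gfo1|exact: morphD0 (@gfoD _ _ G)].
Qed.

Lemma gYo_t k j : Yo k * fo (t j) = fo (t j) * Yo k.
Proof. by rewrite gYo_fo gY_t (morphD0 (@gfoD _ _ G)) add0r. Qed.

Lemma gt_fp j a : fo (t j) * gfp a = gfp a * fo (t j).
Proof. by rewrite /gfp -!gfoM mulrC. Qed.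

Lemma gvN m : v (- m) = - v m.
Proof. by apply: (addIr (v m)); rewrite -gvD !addNr (morphD0 (@gvD _ _ G)). Qed.

Lemma gv_sum (I : Type) (s : seq I) (h : I -> M) : v (\sum_(i <- s) h i) = \sum_(i <- s) v (h i).
Proof. exact: (big_morph v (@gvD _ _ G) (morphD0 (@gvD _ _ G))). Qed.

Definition gtheta : gD G := \sum_j fo (t j) * do j.

Lemma gtheta_fp a : gtheta * gfp a = gfp a * gtheta.
Proof.
rewrite /gtheta mulr_suml mulr_sumr; apply: eq_bigr => j _.
by rewrite -mulrA gdo_fp !mulrA gt_fp.
Qed.

Lemma gdo_theta j : do j * gtheta = gtheta * do j + do j.
Proof.
rewrite /gtheta mulr_suml mulr_sumr.
under eq_bigr do rewrite mulrA gdo_t mulrDl -mulrA (gdoC G j) mulrA.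
rewrite big_split /= addrC; congr (_ + _).
rewrite (bigD1 j) //= eqxx mul1r big1 ?addr0 // => l.
by rewrite eq_sym => /negbTE ->; rewrite mul0r.
Qed.

(** Moving each derivative in front of its coordinate adds 1, hence [d] in total; the coordinate
    then acts on [v m] as [f j]. *)
Lemma gtheta_v m : (gtheta + d%:R) *: v m = \sum_j do j *: v (mf (f j) m).
Proof.
rewrite scalerDl /gtheta scaler_suml -[in RHS](@eq_bigr _ _ _ _ _ _
  (fun j => (fo (t j) * do j) *: v m + v m)) => [|j _].
  rewrite big_split /= sumr_const card_ord; congr (_ + _).
  by rewrite scaler_nat.
by rewrite -gt_v scalerA gdo_t eqxx scalerDl scale1r addrC.
Qed.

(** The part of the direct image on which an additive map commuting suitably with the t-derivatives
    is controlled by its values on the [v m]. It is stable under functions of the base, the [t j]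
    and the coordinate fields. *)
Inductive gspan : gN G -> Prop :=
| Gspan_v m : gspan (v m)
| Gspan_add x y : gspan x -> gspan y -> gspan (x + y)
| Gspan_do j x : gspan x -> gspan (do j *: x).

Lemma gspanN x : gspan x -> gspan (- x).
Proof.
elim=> [m|x1 x2 _ H1 _ H2|j y _ H]; first by rewrite -gvN; exact: Gspan_v.
  by rewrite opprD; exact: Gspan_add.
by rewrite -scalerN; exact: Gspan_do.
Qed.

Lemma gspan0 : gspan 0.
Proof. by rewrite -(morphD0 (@gvD _ _ G)); exact: Gspan_v. Qed.

Lemma gspan_sum (I : Type) (s : seq I) (h : I -> gN G) :
  (forall i, gspan (h i)) -> gspan (\sum_(i <- s) h i).
Proof. by move=> H; elim/big_ind: _ => //; [exact: gspan0|exact: Gspan_add]. Qed.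

Lemma gspan_fp a x : gspan x -> gspan (gfp a *: x).
Proof.
elim=> [m|x1 x2 _ H1 _ H2|j y _ H]; first by rewrite /gfp gpb_v; exact: Gspan_v.
  by rewrite scalerDr; exact: Gspan_add.
by rewrite scalerA -gdo_fp -scalerA; exact: Gspan_do.
Qed.

Lemma gspan_Y k x : gspan x -> gspan (Yo k *: x).
Proof.
elim=> [m|x1 x2 _ H1 _ H2|j y _ H].
- rewrite gY_v; apply: Gspan_add; first exact: Gspan_v.
  apply/gspanN/gspan_sum => j; apply: Gspan_do; exact: Gspan_v.
- by rewrite scalerDr; exact: Gspan_add.
- by rewrite scalerA gYo_do -scalerA; exact: Gspan_do.
Qed.

Lemma gspan_t j x : gspan x -> gspan (fo (t j) *: x).
Proof.
elim=> [m|x1 x2 _ H1 _ H2|l y Hy H]; first by rewrite gt_v; exact: Gspan_v.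
  by rewrite scalerDr; exact: Gspan_add.
have -> : fo (t j) *: (do l *: y) = do l *: (fo (t j) *: y) - (l == j)%:R *: y.
  by rewrite !scalerA gdo_t scalerDl addrC addKr.
apply: Gspan_add; first exact: Gspan_do.
by apply: gspanN; rewrite scaler_nat; case: (l == j); rewrite ?mulr0n //; exact: gspan0.
Qed.

Lemma gspan_theta s x : gspan x -> gspan ((gtheta + s%:R) *: x).
Proof.
move=> Hx; rewrite scalerDl; apply: Gspan_add; last first.
  by rewrite -gfp_nat; exact: gspan_fp.
rewrite /gtheta scaler_suml; apply: gspan_sum => j; rewrite -scalerA.
by apply: gspan_t; exact: Gspan_do.
Qed.

Definition gfield (b : 'I_d -> OX) : gD G := \sum_k gfp (b k) * do k.

Lemma gfield_fp b c : gfield b * gfp c = gfp c * gfield b.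
Proof.
rewrite /gfield mulr_suml mulr_sumr; apply: eq_bigr => k _.
by rewrite -mulrA gdo_fp !mulrA gfpC.
Qed.

Lemma gfield_do b j : gfield b * do j = do j * gfield b.
Proof.
rewrite /gfield mulr_suml mulr_sumr; apply: eq_bigr => k _.
by rewrite mulrA gdo_fp -!mulrA (gdoC G j).
Qed.

(** The coefficients come from the base, so the t-derivatives do not see them. The residue
    construction needs commuting operators on its target, and these fields will be its operators. *)
Lemma gfieldC b c : gfield b * gfield c = gfield c * gfield b.
Proof.
rewrite {2 3}/gfield mulr_suml mulr_sumr; apply: eq_bigr => k _.
by rewrite mulrA gfield_fp -!mulrA gfield_do.
Qed.

Lemma gfield_theta b : gfield b * gtheta = gtheta * gfield b + gfield b.
Proof.
rewrite /gfield mulr_suml mulr_sumr -big_split; apply: eq_bigr => k _ /=.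
by rewrite -mulrA gdo_theta mulrDr !mulrA gtheta_fp.
Qed.

Lemma gYo_field i b : Yo i * gfield b = gfield b * Yo i + gfield (fun k => X i (b k)).
Proof.
rewrite /gfield mulr_suml mulr_sumr -big_split; apply: eq_bigr => k _ /=.
by rewrite mulrA /gfp gYo_fo gY_pb mulrDl -!mulrA gYo_do addrC.
Qed.

Lemma gfp_do_v b c k m : (forall b c m, mf (b * c) m = mf b (mf c m)) ->
  (gfp b * do k) *: v (mf c m) = do k *: v (mf (b * c) m).
Proof. by move=> ->; rewrite -gdo_fp -scalerA /gfp gpb_v. Qed.

Variables (F : OX -> Prop) (u : M).

(* W k is V^(-k) u: in each generator the power of the ideal exceeds the number of
   t-derivatives by k. *)
Inductive gW : nat -> gN G -> Prop :=
| GW_v k h : ideal_pow F k h -> gW k (v (mf h u))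
| GW_add k x y : gW k x -> gW k y -> gW k (x + y)
| GW_fp k a x : gW k x -> gW k (gfp a *: x)
| GW_Y k i x : gW k x -> gW k (Yo i *: x)
| GW_do k j x : gW k.+1 x -> gW k (do j *: x)
| GW_mono k x : gW k.+1 x -> gW k x.

Lemma gW_span k x : gW k x -> gspan x.
Proof.
elim=> {k x} [k h _|k x y _ Hx _ Hy|k a x _ H|k i x _ H|k j x _ H|//].
- exact: Gspan_v.
- exact: Gspan_add.
- exact: gspan_fp.
- exact: gspan_Y.
- exact: Gspan_do.
Qed.

Hypothesis F0 : F 0.

Lemma gW0 k : gW k 0.
Proof.
have : gW k (v (mf 0 u)) by apply: GW_v; exact: ideal_pow_zero.
by move=> /(GW_fp 0); rewrite (morphD0 gfpD) scale0r.
Qed.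

Lemma gW_sum k (I : Type) (s : seq I) (h : I -> gN G) :
  (forall i, gW k (h i)) -> gW k (\sum_(i <- s) h i).
Proof. by move=> H; elim/big_ind: _ => //; [exact: gW0|exact: GW_add]. Qed.

Lemma gWN k x : gW k x -> gW k (- x).
Proof.
have E : gfp (-1) = -1 by apply: (addIr (gfp 1)); rewrite -gfpD gfp1 !addNr (morphD0 gfpD).
by move=> /(GW_fp (-1)); rewrite E scaleN1r.
Qed.

End OneModule.

(** * Transport of the filtration between two systems of generators *)

Section Transport.
Variables (d e : nat) (f : 'I_d -> OX) (g : 'I_e -> OX).
Variables (G : graph_module f) (G' : graph_module g).
Variables (a : 'I_e -> 'I_d -> OX) (Phi : gN G -> gN G').

Definition pushed j : gD G' := gfield G' (a^~ j).

Hypothesis mfD : forall b c m, mf (b + c) m = mf b m + mf c m.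
Hypothesis mfM : forall b c m, mf (b * c) m = mf b (mf c m).
Hypothesis XD : forall i, {morph X i : b c / b + c}.
Hypothesis XM : forall i b c, X i (b * c) = X i b * c + b * X i c.
Hypothesis gE : forall k, g k = \sum_j a k j * f j.
Hypothesis PhiD : {morph Phi : x y / x + y}.
Hypothesis Phi_v : forall m, Phi (gv G m) = gv G' m.
Hypothesis Phi_do : forall j x, Phi (gdo G j *: x) = pushed j *: Phi x.

Lemma PhiN x : Phi (- x) = - Phi x.
Proof. by apply: (addIr (Phi x)); rewrite -PhiD !addNr (morphD0 PhiD). Qed.

Lemma Phi_sum (I : Type) (s : seq I) (h : I -> gN G) :
  Phi (\sum_(i <- s) h i) = \sum_(i <- s) Phi (h i).
Proof. exact: (big_morph Phi PhiD (morphD0 PhiD)). Qed.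

Lemma mf_sum (I : Type) (s : seq I) (h : I -> OX) m :
  mf (\sum_(i <- s) h i) m = \sum_(i <- s) mf (h i) m.
Proof.
have mD : {morph mf^~ m : b c / b + c} by move=> b c; exact: mfD.
exact: (big_morph (mf^~ m) mD (morphD0 mD)).
Qed.

Lemma Phi_fp b x : gspan x -> Phi (gfp G b *: x) = gfp G' b *: Phi x.
Proof.
elim=> [m|x1 x2 _ H1 _ H2|j y _ H]; first by rewrite /gfp gpb_v !Phi_v gpb_v.
  by rewrite scalerDr !PhiD H1 H2 scalerDr.
by rewrite scalerA -gdo_fp -scalerA !Phi_do H !scalerA gfield_fp.
Qed.

Lemma Phi_theta x : gspan x ->
  Phi ((gtheta G + d%:R) *: x) = (gtheta G' + e%:R) *: Phi x.
Proof.
elim=> [m|x1 x2 _ H1 _ H2|j y _ H].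
- rewrite gtheta_v Phi_sum Phi_v gtheta_v.
  under eq_bigr do rewrite Phi_do Phi_v /pushed /gfield scaler_suml.
  rewrite exchange_big /=; apply: eq_bigr => k _; rewrite gE mf_sum gv_sum scaler_sumr.
  by apply: eq_bigr => j _; rewrite gfp_do_v.
- by rewrite scalerDr !PhiD H1 H2 scalerDr.
(* [gdo_theta] and [gfield_theta] are the same commutation rule on the two sides, so the constants
   [d] and [e] pass through unchanged. *)
have -> : (gtheta G + d%:R) *: (gdo G j *: y) = gdo G j *: ((gtheta G + d%:R) *: y) - gdo G j *: y.
  rewrite !scalerA mulrDr gdo_theta mulrDl -scalerBl; congr (_ *: _).
  by rewrite mulr_natl mulr_natr addrAC addrK.
rewrite PhiD PhiN !Phi_do H !scalerA -scalerBl; congr (_ *: _).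
by rewrite mulrDr gfield_theta mulrDl mulr_natl mulr_natr addrAC addrK.
Qed.

(** By Leibniz, X_i(g_k) is the sum over j of X_i(a_kj) f_j and a_kj X_i(f_j). The second part
    matches the chain rule on the source; the first is the defect, in which f_j is the action of
    t_j. *)
Lemma Phi_Y i x : gspan x -> Phi (gYo G i *: x) = gYo G' i *: Phi x +
  \sum_j gfield G' (fun k => X i (a k j)) *: Phi (gfo (gt G j) *: x).
Proof.
elim=> [m|x1 x2 _ H1 _ H2|l y _ H].
- rewrite gY_v PhiD PhiN Phi_sum !Phi_v gY_v -addrA; congr (_ + _).
  pose w k j := gdo G' k *: gv G' (mf (X i (a k j) * f j) m).
  pose z k j := gdo G' k *: gv G' (mf (a k j * X i (f j)) m).
  have -> : \sum_j Phi (gdo G j *: gv G (mf (X i (f j)) m)) = \sum_k \sum_j z k j.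
    rewrite exchange_big /=; apply: eq_bigr => j _; rewrite Phi_do Phi_v scaler_suml.
    by apply: eq_bigr => k _; rewrite gfp_do_v.
  have -> : \sum_k gdo G' k *: gv G' (mf (X i (g k)) m) = \sum_k \sum_j (w k j + z k j).
    apply: eq_bigr => k _; rewrite gE (big_morph (X i) (XD i) (morphD0 (XD i))).
    rewrite mf_sum gv_sum scaler_sumr; apply: eq_bigr => j _.
    by rewrite XM mfD gvD scalerDr.
  have -> : \sum_j gfield G' (fun k => X i (a k j)) *: Phi (gfo (gt G j) *: gv G m) =
      \sum_k \sum_j w k j.
    rewrite exchange_big /=; apply: eq_bigr => j _; rewrite gt_v Phi_v scaler_suml.
    by apply: eq_bigr => k _; rewrite gfp_do_v.
  under [X in _ = - X + _]eq_bigr do rewrite big_split /=.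
  by rewrite big_split /= opprD addrAC addNr add0r.
- rewrite !scalerDr !PhiD H1 H2 scalerDr addrACA -big_split; congr (_ + _).
  by apply: eq_bigr => j _; rewrite !scalerDr PhiD scalerDr.
(* Commuting the coordinate field with [pushed l] produces the field with coefficients
   [X i (a k l)]. It cancels against the commutator of [gt G l] with [gdo G l] in the term [j = l]
   of the defect. *)
rewrite scalerA gYo_do -scalerA !Phi_do H scalerDr scalerA.
rewrite [in RHS]scalerA /pushed gYo_field scalerDl -addrA; congr (_ + _).
set Cj := fun j => gfield G' (fun k => X i (a k j)).
have -> : \sum_j Cj j *: Phi (gfo (gt G j) *: (gdo G l *: y)) =
    \sum_j pushed l *: (Cj j *: Phi (gfo (gt G j) *: y)) - Cj l *: Phi y.
  rewrite [X in _ = _ - X](_ : _ = \sum_j (l == j)%:R *: (Cj j *: Phi y)); last first.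
    rewrite (bigD1 l) //= eqxx scale1r big1 ?addr0 // => j.
    by rewrite eq_sym => /negbTE ->; rewrite scale0r.
  rewrite -sumrB; apply: eq_bigr => j _.
  have -> : gfo (gt G j) *: (gdo G l *: y) = gdo G l *: (gfo (gt G j) *: y) - (l == j)%:R *: y.
    by rewrite !scalerA gdo_t scalerDl addrC addKr.
  rewrite PhiD PhiN Phi_do scalerDr scalerN !scalerA gfieldC; congr (_ - _).
  case: (l == j); first by rewrite !scale1r mul1r.
  by rewrite scale0r (morphD0 PhiD) scaler0 mul0r scale0r.
by rewrite scaler_sumr addrC subrK.
Qed.

(* Phi does not commute with the t_j, so the transport of gW is proved after acting by
   an arbitrary polynomial in t of order at least r. *)
Inductive gtpol : nat -> gO G -> Prop :=
| Gtpol_pb b : gtpol 0 (gpb G b)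
| Gtpol_0 r : gtpol r 0
| Gtpol_add r y z : gtpol r y -> gtpol r z -> gtpol r (y + z)
| Gtpol_pbM r b y : gtpol r y -> gtpol r (gpb G b * y)
| Gtpol_t r j y : gtpol r y -> gtpol r.+1 (gt G j * y)
| Gtpol_mono r y : gtpol r.+1 y -> gtpol r y.

Lemma gtpol_dt r y j : gtpol r y -> gtpol r.-1 (gdt j y).
Proof.
elim=> {r y} [b|r|r y z _ IH _ IH'|r b y _ IH|r l y Hy IH|r y _ IH].
- by rewrite gdt_pb; exact: Gtpol_0.
- by rewrite (morphD0 (@gdtD _ _ G j)); exact: Gtpol_0.
- by rewrite gdtD; exact: Gtpol_add.
- by rewrite gdtM gdt_pb mul0r add0r; exact: Gtpol_pbM.
- rewrite gdtM gdt_t; apply: Gtpol_add.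
    by case: (j == l); rewrite ?mul1r // mul0r; exact: Gtpol_0.
  case: r Hy IH => [|r] Hy IH; last exact: Gtpol_t.
  by apply: Gtpol_mono; exact: Gtpol_t.
- by case: r IH => [//|r] /= IH; exact: Gtpol_mono.
Qed.

Lemma gtpol_Y r y i : gtpol r y -> gtpol r (gY i y).
Proof.
elim=> {r y} [b|r|r y z _ IH _ IH'|r b y Hy IH|r l y Hy IH|r y _ IH].
- by rewrite gY_pb; exact: Gtpol_pb.
- by rewrite (morphD0 (@gYD _ _ G i)); exact: Gtpol_0.
- by rewrite gYD; exact: Gtpol_add.
- by rewrite gYM gY_pb; apply: Gtpol_add; exact: Gtpol_pbM.
- by rewrite gYM gY_t mul0r add0r; exact: Gtpol_t.
- exact: Gtpol_mono.
Qed.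

Lemma gtpol_span r y x : gtpol r y -> gspan x -> gspan (gfo y *: x).
Proof.
move=> Hy; elim: Hy x => {r y} [b|r|r y z _ IH _ IH'|r b y Hy IH|r l y Hy IH|r y _ IH] x Hx.
- exact: gspan_fp.
- by rewrite (morphD0 (@gfoD _ _ G)) scale0r; exact: gspan0.
- by rewrite gfoD scalerDl; apply: Gspan_add; [exact: IH|exact: IH'].
- by rewrite gfoM -scalerA; apply: gspan_fp; exact: IH.
- by rewrite gfoM -scalerA; apply: gspan_t; exact: IH.
- exact: IH.
Qed.

Variables (F : OX -> Prop) (u : M).
Hypothesis F0 : F 0.
Hypothesis Ff : forall j, F (f j).

(** A polynomial in t acts on the delta section through t_j = f_j, so each order in t contributes a
    factor in [F]. *)
Lemma gtpol_v r y k h : gtpol r y -> ideal_pow F k h ->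
  exists2 h', ideal_pow F (k + r) h' & gfo y *: gv G (mf h u) = gv G (mf h' u).
Proof.
move=> Hy Hh; elim: Hy => {r y} [b|r|r y z _ [h1 H1 E1] _ [h2 H2 E2]|r b y _ [h1 H1 E1]|
    r l y _ [h1 H1 E1]|r y _ [h1 H1 E1]].
- by exists (b * h); rewrite ?addn0 ?mfM ?gpb_v //; exact: ideal_powM.
- exists 0; first exact: ideal_pow_zero.
  rewrite (morphD0 (@gfoD _ _ G)) scale0r -(morphD0 (@gvD _ _ G)).
  by congr gv; apply: (addIr (mf 0 u)); rewrite add0r -mfD addr0.
- exists (h1 + h2); first exact: Ideal_powD.
  by rewrite gfoD scalerDl E1 E2 mfD gvD.
- exists (b * h1); first exact: ideal_powM.
  by rewrite gfoM -scalerA E1 gpb_v mfM.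
- exists (f l * h1); first by rewrite addnS; exact: Ideal_powS.
  by rewrite gfoM -scalerA E1 gt_v mfM.
- by exists h1 => //; apply: ideal_pow_mono; rewrite -addnS.
Qed.

Lemma gW_field k b x : gW F u k.+1 x -> gW F u k (gfield G' b *: x).
Proof.
move=> Hx; rewrite /gfield scaler_suml; apply: gW_sum => [//|j].
by rewrite -scalerA; apply: GW_fp; exact: GW_do.
Qed.

(** Carrying an arbitrary [y] through the induction makes it possible to commute [y] past the
    operators before applying [Phi]. The commutator with a coordinate field keeps the order of [y];
    that with a t-derivative lowers it by at most one, which the level k + 1 of [x] compensates. *)
Lemma gW_tpol k x : gW F u k x -> forall r y, gtpol r y ->
  gW F u (k + r) (Phi (gfo y *: x)).
Proof.
move=> Hx; elim: Hx => {k x} [k h Hh|k x z _ IH _ IH'|k b x _ IH|k i x Hx IH|k j x _ IH|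
    k x _ IH] r y Hy.
- by have [h' Hh' ->] := gtpol_v Hy Hh; rewrite Phi_v; exact: GW_v.
- by rewrite scalerDr PhiD; apply: GW_add; [exact: IH|exact: IH'].
- by rewrite scalerA /gfp -gfoM mulrC; apply: IH; exact: Gtpol_pbM.
- have -> : gfo y *: (gYo G i *: x) = gYo G i *: (gfo y *: x) - gfo (gY i y) *: x.
    by rewrite !scalerA gYo_fo scalerDl addrC addKr.
  rewrite PhiD PhiN; apply: GW_add; last first.
    by apply: gWN => //; apply: IH; exact: gtpol_Y.
  rewrite Phi_Y; last exact: gtpol_span Hy (gW_span Hx).
  apply: GW_add; first by apply: GW_Y; exact: IH.
  (* In the defect of [Phi_Y] the factor [gt G j] raises the order of [y] by one, and the field then
     spends one level. *)
  apply: gW_sum => [//|j]; apply: gW_field; rewrite scalerA -gfoM -addnS.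
  by apply: IH; exact: Gtpol_t.
- have -> : gfo y *: (gdo G j *: x) = gdo G j *: (gfo y *: x) - gfo (gdt j y) *: x.
    by rewrite !scalerA gdo_fo scalerDl addrC addKr.
  rewrite PhiD PhiN Phi_do; apply: GW_add.
    by apply: gW_field; rewrite -addSn; exact: IH.
  apply: gWN => //; have := IH _ _ (gtpol_dt j Hy).
  (* At order 0 differentiation does not lower the order any further, so a level is left over and
     given up by [GW_mono]. *)
  case: r {Hy} => [|r] /=; last by rewrite addSnnS.
  by rewrite !addn0; exact: GW_mono.
- by apply: GW_mono; rewrite -addSn; exact: IH.
Qed.

Lemma gW_Phi k x : gW F u k x -> gW F u k (Phi x).
Proof.
move=> Hx; have := gW_tpol Hx (Gtpol_pb 1).
by rewrite gpb1 gfo1 scale1r addn0.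
Qed.

End Transport.
End GraphModules.

(** * Polynomials in theta acting on the delta section *)

Section ThetaPolynomials.
Variables (OX : comNzRingType) (n : nat) (X : 'I_n -> OX -> OX).
Variables (M : zmodType) (mf : OX -> M -> M) (mX : 'I_n -> M -> M).
Hypothesis mfD : forall b c m, mf (b + c) m = mf b m + mf c m.
Hypothesis mfM : forall b c m, mf (b * c) m = mf b (mf c m).

Section OneModule.
Variables (d : nat) (f : 'I_d -> OX) (G : graph_module X mf mX f).

Definition geval (b : {poly OX}) : gD G := \sum_(i < size b) gfp G b`_i * gtheta G ^+ i.

Lemma gfp0 : gfp G 0 = 0. Proof. exact: morphD0 (gfpD G). Qed.

Lemma geval_bound N (b : {poly OX}) : (size b <= N)%N ->
  geval b = \sum_(i < N) gfp G b`_i * gtheta G ^+ i.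
Proof.
move=> bN; rewrite /geval (big_ord_widen N (fun i => gfp G b`_i * gtheta G ^+ i)) //.
rewrite big_mkcond; apply: eq_bigr => i _; case: ltnP => // ib.
by rewrite nth_default // gfp0 mul0r.
Qed.

Lemma gevalD : {morph geval : b c / b + c}.
Proof.
move=> b c; pose N := maxn (size b) (size c).
rewrite (@geval_bound N b) ?leq_maxl // (@geval_bound N c) ?leq_maxr //.
rewrite (@geval_bound N) ?size_polyD // -big_split; apply: eq_bigr => i _.
by rewrite coefD gfpD mulrDl.
Qed.

Lemma gevalC a : geval a%:P = gfp G a.
Proof.
by rewrite (@geval_bound 1) ?size_polyC_leq1 // big_ord1 coefC mulr1.
Qed.

Lemma geval_mulX (b : {poly OX}) : geval (b * 'X) = gtheta G * geval b.
Proof.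
rewrite (@geval_bound (size b).+1); last first.
  by apply: leq_trans (size_polyMleq _ _) _; rewrite size_polyX addn2.
rewrite big_ord_recl coefMX /= gfp0 mul0r add0r mulr_sumr; apply: eq_bigr => i _.
by rewrite coefMX /= exprS !mulrA gtheta_fp.
Qed.

Lemma geval_mulC a (b : {poly OX}) : geval (a%:P * b) = gfp G a * geval b.
Proof.
rewrite (@geval_bound (size b)); last by rewrite mul_polyC size_scale_leq.
by rewrite mulr_sumr; apply: eq_bigr => i _; rewrite mul_polyC coefZ gfpM mulrA.
Qed.

Definition shiftX s : {poly OX} := 'X + s%:R%:P.

Lemma geval_shift s (b : {poly OX}) a : geval ((b * 'X + a%:P) \Po shiftX s) =
  (gtheta G + s%:R) * geval (b \Po shiftX s) + gfp G a.
Proof.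
rewrite comp_polyD comp_polyM comp_polyX comp_polyC gevalD gevalC; congr (_ + _).
rewrite mulrDr gevalD geval_mulX [_ * _%:P]mulrC geval_mulC gfp_nat.
by rewrite mulrDl.
Qed.

Lemma gspan_geval s (b : {poly OX}) m : gspan (geval (b \Po shiftX s) *: gv G m).
Proof.
elim/poly_ind: b => [|b a IH].
  by rewrite comp_poly0 (morphD0 gevalD) scale0r; exact: gspan0.
rewrite geval_shift scalerDl; apply: Gspan_add.
  by rewrite -scalerA; exact: gspan_theta.
by apply: gspan_fp; exact: Gspan_v.
Qed.

Variables (F : OX -> Prop) (u : M).
Hypothesis F0 : F 0.
Hypothesis Ff : forall j, F (f j).

(** On the generators t_j acts as f_j, which lies in [F]. The commutator with a t-derivative leaves
    the element itself, already at level k + 1. *)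
Lemma gW_t j k x : gW F u k x -> gW F u k.+1 (gfo (gt G j) *: x).
Proof.
elim=> {k x} [k h Hh|k x z _ IH _ IH'|k b x _ IH|k i x Hx IH|k l x Hx IH|k x _ IH].
- by rewrite gt_v -mfM; apply: GW_v; exact: Ideal_powS.
- by rewrite scalerDr; exact: GW_add.
- by rewrite scalerA gt_fp -scalerA; exact: GW_fp.
- by rewrite scalerA -gYo_t -scalerA; exact: GW_Y.
- have -> : gfo (gt G j) *: (gdo G l *: x) = gdo G l *: (gfo (gt G j) *: x) - (l == j)%:R *: x.
    by rewrite !scalerA gdo_t scalerDl addrC addKr.
  apply: GW_add; first exact: GW_do.
  apply: gWN => //; case: (l == j); first by rewrite scale1r.
  by rewrite scale0r; exact: gW0.
- exact: GW_mono.
Qed.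

(** The t-derivative in each summand of theta spends a level, which is why the level is positive
    here, and the coordinate restores it. *)
Lemma gW_theta s k x : gW F u k.+1 x -> gW F u k.+1 ((gtheta G + s%:R) *: x).
Proof.
move=> Hx; rewrite scalerDl; apply: GW_add; last by rewrite -gfp_nat; exact: GW_fp.
rewrite /gtheta scaler_suml; apply: gW_sum => // j.
by rewrite -scalerA; apply: gW_t; exact: GW_do.
Qed.

(** Horner's scheme: a coefficient in [F] puts its own term at level 1, and theta keeps that
    level. *)
Lemma gW_geval s (c : {poly OX}) : (forall i, F c`_i) -> gW F u 1 (geval (c \Po shiftX s) *: gv G (mf 1 u)).
Proof.
elim/poly_ind: c => [|c a IH] Fc.
  by rewrite comp_poly0 (morphD0 gevalD) scale0r; exact: gW0.
rewrite geval_shift scalerDl; apply: GW_add.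
  rewrite -scalerA; apply/gW_theta/IH => i.
  by have := Fc i.+1; rewrite coefD coefMX coefC addr0.
rewrite /gfp gpb_v -mfM; apply: GW_v; apply: Ideal_powS; last exact: Ideal_pow0.
by have := Fc 0%N; rewrite coefD coefMX coefC add0r.
Qed.

End OneModule.

Section Transport.
Variables (d e : nat) (f : 'I_d -> OX) (g : 'I_e -> OX).
Variables (G : graph_module X mf mX f) (G' : graph_module X mf mX g).
Variables (a : 'I_e -> 'I_d -> OX) (Phi : gN G -> gN G').
Hypothesis XD : forall i, {morph X i : b c / b + c}.
Hypothesis XM : forall i b c, X i (b * c) = X i b * c + b * X i c.
Hypothesis gE : forall k, g k = \sum_j a k j * f j.
Hypothesis PhiD : {morph Phi : x y / x + y}.
Hypothesis Phi_v : forall m, Phi (gv G m) = gv G' m.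
Hypothesis Phi_do : forall j x, Phi (gdo G j *: x) = pushed G' a j *: Phi x.

Lemma Phi_geval (b : {poly OX}) m : Phi (geval G (b \Po shiftX d) *: gv G m) =
  geval G' (b \Po shiftX e) *: gv G' m.
Proof.
elim/poly_ind: b => [|b c IH].
  by rewrite !comp_poly0 !(morphD0 (gevalD _)) !scale0r (morphD0 PhiD).
rewrite !geval_shift !scalerDl PhiD; congr (_ + _).
  rewrite -!scalerA (Phi_theta mfD mfM gE PhiD Phi_v Phi_do) ?IH //.
  exact: gspan_geval.
by rewrite (Phi_fp PhiD Phi_v Phi_do) ?Phi_v //; exact: Gspan_v.
Qed.

Lemma kills_transport (F : OX -> Prop) u (b : {poly OX}) : F 0 -> (forall j, F (f j)) ->
  gW F u 1 (geval G (b \Po shiftX d) *: gv G u) ->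
  gW F u 1 (geval G' (b \Po shiftX e) *: gv G' u).
Proof.
move=> F0 Ff; rewrite -Phi_geval; exact: (gW_Phi mfD mfM XD XM gE PhiD Phi_v Phi_do).
Qed.

End Transport.
End ThetaPolynomials.

(** * Normal forms of differential operators *)

Section NormalForm.
Variables (B : comNzRingType) (N : nat) (c : 'I_N -> B) (D : 'I_N -> B -> B).
Implicit Types (g h : B) (i j : 'I_N) (w : seq 'I_N).
Hypothesis DD : forall i, {morph D i : g h / g + h}.
Hypothesis DM : forall i g h, D i (g * h) = D i g * h + g * D i h.
Hypothesis DC : forall i j g, D i (D j g) = D j (D i g).
Hypothesis Dc : forall i j, D i (c j) = (i == j)%:R.

Definition Dword w g := foldr D g w.
Definition cword w : B := \prod_(i <- w) c i.

Lemma D1 i : D i 1 = 0.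
Proof.
have := DM i 1 1; rewrite !mulr1 mul1r => E.
by apply: (addrI (D i 1)); rewrite addr0 -E.
Qed.

Lemma D_nat i (m : nat) g : D i (m%:R * g) = m%:R * D i g.
Proof.
rewrite DM (_ : D i m%:R = 0) ?mul0r ?add0r //.
elim: m => [|m IH]; first exact: morphD0 (DD i).
by rewrite -natr1 DD IH D1 addr0.
Qed.

Lemma Dword_nat w (m : nat) g : Dword w (m%:R * g) = m%:R * Dword w g.
Proof. by elim: w => //= i w ->; rewrite D_nat. Qed.

Lemma Dword_D w i g : Dword w (D i g) = D i (Dword w g).
Proof. by elim: w => //= j w ->; exact: DC. Qed.

Lemma Dword_perm w w' g : perm_eq w w' -> Dword w g = Dword w' g.
Proof.
elim: w w' => [|i w IH] w' ww'.
  by move: ww'; rewrite perm_sym => /perm_nilP ->.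
have iw' : i \in w' by rewrite -(perm_mem ww') mem_head.
have /= -> := IH (rem i w') _; last first.
  by rewrite -(perm_cons i); apply: perm_trans ww' _; exact: perm_to_rem.
elim: w' iw' {ww' IH} => //= j w' IH; rewrite inE eq_sym.
by case: eqVneq => [-> //|ij] /= iw'; rewrite DC IH.
Qed.

Lemma D_cword i w : D i (cword w) = (count_mem i w)%:R * cword (rem i w).
Proof.
rewrite /cword; elim: w => [|j w IH]; first by rewrite big_nil D1 mul0r.
rewrite big_cons DM Dc IH /=; have [->|ij] := eqVneq i j.
  rewrite mul1r -[(true + _)%N]/(_.+1) -natr1 addrC mulrDl mul1r; congr (_ + _).
  have [jw|jw] := boolP (j \in w); last by rewrite (count_memPn jw) !mul0r mulr0.
  rewrite mulrCA; congr (_ * _).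
  by rewrite [RHS](perm_big _ (perm_to_rem jw)) big_cons.
by rewrite mul0r !add0r big_cons mulrCA.
Qed.

(** The duality between derivatives and monomials, words standing for multi-indices. Each letter of
    [w] removes one occurrence from [w'] with its multiplicity as a factor, or gives 0 if there is
    none. *)
Lemma Dword_cword w w' : (size w' <= size w)%N ->
  if perm_eq w w' then exists m : nat, Dword w (cword w') = m.+1%:R
  else Dword w (cword w') = 0.
Proof.
elim: w w' => [|i w IH] w'.
  by rewrite leqn0 size_eq0 => /eqP ->; rewrite perm_refl; exists 0%N; rewrite /= /cword big_nil.
move=> sw; rewrite -[Dword (i :: w) _]Dword_D D_cword Dword_nat.
have [iw'|iw'] := boolP (i \in w'); last first.
  rewrite (count_memPn iw') mul0r; case: ifP => // /perm_mem /(_ i).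
  by rewrite mem_head (negbTE iw').
have E : perm_eq (i :: w) w' = perm_eq w (rem i w').
  by rewrite -(perm_cons i w (rem i w')); exact: (permPr (perm_to_rem iw')).
have := IH (rem i w'); rewrite size_rem // E.
have -> : ((size w').-1 <= size w)%N by rewrite -subn1 leq_subLR add1n.
move=> /(_ isT); case: ifP => [_ [m ->]|_ ->]; last by rewrite mulr0.
rewrite -natrM; have : (0 < count_mem i w' * m.+1)%N.
  by rewrite muln_gt0 /= andbT -has_count has_pred1.
by case: (_ * _)%N => // k _; exists k.
Qed.

Section NormalOperators.

Definition normal_op (P : B -> B) :=
  exists s : seq (B * seq 'I_N), forall g, P g = \sum_(x <- s) x.1 * Dword x.2 g.

Lemma normal_op_id : normal_op (fun g => g).
Proof. by exists [:: (1, [::])] => g; rewrite big_seq1 mul1r. Qed.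

Lemma normal_opD P Q : normal_op P -> normal_op Q -> normal_op (fun g => P g + Q g).
Proof. by move=> [s Hs] [s' Hs']; exists (s ++ s') => g; rewrite big_cat Hs Hs'. Qed.

Lemma normal_opM a P : normal_op P -> normal_op (fun g => a * P g).
Proof.
move=> [s Hs]; exists [seq (a * x.1, x.2) | x <- s] => g.
by rewrite big_map Hs mulr_sumr; apply: eq_bigr => x _; rewrite mulrA.
Qed.

Lemma normal_op_der i P : normal_op P -> normal_op (fun g => D i (P g)).
Proof.
move=> [s Hs]; exists ([seq (D i x.1, x.2) | x <- s] ++ [seq (x.1, i :: x.2) | x <- s]) => g.
rewrite big_cat !big_map /= Hs (big_morph _ (DD i) (morphD0 (DD i))) -big_split.
by apply: eq_bigr => x _; rewrite DM.
Qed.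

Lemma normal_op_sum (I : Type) (s : seq I) (P : I -> B -> B) : (forall k : I, normal_op (P k)) ->
  normal_op (fun g => \sum_(k <- s) P k g).
Proof.
move=> HP; elim: s => [|k s [s' Hs']]; first by exists [::] => g; rewrite !big_nil.
have [s'' Hs''] := HP k; exists (s'' ++ s') => g.
by rewrite big_cons big_cat Hs' Hs''.
Qed.

Definition canon w := sort (fun i j : 'I_N => i <= j)%N w.

Lemma canon_perm w w' : perm_eq w w' -> canon w = canon w'.
Proof.
apply/perm_sortP => [i j|i j k|i j].
- exact: leq_total.
- exact: leq_trans.
- by move=> /anti_leq/val_inj.
Qed.

(** The derivations commute, so a sorted word represents a multi-index; terms with the same sorted
    word are merged. *)
Lemma normal_op_canon P : normal_op P -> exists (r : seq (seq 'I_N)) (A : seq 'I_N -> B),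
  [/\ uniq r, forall w, w \in r -> canon w = w &
      forall g, P g = \sum_(w <- r) A w * Dword w g].
Proof.
move=> [s]; elim: s P => [|[a w] s IH] P Hs.
  by exists [::], (fun=> 0); split => // g; rewrite Hs !big_nil.
have [r [A [ur rc E]]] := IH (fun g => \sum_(x <- s) x.1 * Dword x.2 g) (fun=> erefl).
pose w' := canon w.
have ww' g : Dword w g = Dword w' g by apply: Dword_perm; rewrite perm_sym perm_sort.
have w'c : canon w' = w' by apply: canon_perm; rewrite perm_sort.
have HP g : P g = a * Dword w' g + \sum_(v <- r) A v * Dword v g.
  by rewrite Hs big_cons /= ww' E.
have [wr|wr] := boolP (w' \in r).
  exists r, (fun v => if v == w' then a + A v else A v); split => // g.
  rewrite HP !(bigD1_seq w') //= eqxx mulrDl addrA; congr (_ + _).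
  by apply: eq_bigr => v /negbTE ->.
exists (w' :: r), (fun v => if v == w' then a else A v); split => [|v|g].
- by rewrite /= wr.
- by rewrite inE => /orP[/eqP ->|/rc].
rewrite HP big_cons eqxx; congr (_ + _); rewrite big_seq [RHS]big_seq.
by apply: eq_bigr => v vr; case: eqP => // vw; rewrite vw (negbTE wr) in vr.
Qed.

End NormalOperators.

Section Filtration.
Variables (tau : 'I_N -> nat) (J : nat -> B -> Prop).
Hypothesis J0 : forall g, J 0 g.
Hypothesis JD : forall k g h, J k g -> J k h -> J k (g + h).
Hypothesis Jz : forall k, J k 0.
Hypothesis JM : forall k l g h, J k g -> J l h -> J (k + l) (g * h).
Hypothesis Jmono : forall k g, J k.+1 g -> J k g.
Hypothesis Jc : forall i, J (tau i) (c i).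
Hypothesis JDer : forall k i g, J k g -> J (k - tau i) (D i g).
Hypothesis natU : forall m : nat, exists h, h * m.+1%:R = 1.

(** In the application [tau] is 1 on the fibre directions and 0 on the others, so this counts the
    t-derivatives in a word. *)
Definition weight w : nat := \sum_(i <- w) tau i.

Lemma J_le k l g : (l <= k)%N -> J k g -> J l g.
Proof.
move=> /subnK <-; elim: (k - l)%N => [//|m IH].
by rewrite addSn => /Jmono.
Qed.

Lemma J_opp k g : J k g -> J k (- g).
Proof. by move=> Jg; rewrite -mulN1r -[k]add0n; exact: JM. Qed.

Lemma J_sum k (I : Type) (s : seq I) (P : pred I) (h : I -> B) :
  (forall x, P x -> J k (h x)) -> J k (\sum_(x <- s | P x) h x).
Proof. by move=> H; elim/big_ind: _ => // *; exact: JD. Qed.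

Lemma J_cword w : J (weight w) (cword w).
Proof.
rewrite /weight /cword; elim: w => [|i w IH]; first by rewrite !big_nil.
by rewrite !big_cons; exact: JM.
Qed.

Lemma J_Dword k w g : J k g -> J (k - weight w) (Dword w g).
Proof.
move=> Jg; rewrite /weight; elim: w => [|i w IH] /=; first by rewrite big_nil subn0.
by rewrite big_cons addnC subnDA; exact: JDer.
Qed.

(* Evaluate P on the monomials dual to the D^w, by increasing length. *)
Lemma normal_op_coef (r : seq (seq 'I_N)) (A : seq 'I_N -> B) :
  uniq r -> (forall w, w \in r -> canon w = w) ->
  (forall k g, J k g -> J k.+1 (\sum_(w <- r) A w * Dword w g)) ->
  forall w, w \in r -> J (weight w).+1 (A w).
Proof.
move=> ur rc HP w; have [m] := ubnP (size w); elim: m w => // m IH w sw wr.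
have := HP _ _ (J_cword w); rewrite (bigD1_seq w) //=.
have := Dword_cword (leqnn (size w)); rewrite perm_refl => -[l ->] H.
have Hrest : J (weight w).+1 (\sum_(v <- r | v != w) A v * Dword v (cword w)).
  rewrite big_seq_cond; apply: J_sum => v /andP[vr vw].
  (* Words at least as long as [w] and different from it kill the monomial. For shorter ones the
     induction gives order [weight v] + 1 for the coefficient, while the derivative of the monomial
     still has order at least [weight w - weight v]. *)
  have [sv|sv] := leqP (size w) (size v).
    have := Dword_cword sv; case: ifP => [/canon_perm|_ ->]; last by rewrite mulr0.
    by rewrite (rc v vr) (rc w wr) => /eqP; rewrite (negbTE vw).
  have Jv : J (weight v).+1 (A v) by apply: IH => //; exact: leq_trans sv _.
  apply: J_le (JM Jv (J_Dword v (J_cword w))).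
  by rewrite addSn ltnS -leq_subLR.
(* Duality isolates [A w] only up to a positive integer factor, which is invertible. *)
have [h hE] := natU l.
have -> : A w = h * (A w * l.+1%:R + \sum_(v <- r | v != w) A v * Dword v (cword w) -
    \sum_(v <- r | v != w) A v * Dword v (cword w)).
  by rewrite addrK mulrCA hE mulr1.
rewrite -[_.+1]add0n; apply: JM => //.
by apply: JD => //; exact: J_opp.
Qed.

End Filtration.
End NormalForm.

(** * Residues along a graph *)

Section Pushforward.
Variables (B : comNzRingType) (d : nat) (l : 'I_d -> B) (dB : 'I_d -> B -> B).
Variables (inv : nat -> B) (Z : zmodType) (T : 'I_d -> Z -> Z).
Implicit Types (c : B) (i j : 'I_d) (K : nat) (Gam : B -> Z) (s : seq 'I_d).

Hypothesis dBD : forall j, {morph dB j : a b / a + b}.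
Hypothesis dBM : forall j a b, dB j (a * b) = dB j a * b + a * dB j b.
Hypothesis dBC : forall i j c, dB i (dB j c) = dB j (dB i c).
Hypothesis dBl : forall i j, dB i (l j) = (i == j)%:R.
Hypothesis invE : forall K, inv K * K.+1%:R = 1.
Hypothesis TD : forall j, {morph T j : x y / x + y}.
Hypothesis TC : forall i j x, T i (T j x) = T j (T i x).

(** The inverse of the factorial of [K]. *)
Fixpoint ifact K : B := if K is K'.+1 then ifact K' * inv K' else 1.

Lemma ifactE K : ifact K.+1 * K.+1%:R = ifact K.
Proof. by rewrite /= -mulrA invE mulr1. Qed.

Lemma dB_nat j K : dB j K%:R = 0.
Proof.
have d1 : dB j 1 = 0.
  by apply: (addrI (dB j 1)); rewrite addr0 -{3}[1 : B]mulr1 dBM mulr1 mul1r.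
elim: K => [|K IH]; first exact: morphD0 (dBD j).
by rewrite -natr1 dBD IH d1 addr0.
Qed.

Lemma dB_inv j K : dB j (inv K) = 0.
Proof.
have := dBM j (inv K) K.+1%:R; rewrite invE (dB_nat j 1) dB_nat mulr0 addr0 => E.
by rewrite -[LHS]mulr1 -(invE K) mulrCA -E mulr0.
Qed.

Lemma dB_ifact j K c : dB j (ifact K * c) = ifact K * dB j c.
Proof.
rewrite dBM (_ : dB j (ifact K) = 0) ?mul0r ?add0r //.
elim: K => [|K IH] /=; first exact: (dB_nat j 1).
by rewrite dBM IH dB_inv mul0r mulr0 addr0.
Qed.

Lemma T0 j : T j 0 = 0. Proof. exact: morphD0 (TD j). Qed.

Lemma TN j x : T j (- x) = - T j x.
Proof. by apply: (addIr (T j x)); rewrite -TD !addNr T0. Qed.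

Lemma T_muln j x K : T j (x *+ K) = T j x *+ K.
Proof. by elim: K => [|K IH]; rewrite ?mulr0n ?T0 // !mulrSr TD IH. Qed.

(** The derivative of [c * exp (- T_j l_j)] in direction [j], evaluated by [Gam], with the operator
    T_j acting on the target. *)
Definition twist j Gam : B -> Z := fun c => Gam (dB j c) - T j (Gam c).

(* With Gam the evaluation on l = 0, this computes the coefficient of l_j^(K-1) in
   c * exp (- T_j l_j), the residue of c / l_j^K against the pushed delta function. *)
Definition residue j K Gam : B -> Z := fun c =>
  if K is K'.+1 then iter K' (twist j) Gam (ifact K' * c) else 0.

Section Iterate.
Variables (j : 'I_d).

Lemma twistD Gam : {morph Gam : a b / a + b} -> {morph twist j Gam : a b / a + b}.
Proof. by move=> GD a b; rewrite /twist dBD !GD TD opprD addrACA. Qed.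

Lemma iter_twistD K Gam : {morph Gam : a b / a + b} ->
  {morph iter K (twist j) Gam : a b / a + b}.
Proof. by move=> GD; elim: K => //= K; exact: twistD. Qed.

Lemma iter_twist_muln K Gam a m : {morph Gam : a b / a + b} ->
  iter K (twist j) Gam (a *+ m) = iter K (twist j) Gam a *+ m.
Proof.
move=> GD; elim: m => [|m IHm]; first by rewrite !mulr0n (morphD0 (iter_twistD K GD)).
by rewrite !mulrSr (iter_twistD K GD) IHm.
Qed.

Lemma residueD K Gam : {morph Gam : a b / a + b} -> {morph residue j K Gam : a b / a + b}.
Proof.
case: K => [|K] GD a b /=; first by rewrite addr0.
by rewrite mulrDr iter_twistD.
Qed.

Lemma iter_twist_precomp K Gam Gam' (phi : B -> B) :
  (forall c, Gam (phi c) = Gam' c) -> (forall c, dB j (phi c) = phi (dB j c)) ->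
  forall c, iter K (twist j) Gam (phi c) = iter K (twist j) Gam' c.
Proof. by move=> H dphi; elim: K => //= K IH c; rewrite /twist dphi !IH. Qed.

(** Used for multiplications by elements that the derivation in direction [j] does not see: the
    other equations and the functions of the base. *)
Lemma residue_precomp K Gam Gam' (phi : B -> B) :
  (forall c, Gam (phi c) = Gam' c) -> (forall c, dB j (phi c) = phi (dB j c)) ->
  (forall K c, ifact K * phi c = phi (ifact K * c)) ->
  forall c, residue j K Gam (phi c) = residue j K Gam' c.
Proof.
by case: K => // K H dphi fphi c /=; rewrite fphi (iter_twist_precomp K H dphi).
Qed.

(** Leibniz's rule for the (K+1)-st derivative of [l j * c]: the terms still containing [l j] are
    killed by [Gam]. *)
Lemma iter_twist_l K Gam c : (forall c, Gam (l j * c) = 0) -> {morph Gam : a b / a + b} ->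
  iter K.+1 (twist j) Gam (l j * c) = iter K (twist j) Gam c *+ K.+1.
Proof.
move=> G0 GD; have dl a : dB j (l j * a) = a + l j * dB j a by rewrite dBM dBl eqxx mul1r.
elim: K c => [|K IH] c.
  by rewrite /= /twist dl GD !G0 T0 addr0 subr0.
rewrite iterS {1}/twist dl (iter_twistD _ GD) !IH.
rewrite [in RHS]mulrS -addrA; congr (_ + _).
by rewrite T_muln -mulrnBl.
Qed.

Lemma residue_l K Gam c : (forall c, Gam (l j * c) = 0) -> {morph Gam : a b / a + b} ->
  residue j K.+1 Gam (l j * c) = residue j K Gam c.
Proof.
move=> G0 GD; case: K => [|K]; first by rewrite /= mul1r G0.
rewrite -[LHS]/(iter K.+1 (twist j) Gam (ifact K.+1 * (l j * c))).
by rewrite mulrCA iter_twist_l // -iter_twist_muln // -mulr_natr mulrAC ifactE.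
Qed.

Lemma residue_l_exp K Gam c : (forall c, Gam (l j * c) = 0) -> {morph Gam : a b / a + b} ->
  residue j K Gam (l j ^+ K * c) = 0.
Proof. by move=> G0 GD; elim: K => // K IH; rewrite exprS -mulrA residue_l. Qed.

(** The left side is the residue of the derivative of [c / l_j^K]. Thus differentiation in direction
    [j] before taking residues becomes [T j] afterwards. *)
Lemma residue_dB K Gam c : {morph Gam : a b / a + b} ->
  residue j K Gam (dB j c) - residue j K.+1 Gam c *+ K = T j (residue j K Gam c).
Proof.
move=> GD; case: K => [|K]; first by rewrite /= mulr0n subr0 T0.
rewrite -[residue j K.+2 Gam c]/(iter K.+1 (twist j) Gam (ifact K.+1 * c)).
rewrite -iter_twist_muln // -mulr_natr mulrAC ifactE iterS {1}/twist dB_ifact.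
exact: subKr.
Qed.

Lemma residue0 K (Gam : B -> Z) c : (forall c, Gam c = 0) -> residue j K Gam c = 0.
Proof.
case: K => // K G0 /=; elim: K (_ * c) => [|K IH] a //=.
by rewrite /twist !IH T0 subr0.
Qed.

(** A first-order relation in direction [i] passes through the residue in direction [j], as both the
    derivations and the operators on the target commute. *)
Lemma residue_T i K Gam Gam' Gam'' (m : nat) c :
  (forall c, Gam (dB i c) - Gam' c *+ m = Gam'' c) ->
  residue j K Gam (dB i c) - residue j K Gam' c *+ m = residue j K Gam'' c.
Proof.
case: K => [|K] H /=; first by rewrite mul0rn subr0.
rewrite -dB_ifact; elim: K (_ * c) => [|K IH] a //=.
rewrite /twist dBC -!IH TD TN T_muln mulrnBl opprD opprK.
by rewrite addrACA opprB; congr (_ + _); rewrite addrC.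
Qed.

Lemma residue_Tcomp i K Gam c :
  residue j K (fun a => T i (Gam a)) c = T i (residue j K Gam c).
Proof.
case: K => [|K] /=; first by rewrite T0.
elim: K (_ * c) => [|K IH] a //=.
by rewrite /twist !IH TD TN TC.
Qed.

Lemma residue_add K Gam Gam' Gam'' c : (forall c, Gam'' c = Gam c + Gam' c) ->
  residue j K Gam'' c = residue j K Gam c + residue j K Gam' c.
Proof.
case: K => [|K] H /=; first by rewrite addr0.
elim: K (_ * c) => [|K IH] a //=.
by rewrite /twist !IH TD opprD addrACA.
Qed.

End Iterate.

Arguments residue : simpl never.

(** The iterated residue of [c] over the [K]-th power of the product of the [l j]. One exponent
    serves all directions because the localisation inverts the product. *)
Definition residues s K Gam : B -> Z := foldr (fun j => residue j K) Gam s.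

Definition lprod s : B := \prod_(j <- s) l j.

Lemma dB_lprod j s c : j \notin s -> dB j (lprod s * c) = lprod s * dB j c.
Proof.
rewrite /lprod; elim: s c => [|i s IH] c; first by rewrite big_nil !mul1r.
rewrite inE negb_or => /andP[ji js]; rewrite big_cons -!mulrA dBM dBl (negbTE ji).
by rewrite mul0r add0r IH.
Qed.

Lemma dB_lprod_mem j s : uniq s -> j \in s -> dB j (lprod s) = lprod (rem j s).
Proof.
move=> us js; rewrite /lprod (perm_big _ (perm_to_rem js)) big_cons dBM dBl eqxx mul1r.
have := @dB_lprod j (rem j s) 1; rewrite mem_rem_uniqF // => /(_ isT).
by rewrite !mulr1 /lprod (dB_nat j 1) mulr0 => ->; rewrite mulr0 addr0.
Qed.

Section Base.
Variable Gam : B -> Z.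
Hypothesis GD : {morph Gam : a b / a + b}.
Hypothesis Gl : forall j c, Gam (l j * c) = 0.

Lemma residuesD s K : {morph residues s K Gam : a b / a + b}.
Proof. by elim: s => //= j s IH; exact: residueD. Qed.

Lemma residuesN s K c : residues s K Gam (- c) = - residues s K Gam c.
Proof.
apply: (addIr (residues s K Gam c)).
by rewrite -residuesD !addNr (morphD0 (residuesD s K)).
Qed.

Lemma residues_l s K i c : i \notin s -> residues s K Gam (l i * c) = 0.
Proof.
elim: s c => [|j s IH] c /=; first by rewrite Gl.
rewrite inE negb_or => /andP[ij ins].
rewrite (@residue_precomp j K _ (fun=> 0) (fun c => l i * c)) => [|a|a|K' a].
- exact: residue0.
- exact: IH.
- by rewrite dBM dBl eq_sym (negbTE ij) mul0r add0r.
- by rewrite mulrCA.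
Qed.

(** A common factor cancels from numerator and denominator; this is the relation [1 - h 'X] of the
    localisation. *)
Lemma residues_shift s K c : uniq s ->
  residues s K.+1 Gam (lprod s * c) = residues s K Gam c.
Proof.
elim: s c => [|j s IH] c /=; first by rewrite /lprod big_nil mul1r.
move=> /andP[js us]; rewrite {1}/lprod big_cons -mulrA residue_l.
- apply: (@residue_precomp j K _ _ (fun c => lprod s * c)) => [a|a|K' a].
  + exact: IH.
  + exact: dB_lprod.
  + by rewrite mulrCA.
- by move=> a; exact: residues_l.
- exact: residuesD.
Qed.

(** Such a fraction has no pole along [l j]: these are the elements coming from the localisation
    with [l j] left out. *)
Lemma residues_l_exp s K j c : uniq s -> j \in s -> residues s K Gam (l j ^+ K * c) = 0.
Proof.
elim: s c => // i s IH c /= /andP[ins us]; rewrite inE.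
case: eqVneq => [->|ji] /= js.
  apply: residue_l_exp; last exact: residuesD.
  by move=> a; exact: residues_l.
rewrite (@residue_precomp i K _ (fun=> 0) (fun c => l j ^+ K * c)) => [|a|a|K' a].
- exact: residue0.
- exact: IH.
- elim: (K) => [|m IHm]; first by rewrite !mul1r.
  by rewrite exprS -!mulrA dBM dBl eq_sym (negbTE ji) mul0r add0r IHm.
- by rewrite mulrCA.
Qed.

(** The quotient rule: the derivative of the denominator is the product of the factors other than
    [l j]. Directions before [j] are crossed by [residue_T]. *)
Lemma residues_dB s K j c : uniq s -> j \in s ->
  residues s K Gam (dB j c) - residues s K.+1 Gam (lprod (rem j s) * c) *+ K =
  T j (residues s K Gam c).
Proof.
elim: s c => // i s IH c /= /andP[ins us]; rewrite inE [i == j]eq_sym.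
case: eqVneq => [->|ji] /= js.
  rewrite -(residue_dB _ _ _ (residuesD s K)); congr (_ - _ *+ _).
  apply: (@residue_precomp i K.+1 _ _ (fun c => lprod s * c)) => [a|a|K' a].
  + exact: residues_shift.
  + exact: dB_lprod.
  + by rewrite mulrCA.
have -> : residue i K.+1 (residues s K.+1 Gam) (lprod (i :: rem j s) * c) =
    residue i K (fun a => residues s K.+1 Gam (lprod (rem j s) * a)) c.
  rewrite /lprod big_cons -mulrA residue_l.
  - apply: (@residue_precomp i K _ _ (fun c => lprod (rem j s) * c)) => [//|a|K' a].
      by apply: dB_lprod; apply: contra ins; exact: mem_rem.
    by rewrite mulrCA.
  - by move=> a; exact: residues_l.
  - exact: residuesD.
rewrite -residue_Tcomp; apply: residue_T => a.
exact: IH.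
Qed.

End Base.

Lemma residues_precomp s K Gam Gam' (phi : B -> B) :
  (forall c, Gam (phi c) = Gam' c) -> (forall j c, dB j (phi c) = phi (dB j c)) ->
  (forall K c, ifact K * phi c = phi (ifact K * c)) ->
  forall c, residues s K Gam (phi c) = residues s K Gam' c.
Proof.
by move=> H dphi fphi; elim: s => //= j s IH c; apply: residue_precomp.
Qed.

Lemma residues_add s K Gam Gam' Gam'' : (forall c, Gam'' c = Gam c + Gam' c) ->
  forall c, residues s K Gam'' c = residues s K Gam c + residues s K Gam' c.
Proof. by move=> H; elim: s => //= j s IH c; exact: residue_add. Qed.

Local Notation all_j := (index_enum 'I_d).

Definition poly_residue Gam (q : {poly B}) : Z := \sum_(K < size q) residues all_j K Gam q`_K.

Section PolyResidue.
Variable Gam : B -> Z.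
Hypothesis GD : {morph Gam : a b / a + b}.
Hypothesis Gl : forall j c, Gam (l j * c) = 0.

Lemma poly_residue_bound m (q : {poly B}) : (size q <= m)%N ->
  poly_residue Gam q = \sum_(K < m) residues all_j K Gam q`_K.
Proof.
move=> qm; rewrite /poly_residue (big_ord_widen m (fun K => residues all_j K Gam q`_K)) //.
rewrite big_mkcond; apply: eq_bigr => K _; case: ltnP => // qK.
by rewrite nth_default // (morphD0 (residuesD GD _ _)).
Qed.

Lemma poly_residueD : {morph poly_residue Gam : p q / p + q}.
Proof.
move=> p q; pose m := maxn (size p) (size q).
rewrite (@poly_residue_bound m p) ?leq_maxl // (@poly_residue_bound m q) ?leq_maxr //.
rewrite (@poly_residue_bound m) ?size_polyD // -big_split; apply: eq_bigr => K _.
by rewrite coefD residuesD.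
Qed.

Lemma poly_residue_monomial c K : poly_residue Gam (c *: 'X^K) = residues all_j K Gam c.
Proof.
rewrite (@poly_residue_bound K.+1); last first.
  by apply: leq_trans (size_scale_leq _ _) _; rewrite size_polyXn.
rewrite big_ord_recr /= big1 ?add0r => [|k _]; last first.
  by rewrite coefZ coefXn ltn_eqF // mulr0 (morphD0 (residuesD GD _ _)).
by rewrite coefZ coefXn eqxx mulr1.
Qed.

Lemma poly_residue_sum (I : Type) (r : seq I) (q : I -> {poly B}) :
  poly_residue Gam (\sum_(i <- r) q i) = \sum_(i <- r) poly_residue Gam (q i).
Proof. exact: (big_morph _ poly_residueD (morphD0 poly_residueD)). Qed.

Lemma loc_denE : loc_den l = lprod all_j. Proof. by []. Qed.

(** The two kinds of relations defining local cohomology vanish by [residues_shift] and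
    [residues_l_exp] respectively. *)
Lemma poly_residue_null q : loc_null l q -> poly_residue Gam q = 0.
Proof.
move=> /asboolP[r [c ->]]; rewrite poly_residueD poly_residue_sum.
rewrite [X in _ + X]big1 ?addr0 => [|j _].
  rewrite -[r]coefK poly_def mulr_suml poly_residue_sum big1 // => K _.
  have -> : r`_K *: 'X^K * (1 - loc_den l *: 'X) = r`_K *: 'X^K + (- (lprod all_j * r`_K)) *: 'X^(K.+1).
    by rewrite mulrBr mulr1 scaleNr loc_denE -scalerAr -scalerAl scalerA -exprSr.
  rewrite poly_residueD !poly_residue_monomial.
  rewrite residuesN // residues_shift ?subrr //.
  exact: index_enum_uniq.
rewrite comp_polyE poly_residue_sum big1 // => K _.
rewrite exprZn scalerA poly_residue_monomial mulrC.
by rewrite residues_l_exp // ?index_enum_uniq // mem_index_enum.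
Qed.

Lemma poly_residue_frac_der j q :
  poly_residue Gam (frac_der (dB j) (loc_den l) q) = T j (poly_residue Gam q).
Proof.
have T_sum m (h : 'I_m -> Z) : T j (\sum_i h i) = \sum_i T j (h i).
  exact: (big_morph _ (TD j) (T0 j)).
have dB0 := morphD0 (dBD j).
rewrite (@poly_residue_bound (size q).+1); last first.
  apply/leq_sizeP => K qK; rewrite coefB coefZ coefXnM coef_map_id0 // coef_deriv.
  rewrite nth_default ?(leq_trans _ qK) // dB0 sub0r.
  case: ltnP => [_|K2]; first by rewrite mulr0 oppr0.
  rewrite nth_default ?mul0rn ?mulr0 ?oppr0 //.
  by rewrite -ltnS (leq_trans qK) // subn2; case: K K2 {qK} => [|[|K]].
(* Multiplying the derivative of [q] by ['X^2] moves index K - 1 to K with the factor K - 1, and the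
   derivative of the full product is the product of the remaining factors. *)
have coefE K : (frac_der (dB j) (loc_den l) q)`_K =
    dB j q`_K - (if K is K'.+1 then (lprod (rem j all_j) * q`_K') *+ K' else 0).
  rewrite coefB coefZ coefXnM coef_map_id0 // coef_deriv; congr (_ - _).
  rewrite loc_denE dB_lprod_mem ?index_enum_uniq ?mem_index_enum //.
  by case: K => [|[|K]]; rewrite /= ?mulr0 ?mulr0n // subn2 /= mulrnAr.
have resB K a b : residues all_j K Gam (a - b) = residues all_j K Gam a - residues all_j K Gam b.
  by apply: (addIr (residues all_j K Gam b)); rewrite -residuesD // !subrK.
have res_n K a m : residues all_j K Gam (a *+ m) = residues all_j K Gam a *+ m.
  elim: m => [|m IHm]; first by rewrite !mulr0n (morphD0 (residuesD GD _ _)).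
  by rewrite !mulrSr residuesD // IHm.
under eq_bigr do rewrite coefE resB.
rewrite sumrB big_ord_recr /= nth_default // dB0 (morphD0 (residuesD GD _ _)) addr0.
rewrite big_ord_recl /= (morphD0 (residuesD GD _ _)) add0r -sumrB T_sum.
apply: eq_bigr => K _; rewrite res_n residues_dB ?index_enum_uniq ?mem_index_enum //.
Qed.

End PolyResidue.

Section OnCohomology.
Variables (OX : comNzRingType) (pb : OX -> B) (M : zmodType) (mf : OX -> M -> M).
Variable Gam : M -> B -> Z.
Hypothesis GD : forall m, {morph Gam m : a b / a + b}.
Hypothesis Gl : forall m j c, Gam m (l j * c) = 0.
Hypothesis GmD : forall m m' c, Gam (m + m') c = Gam m c + Gam m' c.
Hypothesis Gpb : forall a m c, Gam (mf a m) c = Gam m (pb a * c).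
Hypothesis dB_pb : forall j a, dB j (pb a) = 0.

Lemma cohomology_residue : exists phi : M -> loc_cohom l -> Z,
  [/\ forall m m' b, phi (m + m') b = phi m b + phi m' b,
      forall m b b', phi m (b + b') = phi m b + phi m b',
      forall a m (c : {poly B}), phi (mf a m) (loc_class l c) = phi m (loc_class l (pb a *: c)),
      forall m, phi m (loc_class l 'X) = Gam m 1 &
      forall j m (c : {poly B}), phi m (loc_class l (frac_der (dB j) (loc_den l) c)) =
        T j (phi m (loc_class l c))].
Proof.
pose phi m (b : loc_cohom l) := poly_residue (Gam m) (repr b).
have phiE m (q : {poly B}) : phi m (loc_class l q) = poly_residue (Gam m) q.
  have E : \pi_(loc_cohom l)%qT (repr (loc_class l q)) = \pi_(loc_cohom l)%qT q by rewrite reprK.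
  have Hn : loc_null l (repr (loc_class l q) - q).
    by move: E => /eqP; rewrite -Quotient.idealrBE.
  have PD := poly_residueD (GD m); have := poly_residue_null (GD m) (Gl m) Hn.
  move=> H0; rewrite /phi -[X in poly_residue _ X](subrK q) PD H0 add0r //.
exists phi; split.
- move=> m m' b; rewrite /phi /poly_residue -big_split; apply: eq_bigr => K _.
  exact: residues_add (GmD m m') _.
- move=> m b b'; rewrite -[b]reprK -[b']reprK.
  have -> : \pi_(loc_cohom l)%qT (repr b) + \pi_(loc_cohom l)%qT (repr b') =
      loc_class l (repr b + repr b') by rewrite /loc_class raddfD.
  by rewrite !phiE (poly_residueD (GD m)).
- move=> a m q; rewrite !phiE (@poly_residue_bound _ (GD m) (size q)) ?size_scale_leq //.
  rewrite /poly_residue; apply: eq_bigr => K _; rewrite coefZ; apply: esym.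
  apply: (@residues_precomp _ _ _ _ (fun c => pb a * c)) => [a'|j a'|K' a'].
  + by rewrite Gpb.
  + by rewrite dBM dB_pb mul0r add0r.
  + by rewrite mulrCA.
- move=> m; rewrite phiE -['X]expr1 -[X in poly_residue _ X]scale1r poly_residue_monomial //.
  elim: (index_enum _) => //= j s IH; rewrite -[RHS]IH.
  by rewrite /residue /= mul1r.
- by move=> j m q; rewrite !phiE poly_residue_frac_der.
Qed.

End OnCohomology.
End Pushforward.

(** * The operators of V^-1 and the inductive description of V^-1 u *)

Section VFiltration.
Variables (OX : comNzRingType) (n : nat) (X : 'I_n -> OX -> OX).
Variables (M : zmodType) (mf : OX -> M -> M) (mX : 'I_n -> M -> M).
Variables (d : nat) (f : 'I_d -> OX) (G : graph_module X mf mX f).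
Variables (F : OX -> Prop) (u : M).
Variables (act : gD G -> gO G -> gO G) (J : nat -> gO G -> Prop).
Variables (c : 'I_(n + d) -> gO G) (D : 'I_(n + d) -> gO G -> gO G).

Hypothesis mfM : forall b c m, mf (b * c) m = mf b (mf c m).
Hypothesis F0 : F 0.
Hypothesis F_f : forall a, F a <-> exists b : 'I_d -> OX, a = \sum_j b j * f j.
Hypothesis act_inj : forall P Q, (forall g, act P g = act Q g) -> P = Q.
Hypothesis actD : forall P Q g, act (P + Q) g = act P g + act Q g.
Hypothesis actM : forall P Q g, act (P * Q) g = act P (act Q g).
Hypothesis act_fo : forall a g, act (gfo a) g = a * g.
Hypothesis act_do : forall j g, act (gdo G j) g = gdt j g.
Hypothesis act_Yo : forall k g, act (gYo G k) g = gY k g.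
Hypothesis J0 : forall g, J 0 g.
Hypothesis JD : forall k g h, J k g -> J k h -> J k (g + h).
Hypothesis Jz : forall k, J k 0.
Hypothesis JM : forall k l g h, J k g -> J l h -> J (k + l) (g * h).
Hypothesis Jmono : forall k g, J k.+1 g -> J k g.
Hypothesis Jt : forall j, J 1 (gt G j).
Hypothesis J_gen : forall k g, J k.+1 g ->
  exists b : 'I_d -> gO G, (forall j, J k (b j)) /\ g = \sum_j gt G j * b j.
Hypothesis JY : forall k i g, J k g -> J k (gY i g).
Hypothesis Jdt : forall k j g, J k.+1 g -> J k (gdt j g).
Hypothesis graph_gen : forall g : gO G, exists (a : OX) (b : 'I_d -> gO G),
  g = gpb G a + \sum_j (gt G j - gpb G (f j)) * b j.
Hypothesis Dl : forall k g, D (lshift d k) g = gY k g.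
Hypothesis Dr : forall j g, D (rshift n j) g = gdt j g.
Hypothesis DD : forall i, {morph D i : g h / g + h}.
Hypothesis DM : forall i g h, D i (g * h) = D i g * h + g * D i h.
Hypothesis DC : forall i j g, D i (D j g) = D j (D i g).
Hypothesis Dc : forall i j, D i (c j) = (i == j)%:R.
Hypothesis cr : forall j, c (rshift n j) = gt G j.
Hypothesis natU : forall m : nat, exists h : gO G, h * m.+1%:R = 1.
Hypothesis act_normal : forall P, normal_op D (act P).

(* P belongs to V^(-k). *)
Definition lowers k (P : gD G) := forall i g, J i g -> J (i + k) (act P g).

Lemma fo0 : gfo (0 : gO G) = 0. Proof. exact: morphD0 (@gfoD _ _ _ _ _ _ _ _ G). Qed.

Lemma fo_sum (I : Type) (s : seq I) (h : I -> gO G) :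
  gfo (\sum_(i <- s) h i) = \sum_(i <- s) gfo (h i).
Proof. exact: (big_morph _ (@gfoD _ _ _ _ _ _ _ _ G) fo0). Qed.

(** The equations of the graph annihilate the delta section, so a function acts through its
    restriction to the graph. *)
Lemma fo_graph g : exists a, forall m, gfo g *: gv G m = gv G (mf a m).
Proof.
have [a [b ->]] := graph_gen g; exists a => m.
rewrite gfoD scalerDl gpb_v fo_sum scaler_suml big1 ?addr0 // => j _.
rewrite mulrC gfoM -scalerA gfoD scalerDl gt_v.
have -> : gfo (- gpb G (f j)) = - gfo (gpb G (f j)).
  by apply: (addIr (gfo (gpb G (f j)))); rewrite -gfoD !addNr fo0.
by rewrite scaleNr gpb_v subrr scaler0.
Qed.

(** On the graph t_j equals f_j, so the k-th power of the ideal of the zero section restricts into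
    the k-th power of [F]. *)
Lemma fo_graph_ideal k g : J k g ->
  exists2 h, ideal_pow F k h & forall m, gfo g *: gv G m = gv G (mf h m).
Proof.
elim: k g => [|k IH] g Jg.
  by have [a Ha] := fo_graph g; exists a => //; exact: Ideal_pow0.
have [b [Jb ->]] := J_gen Jg; have /choice[h Hh] : forall j, exists h,
    ideal_pow F k h /\ forall m, gfo (b j) *: gv G m = gv G (mf h m).
  by move=> j; have [h] := IH _ (Jb j); exists h.
exists (\sum_j f j * h j) => [|m].
  apply: ideal_pow_sum => // j; apply: Ideal_powS; last by case: (Hh j).
  by apply/F_f; exists (fun i => (i == j)%:R); rewrite sum_delta.
rewrite fo_sum scaler_suml.
transitivity (\sum_j gv G (mf (f j * h j) m)).
  apply: eq_bigr => j _; have [_ hE] := Hh j.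
  by rewrite gfoM -scalerA hE gt_v mfM.
transitivity (\sum_j gfo (gpb G (f j * h j)) *: gv G m).
  by apply: eq_bigr => j _; rewrite gpb_v.
rewrite -scaler_suml -fo_sum -gpb_v; congr (gfo _ *: _).
by rewrite (big_morph _ (@gpbD _ _ _ _ _ _ _ _ G) (morphD0 (@gpbD _ _ _ _ _ _ _ _ G))).
Qed.

Lemma Jsum k (I : Type) (s : seq I) (h : I -> gO G) :
  (forall i, J k (h i)) -> J k (\sum_(i <- s) h i).
Proof. by move=> H; elim/big_ind: _ => // *; exact: JD. Qed.

(** Conversely each f_j is the restriction of t_j, and lifting factor by factor lands in the k-th
    power of the ideal of the zero section. *)
Lemma ideal_pow_lift k h : ideal_pow F k h ->
  exists2 g, J k g & gfo g *: gv G u = gv G (mf h u).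
Proof.
suff H : ideal_pow F k h -> exists2 g, J k g & forall m, gfo g *: gv G m = gv G (mf h m).
  by move=> /H[g Jg E]; exists g.
elim=> {k h} [h|k a h /F_f[b ->] _ [g Jg E]|k h h' _ [g Jg E] _ [g' Jg' E']].
- by exists (gpb G h) => // m; rewrite gpb_v.
- exists ((\sum_j gpb G (b j) * gt G j) * g).
    rewrite -[k.+1]add1n; apply: JM => //; apply: Jsum => j.
    by rewrite -[1%N]add0n; exact: JM.
  move=> m; rewrite gfoM -scalerA E mfM -[in RHS]gpb_v.
  rewrite fo_sum (big_morph _ (@gpbD _ _ _ _ _ _ _ _ G) (morphD0 (@gpbD _ _ _ _ _ _ _ _ G))).
  rewrite fo_sum !scaler_suml; apply: eq_bigr => j _.
  by rewrite gfoM -scalerA gt_v !gpb_v mfM.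
exists (g + g'); first exact: JD.
move=> m; rewrite gfoD scalerDl E E' -!gpb_v -scalerDl -gfoD -gpbD.
by rewrite gpb_v.
Qed.

Lemma gW_lowers k x : gW F u k x -> exists2 P, lowers k P & x = P *: gv G u.
Proof.
elim=> {k x} [k h /ideal_pow_lift[g Jg <-]|k x y _ [P HP ->] _ [Q HQ ->]|
  k a x _ [P HP ->]|k i x _ [P HP ->]|k j x _ [P HP ->]|k x _ [P HP ->]].
- by exists (gfo g) => // i h' Jh; rewrite act_fo addnC; exact: JM.
- exists (P + Q); last by rewrite scalerDl.
  by move=> i g Jg; rewrite actD; apply: JD; [exact: HP|exact: HQ].
- exists (gfp G a * P); last by rewrite scalerA.
  by move=> i g Jg; rewrite actM act_fo -[(i + k)%N]add0n; apply: JM => //; exact: HP.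
- exists (gYo G i * P); last by rewrite scalerA.
  by move=> l g Jg; rewrite actM act_Yo; apply: JY; exact: HP.
- exists (gdo G j * P); last by rewrite scalerA.
  by move=> l g Jg; rewrite actM act_do; apply: Jdt; rewrite -addnS; exact: HP.
- exists P => // i g Jg; apply: Jmono; rewrite -addnS; exact: HP.
Qed.

Definition letter (i : 'I_(n + d)) : gD G :=
  match fintype.split i with inl k => gYo G k | inr j => gdo G j end.

Definition tau (i : 'I_(n + d)) : nat := if fintype.split i is inr _ then 1 else 0.

Definition word w : gD G := \prod_(i <- w) letter i.

Lemma act1 g : act 1 g = g.
Proof. by rewrite -(@gfo1 _ _ _ _ _ _ _ _ G) act_fo mul1r. Qed.

Lemma act_letter i g : act (letter i) g = D i g.
Proof.
by rewrite /letter -{2}(fintype.splitK i); case: (fintype.split i) => k /=;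
  rewrite ?Dl ?Dr ?act_Yo ?act_do.
Qed.

Lemma act_word w g : act (word w) g = Dword D w g.
Proof.
rewrite /word; elim: w => [|i w IH]; first by rewrite big_nil act1.
by rewrite big_cons actM act_letter IH.
Qed.

Lemma act_sum (I : Type) (s : seq I) (P : I -> gD G) g :
  act (\sum_(i <- s) P i) g = \sum_(i <- s) act (P i) g.
Proof.
elim: s => [|i s IH]; last by rewrite !big_cons actD IH.
by rewrite !big_nil -fo0 act_fo mul0r.
Qed.

Lemma letter_fo i g : gfo g * letter i = letter i * gfo g - gfo (D i g).
Proof.
rewrite /letter -{3}(fintype.splitK i); case: (fintype.split i) => k /=.
  by rewrite gYo_fo Dl addrC addKr.
by rewrite gdo_fo Dr addrC addKr.
Qed.

(** The function is moved to the right past the word, so that it meets the delta section first. Each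
    t-derivative left in front uses one order of the function, and commutators keep the count. *)
Lemma gW_word r w g : J (r + weight tau w) g -> gW F u r ((gfo g * word w) *: gv G u).
Proof.
rewrite /weight /word; elim: w r g => [|i w IH] r g.
  rewrite !big_nil addn0 mulr1 => /fo_graph_ideal[h Hh ->]; exact: GW_v.
rewrite !big_cons mulrA letter_fo mulrBl scalerBl -mulrA -scalerA.
rewrite /letter /tau -[in D i g](fintype.splitK i); case: (fintype.split i) => k /= Jg.
  apply: GW_add; first by apply: GW_Y; apply: IH.
  by apply: gWN => //; apply: IH; rewrite Dl; exact: JY.
apply: GW_add; first by apply: GW_do; apply: IH; move: Jg; rewrite addnA addn1.
by apply: gWN => //; apply: IH; rewrite Dr; apply: Jdt; rewrite -addnS -add1n.
Qed.

(** The normal form of [P] has coefficients of order exceeding the number of t-derivatives by one,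
    as testing on monomials shows. Operators are determined by their action, so the identity holds
    for [P] itself and each term falls under [gW_word]. *)
Lemma lowers_gW P : lowers 1 P -> gW F u 1 (P *: gv G u).
Proof.
move=> HP; have [r [A [ur rc PE]]] := normal_op_canon DC (act_normal P).
have tauD k i g : J k g -> J (k - tau i) (D i g).
  rewrite /tau -{2}(fintype.splitK i); case: (fintype.split i) => j /= Jg; first by rewrite subn0 Dl; exact: JY.
  by rewrite Dr; case: k Jg => [|k] Jg; rewrite ?subn1 //; exact: Jdt.
have tauc i : J (tau i) (c i).
  by rewrite /tau -{2}(fintype.splitK i); case: (fintype.split i) => j //=; rewrite cr.
have HA := normal_op_coef DD DM DC Dc J0 JD Jz JM Jmono tauc tauD natU ur rc.
have -> : P = \sum_(w <- r) gfo (A w) * word w.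
  apply: act_inj => g; rewrite PE act_sum; apply: eq_bigr => w _.
  by rewrite actM act_fo act_word.
rewrite big_seq scaler_suml; elim/big_ind: _ => [|x y|w wr]; first exact: gW0.
  exact: GW_add.
apply: gW_word; rewrite add1n; apply: HA => // k g Jg.
by rewrite -PE -addn1; exact: HP.
Qed.

Lemma lowers_gWP x :
  (exists2 P, lowers 1 P & x = P *: gv G u) <-> gW F u 1 x.
Proof. by split => [[P HP ->]|]; [exact: lowers_gW|exact: gW_lowers]. Qed.

End VFiltration.

(** * From local cohomology to a graph module, and the map [Phi] *)

Section DirectImageModule.
Variables (OX : comNzRingType) (n : nat) (X : 'I_n -> OX -> OX).
Variables (M : zmodType) (mf : OX -> M -> M) (mX : 'I_n -> M -> M).
Variables (d : nat) (f : 'I_d -> OX) (OW : comNzRingType) (DW : pzRingType) (N : lmodType DW).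
Variables (pb : OX -> OW) (t l : 'I_d -> OW) (dW : 'I_d -> OW -> OW) (Y : 'I_n -> OW -> OW).
Variables (fo : OW -> DW) (do : 'I_d -> DW) (Yo : 'I_n -> DW).
Variable tens : M -> loc_cohom l -> N.
Local Notation cls := (@loc_class OW d l).

Hypothesis lE : forall j, l j = t j - pb (f j).
Hypothesis pbD : {morph pb : a b / a + b}.
Hypothesis pbM : {morph pb : a b / a * b}.
Hypothesis pb1 : pb 1 = 1.
Hypothesis dWD : forall j, {morph dW j : a b / a + b}.
Hypothesis dWM : forall j a b, dW j (a * b) = dW j a * b + a * dW j b.
Hypothesis dW_pb : forall j a, dW j (pb a) = 0.
Hypothesis dW_t : forall j k, dW j (t k) = (j == k)%:R.
Hypothesis YD : forall k, {morph Y k : a b / a + b}.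
Hypothesis YM : forall k a b, Y k (a * b) = Y k a * b + a * Y k b.
Hypothesis Y_pb : forall k a, Y k (pb a) = pb (X k a).
Hypothesis Y_t : forall k j, Y k (t j) = 0.
Hypothesis foD : {morph fo : a b / a + b}.
Hypothesis foM : {morph fo : a b / a * b}.
Hypothesis fo1 : fo 1 = 1.
Hypothesis do_fo : forall j a, do j * fo a = fo (dW j a) + fo a * do j.
Hypothesis Yo_fo : forall k a, Yo k * fo a = fo (Y k a) + fo a * Yo k.
Hypothesis doC : forall i j, do i * do j = do j * do i.
Hypothesis Yo_do : forall k j, Yo k * do j = do j * Yo k.
Hypothesis tensDl : forall m m' b, tens (m + m') b = tens m b + tens m' b.
Hypothesis tensDr : forall m b b', tens m (b + b') = tens m b + tens m b'.
Hypothesis tens_pb : forall a m c, tens (mf a m) (cls c) = tens m (cls (pb a *: c)).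
Hypothesis fo_tens : forall a m c, fo a *: tens m (cls c) = tens m (cls (a *: c)).
Hypothesis do_tens : forall j m c,
  do j *: tens m (cls c) = tens m (cls (frac_der (dW j) (loc_den l) c)).
Hypothesis Yo_tens : forall k m c, Yo k *: tens m (cls c) =
  tens (mX k m) (cls c) + tens m (cls (frac_der (Y k) (loc_den l) c)).

Definition delta m : N := tens m (cls 'X).

Lemma clsD p q : cls (p + q) = cls p + cls q.
Proof. by rewrite /loc_class raddfD. Qed.

Lemma cls_eq p q : loc_null l (p - q) -> cls p = cls q.
Proof. by move=> H; apply/eqP; rewrite -Quotient.idealrBE. Qed.

Lemma tens_clsD m : {morph (fun c => tens m (cls c)) : p q / p + q}.
Proof. by move=> p q; rewrite clsD tensDr. Qed.

Lemma deltaD : {morph delta : m m' / m + m'}.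
Proof. by move=> m m'; exact: tensDl. Qed.

Lemma fo_pb_delta a m : fo (pb a) *: delta m = delta (mf a m).
Proof. by rewrite /delta fo_tens tens_pb. Qed.

Lemma fo_t_delta j m : fo (t j) *: delta m = delta (mf (f j) m).
Proof.
rewrite /delta fo_tens tens_pb; congr (tens m _); apply: cls_eq.
rewrite -scalerBl -lE; apply/asboolP.
(* [l j] times 1/h is the inverse of the product of the other equations, hence zero in local
   cohomology: the witness is ['X] in slot [j]. *)
exists 0, (fun k => if k == j then 'X else 0); rewrite mul0r add0r.
rewrite (bigD1 j) //= eqxx comp_polyX big1 ?addr0 // => k /negbTE ->.
exact: comp_poly0.
Qed.

Lemma frac_der_X (D : OW -> OW) h : D 0 = 0 -> D 1 = 0 ->
  frac_der D h 'X = (- D h) *: 'X^2.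
Proof.
move=> D0 D1; rewrite /frac_der derivX mulr1 scaleNr.
rewrite (_ : map_poly D 'X = 0) ?sub0r //.
by apply/polyP => k; rewrite coef_map_id0 // coefX coef0; case: (k == 1%N).
Qed.

Lemma der1 (D : OW -> OW) : (forall a b, D (a * b) = D a * b + a * D b) -> D 1 = 0.
Proof.
move=> DM; apply: (addrI (D 1)); rewrite addr0.
by have := DM 1 1; rewrite !mulr1 mul1r => <-.
Qed.

(* Both sides are derivations that agree on each l j = t j - pb (f j). *)
Lemma Y_loc_den k : Y k (loc_den l) = - \sum_j pb (X k (f j)) * dW j (loc_den l).
Proof.
suff H s : Y k (\prod_(j <- s) l j) = - \sum_j pb (X k (f j)) * dW j (\prod_(i <- s) l i).
  exact: H.
elim: s => [|i s IH].
  rewrite !big_nil (der1 (YM k)) big1 ?oppr0 // => j _.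
  by rewrite (der1 (dWM j)) mulr0.
have dl j : dW j (l i) = (j == i)%:R.
  have := dWD j (l i) (pb (f i)); rewrite {1}lE subrK dW_pb addr0 dW_t.
  by move=> <-.
have Yl : Y k (l i) = - pb (X k (f i)).
  apply: (addIr (pb (X k (f i)))); rewrite addNr -[in LHS]Y_pb -YD.
  by rewrite lE subrK Y_t.
rewrite !big_cons YM IH Yl mulNr mulrN -opprD; congr (- _).
under [RHS]eq_bigr do rewrite dWM dl mulrDr.
rewrite big_split /=; congr (_ + _).
  rewrite (bigD1 i) //= eqxx mul1r [X in _ + X]big1 ?addr0 // => j /negbTE ->.
  by rewrite mul0r mulr0.
by rewrite mulr_sumr; apply: eq_bigr => j _; rewrite mulrCA.
Qed.

(** The chain rule for delta(t - f): the field differentiates 1/h through h, and on h it acts as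
    minus the sum of the X_k(f_j) d/dt_j. *)
Lemma Yo_delta k m : Yo k *: delta m =
  delta (mX k m) - \sum_j do j *: delta (mf (X k (f j)) m).
Proof.
rewrite /delta Yo_tens; congr (_ + _).
have Y0 := morphD0 (YD k); rewrite frac_der_X ?(der1 (YM k)) // Y_loc_den opprK scaler_suml.
have td0 : tens m (cls 0) = 0 by exact: (morphD0 (tens_clsD m)).
rewrite (big_morph (fun c => tens m (cls c)) (tens_clsD m) td0) -sumrN.
apply: eq_bigr => j _; have d0 := morphD0 (dWD j).
have -> : do j *: tens (mf (X k (f j)) m) (cls 'X) =
    fo (pb (X k (f j))) *: (do j *: tens m (cls 'X)).
  rewrite tens_pb -fo_tens !scalerA do_fo dW_pb.
  by rewrite (morphD0 foD) add0r.
rewrite do_tens frac_der_X ?(der1 (dWM j)) // fo_tens scaleNr scalerN scalerA.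
by apply: (addIr (tens m (cls (- (pb (X k (f j)) * dW j (loc_den l) *: 'X^2)))));
  rewrite -[LHS]tens_clsD subrr addNr.
Qed.

Definition direct_image_module : graph_module X mf mX f :=
  @GraphModule OX n X M mf mX d f OW DW N pb t dW Y fo do Yo delta
    pbD pbM pb1 dWD dWM dW_pb dW_t YD YM Y_pb Y_t foD foM fo1 do_fo Yo_fo doC Yo_do
    deltaD fo_pb_delta fo_t_delta Yo_delta.

Hypothesis dWC : forall i j c, dW i (dW j c) = dW j (dW i c).
Variables (ev : OW -> OX) (inv : nat -> OW).
Hypothesis invE : forall K, inv K * K.+1%:R = 1.
Hypothesis evD : {morph ev : a b / a + b}.
Hypothesis evM : {morph ev : a b / a * b}.
Hypothesis ev_pb : forall a, ev (pb a) = a.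
Hypothesis ev_t : forall j, ev (t j) = f j.
Hypothesis mfD : forall b c m, mf (b + c) m = mf b m + mf c m.
Hypothesis mfM : forall b c m, mf (b * c) m = mf b (mf c m).
Hypothesis mf1 : forall m, mf 1 m = m.
Hypothesis mfDr : forall a m m', mf a (m + m') = mf a m + mf a m'.
Variables (e : nat) (g : 'I_e -> OX) (G' : graph_module X mf mX g) (a : 'I_e -> 'I_d -> OX).

Hypothesis tens_universal : forall phi : M -> loc_cohom l -> gN G',
  [/\ forall m m' b, phi (m + m') b = phi m b + phi m' b,
      forall m b b', phi m (b + b') = phi m b + phi m b' &
      forall a m c, phi (mf a m) (cls c) = phi m (cls (pb a *: c))] ->
  exists! psi : N -> gN G', (forall x y, psi (x + y) = psi x + psi y) /\
    forall m b, phi m b = psi (tens m b).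

(** The residue pairing is balanced, so it factors through the tensor product as [Phi]. The rule for
    t-derivatives has to hold on all of [N] and comes from uniqueness of the factorisation. *)
Lemma transfer_map : exists Phi : N -> gN G',
  [/\ {morph Phi : x y / x + y}, forall m, Phi (delta m) = gv G' m &
      forall j x, Phi (do j *: x) = pushed G' a j *: Phi x].
Proof.
pose T j : gN G' -> gN G' := fun x => pushed G' a j *: x.
have TD j : {morph T j : x y / x + y} by move=> x y; exact: scalerDr.
have TC i j x : T i (T j x) = T j (T i x) by rewrite /T !scalerA /pushed gfieldC.
(* The base of the residue: restrict the function to the graph of [f], let it act on [m], and place
   the result on the delta section of the other graph. *)
pose Gam m c := gv G' (mf (ev c) m).
have GD m : {morph Gam m : b c / b + c} by move=> b c; rewrite /Gam evD mfD gvD.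
have dl i j : dW i (l j) = (i == j)%:R.
  have := dWD i (l j) (pb (f j)); rewrite {1}lE subrK dW_pb addr0 dW_t.
  by move=> <-.
have ev_l j : ev (l j) = 0.
  apply: (addIr (f j)); rewrite add0r -{1}[f j]ev_pb -evD.
  by rewrite lE subrK ev_t.
have mf0 m : mf 0 m = 0 by apply: (addIr (mf 0 m)); rewrite -mfD !add0r.
have Gl m j c : Gam m (l j * c) = 0.
  by rewrite /Gam evM ev_l mul0r mf0 (morphD0 (@gvD _ _ _ _ _ _ _ _ G')).
have GmD m m' c : Gam (m + m') c = Gam m c + Gam m' c by rewrite /Gam mfDr gvD.
have Gpb b m c : Gam (mf b m) c = Gam m (pb b * c).
  by rewrite /Gam -mfM evM ev_pb mulrC.
have [phi [phiDl phiDr phi_pb phi_X phi_der]] :=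
  cohomology_residue dWD dWM dWC dl invE TD TC GD Gl GmD Gpb dW_pb.
have [Phi [[PhiD PhiE] _]] := tens_universal (And3 phiDl phiDr phi_pb).
exists Phi; split => [//|m|j x]; first by rewrite /delta -PhiE phi_X /Gam -[1]pb1 ev_pb mf1.
(* Following [phi] by [T j] gives a balanced map. Both [T j] after [Phi] and [Phi] after the
   t-derivative factor it, hence they agree. *)
have bal : [/\ forall m m' b, T j (phi (m + m') b) = T j (phi m b) + T j (phi m' b),
      forall m b b', T j (phi m (b + b')) = T j (phi m b) + T j (phi m b') &
      forall b m c, T j (phi (mf b m) (cls c)) = T j (phi m (cls (pb b *: c)))].
  by split=> *; rewrite ?phiDl ?phiDr ?TD ?phi_pb.
have [psi [_ psiU]] := tens_universal bal.
have H1 : psi = fun x => T j (Phi x).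
  by apply: psiU; split => [y z|m b]; rewrite ?PhiD ?TD ?PhiE.
have H2 : psi = fun x => Phi (do j *: x).
  apply: psiU; split => [y z|m b]; first by rewrite scalerDr PhiD.
  by rewrite -[b]reprK do_tens -PhiE phi_der.
by rewrite -[LHS]/((fun x => Phi (do j *: x)) x) -H2 H1.
Qed.

End DirectImageModule.

(** * The direct image at a point *)

Section CoordinateIdeal.
Variables (B : comNzRingType) (d : nat) (c : 'I_d -> B).

Lemma coord_expnMl N a g : coord_expn c N g -> coord_expn c N (a * g).
Proof.
elim: N a g => //= N IH a g [H HN ->]; exists (fun k => a * H k) => [k|]; first exact: IH.
by rewrite mulr_sumr; apply: eq_bigr => k _; rewrite mulrCA.
Qed.

Lemma coord_expn_seq (N : nat) (I : Type) (s : seq I) (h : I -> B) :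
  (forall x, coord_expn c N (h x)) -> coord_expn c N (\sum_(x <- s) h x).
Proof.
by move=> H; elim/big_ind: _ => // [|x y]; [exact: coord_expn0|exact: coord_expnD].
Qed.

Lemma coord_expnM N L g h : coord_expn c N g -> coord_expn c L h -> coord_expn c (N + L) (g * h).
Proof.
move=> + HL; elim: N g => [|N IH] g; first by move=> _; exact: coord_expnMl.
move=> /= [H HN ->]; exists (fun k => H k * h) => [k|]; first exact: IH.
by rewrite mulr_suml; apply: eq_bigr => k _; rewrite mulrA.
Qed.

Lemma coord_expn_mono N g : coord_expn c N.+1 g -> coord_expn c N g.
Proof.
elim: N g => // N IH g [H HN ->]; exists H => // k; exact: IH.
Qed.

Lemma coord_expn_coord j : coord_expn c 1 (c j).
Proof.
exists (fun k => (k == j)%:R) => //.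
by rewrite -{1}(sum_delta c j); apply: eq_bigr => k _; rewrite mulrC.
Qed.

Lemma coord_expn_tangent (D : B -> B) N g : {morph D : a b / a + b} ->
  (forall a b, D (a * b) = D a * b + a * D b) -> (forall j, D (c j) = 0) ->
  coord_expn c N g -> coord_expn c N (D g).
Proof.
move=> DD DM Dc; elim: N g => // N IH g [H HN ->].
exists (fun k => D (H k)) => [k|]; first exact/IH/HN.
rewrite (big_morph D DD (morphD0 DD)); apply: eq_bigr => k _.
by rewrite DM Dc mul0r add0r.
Qed.

(** Powers defined by sums of products with arbitrary members of the ideal agree with those built
    from coordinates, because the coordinates generate it. *)
Lemma ideal_expn_coord (K : B -> Prop) (E : nat -> B -> Prop) :
  (forall g, K g <-> exists b : 'I_d -> B, g = \sum_j c j * b j) ->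
  (forall g, E 0 g) ->
  (forall N g, E N.+1 g <-> exists k (a b : 'I_k -> B),
    [/\ forall l, K (a l), forall l, E N (b l) & g = \sum_l a l * b l]) ->
  forall N g, E N g <-> coord_expn c N g.
Proof.
move=> KP E0 EP; elim=> [|N IH] g; first by split=> _; [exact: I|exact: E0].
split=> [/EP[k [a [b [Ka Eb ->]]]]|[H HN ->]].
  apply: coord_expn_seq => l; rewrite -[N.+1]add1n; apply: coord_expnM; last exact/IH.
  by have /KP[b' ->] := Ka l; exists b'.
apply/EP; exists d, c, H; split => [l|l|//]; last exact/IH/HN.
by apply/KP; have [b _ bE] := coord_expn_coord l; exists b.
Qed.
End CoordinateIdeal.

Lemma normal_op_comp (B : comNzRingType) N (D : 'I_N -> B -> B) (P Q : B -> B) :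
  (forall i, {morph D i : g h / g + h}) ->
  (forall i g h, D i (g * h) = D i g * h + g * D i h) ->
  normal_op D P -> normal_op D Q -> normal_op D (P \o Q).
Proof.
move=> DD DM [s Hs] HQ.
have [s' Hs'] : normal_op D (fun g => \sum_(x <- s) x.1 * Dword D x.2 (Q g)).
  apply: normal_op_sum => -[a w] /=; apply: normal_opM.
  by elim: w => //= i w; exact: normal_op_der.
by exists s' => g; rewrite /= Hs Hs'.
Qed.

Section ConstantGerms.
Variables (R : realType) (n : nat) (T : topologicalType) (A : atlas R n T) (x : T).
Hypothesis AC : compatible A.
Local Notation C := (Cx R).

Definition const_germ (k : C) : ostalk A x := germ A (fun=> k) x.

Lemma const_germ_hol (k : C) : hol_at A (fun=> k) x.
Proof. by move=> i _; exact: analytic_at_cst. Qed.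

Lemma const_germD k k' : const_germ (k + k') = const_germ k + const_germ k'.
Proof. exact: (germ_addE AC (const_germ_hol k) (const_germ_hol k')). Qed.

Lemma const_germM k k' : const_germ (k * k') = const_germ k * const_germ k'.
Proof. exact: (germ_mulE AC (const_germ_hol k) (const_germ_hol k')). Qed.

Lemma const_germ1 : const_germ 1 = 1. Proof. exact: germ_cst1. Qed.

Lemma const_germ0 : const_germ 0 = 0. Proof. exact: germ_cst0. Qed.

Lemma const_germ_nat m : const_germ m%:R = m%:R.
Proof.
elim: m => [|m IH]; first exact: const_germ0.
by rewrite -[m.+1%:R]natr1 const_germD const_germ1 -[m.+1%:R]natr1 IH.
Qed.

Lemma const_germ_inv m : const_germ m.+1%:R^-1 * m.+1%:R = 1.
Proof. by rewrite -const_germ_nat -const_germM mulVf ?const_germ1 // pnatr_eq0. Qed.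
End ConstantGerms.

Section Operators.
Variables (R : realType) (n : nat) (T : topologicalType) (A : atlas R n T).
Variables (i : chart_index A) (x : T).
Hypothesis AC : compatible A.
Hypothesis xi : chart_dom A i x.
Local Notation O := (ostalk A x).
Local Notation D := (dstalk A x).

Definition dop k : D := dstalk_of (Diffop_field (dgerm_derivation AC xi k)).

Lemma fun_opD : {morph (@fun_op R n T A x) : a b / a + b}.
Proof. by move=> a b; apply: val_inj; apply/funext => g; exact: (mulrDl a b g). Qed.

Lemma fun_opM : {morph (@fun_op R n T A x) : a b / a * b}.
Proof. by move=> a b; apply: val_inj; apply/funext => g; exact: (esym (mulrA a b g)). Qed.

Lemma fun_op1 : fun_op (1 : O) = 1.
Proof. by []. Qed.

Lemma dop_fun_op k a : dop k * fun_op a = fun_op (dgerm i k a) + fun_op a * dop k.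
Proof. by apply: val_inj; apply/funext => g; exact: (dgermM AC xi k a g). Qed.

Lemma dopC k l : dop k * dop l = dop l * dop k.
Proof. by apply: val_inj; apply/funext => g; exact: (dgermC AC xi k l g). Qed.

(** Induction on how the operator is generated; a field is a combination of coordinate fields by
    [derivationE]. *)
Lemma diffop_normal (P : D) : normal_op (dgerm (x := x) i) (val P).
Proof.
have Hid k : normal_op (dgerm (x := x) i) (dgerm i k).
  exact: (normal_op_der (dgermD AC xi) (dgermM AC xi) k (normal_op_id _)).
elim: {P} (dstalk_diffop P) => [a|dlt Hd|P Q _ HP _ HQ|P Q _ HP _ HQ].
- exact: (normal_opM a (normal_op_id _)).
- rewrite (_ : dlt = fun g => \sum_k dlt (cgerm i x k) * dgerm i k g).
    by apply: normal_op_sum => k; exact: normal_opM.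
  by apply/funext => g; exact: (derivationE AC xi Hd g).
- exact: normal_opD HP HQ.
- exact: (normal_op_comp (dgermD AC xi) (dgermM AC xi) HP HQ).
Qed.

Lemma dstalk_inj (P Q : D) : (forall g, val P g = val Q g) -> P = Q.
Proof. by move=> H; apply: val_inj; apply/funext. Qed.
End Operators.

Lemma direct_image_laws (R : realType) n (T : topologicalType) (A : atlas R n T) d (p : T)
    (M : lmodType (dstalk A p)) f (N : @direct_image R n T A d p M f) :
  [/\ is_tensor (tens N),
      forall (a : ostalk (prod_atlas d A) (p, 0)) m c, fun_op a *: tens N m (loc_class (graph_eq A p f) c) =
        tens N m (loc_class (graph_eq A p f) (a *: c)) &
      forall (P : dstalk (prod_atlas d A) (p, 0)) (Q : dstalk A p) m c, derivation (val P) -> derivation (val Q) ->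
        (forall g, val P (pullback d g) = pullback d (val Q g)) ->
        P *: tens N m (loc_class (graph_eq A p f) c) =
          tens N (Q *: m) (loc_class (graph_eq A p f) c) +
          tens N m (loc_class (graph_eq A p f)
            (frac_der (val P) (loc_den (graph_eq A p f)) c))].
Proof. by case: N. Qed.

(** * The stalk of a direct image *)

Section DirectImageStalk.
Variables (R : realType) (n d : nat) (T : topologicalType) (A : atlas R n T).
Local Notation C := (Cx R).
Variables (i : chart_index A) (p : T).
Hypothesis CA : compatible A.
Hypothesis pi : chart_dom A i p.
Local Notation AW := (prod_atlas d A).
Local Notation W := (T * 'rV[C]_d)%type.
Local Notation q := ((p, 0) : W).
Local Notation OX := (ostalk A p).
Local Notation OW := (ostalk AW q).
Local Notation DX := (dstalk A p).
Local Notation DW := (dstalk AW q).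
Local Notation iW := (i : chart_index AW).
Local Notation pb := (@pullback R n T A d p).
Variables (M : lmodType DX) (f : 'I_d -> T -> C) (N : @direct_image R n T A d p M f).
Hypothesis f_hol : forall j, hol_at A (f j) p.
Hypothesis fp : forall j, f j p = 0.

Let CW : compatible AW := compatible_prod d CA.
Let qi : chart_dom AW iW q := pi.
Local Notation fg := (fun j => germ A (f j) p).
Local Notation l := (graph_eq A p f).

Lemma lrep_germ0 j : lrep i (fg j) (chart A i p) = 0.
Proof.
rewrite lrepE /= (chartK CA pi) -[RHS](fp j).
exact: nbhs_singleton (germ_repE CA (f_hol j)).
Qed.

Lemma pbD : {morph pb : a b / a + b}.
Proof.
move=> a b; apply: etrans (pullback_pull d CA pi _) _.
apply: etrans (pullD CW CA qi pi (chart_map_lsubmx d i p) a b) _.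
by rewrite -!(pullback_pull d CA pi).
Qed.

Lemma pbM : {morph pb : a b / a * b}.
Proof.
move=> a b; apply: etrans (pullback_pull d CA pi _) _.
apply: etrans (pullM CW CA qi pi (chart_map_lsubmx d i p) a b) _.
by rewrite -!(pullback_pull d CA pi).
Qed.

Lemma pb1 : pb 1 = 1.
Proof.
apply: etrans (pullback_pull d CA pi _) _.
exact: (pull1 CW CA qi pi (chart_map_lsubmx d i p)).
Qed.

Lemma graph_eqE j : l j = tcoord A p j - pb (fg j).
Proof.
apply: (addIr (pb (fg j))); rewrite [RHS]subrK.
have pc : hol_at AW (fun w => f j w.1) q.
  apply: (hol_at_chart CW qi).
  have H := analytic_at_pull (chart_map_lsubmx d i p) (f_hol j pi).
  exact: H.
have tc : hol_at AW (fun w => w.2 0 j) q.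
  apply: (hol_at_chart CW qi).
  exact: (analytic_at_rsubmx (chart AW iW q) j).
have dc : hol_at AW (fun w => w.2 0 j - f j w.1) q.
  by move=> k qk; exact: (analytic_atB (tc k qk) (pc k qk)).
have -> : pb (fg j) = germ AW (fun w => f j w.1) q.
  apply: esym; apply: (germ_near_eq CW pc).
  have H : \forall w \near q, germ_rep (fg j) w.1 = f j w.1.
    exact: (cvg_fst (germ_repE CA (f_hol j))).
  by apply: filterS H => w /esym.
apply: etrans (esym (germ_addE CW dc pc)) _.
apply: (congr1 (fun F => germ AW F q)); apply/funext => w.
by rewrite subrK.
Qed.

Local Notation dW := (fun j => dgerm (A := AW) (x := q) iW (rshift n j)).
Local Notation dY := (fun k => dgerm (A := AW) (x := q) iW (lshift d k)).
Local Notation cls := (@loc_class OW d l).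

Lemma dW_t j k : dW j (tcoord A p k) = (j == k)%:R.
Proof.
apply: etrans (congr1 (dgerm iW _) (tcoordE i p k)) _.
apply: etrans (dgerm_cgerm CW qi _ _) _.
by rewrite eq_rshift.
Qed.

Lemma dY_t k j : dY k (tcoord A p j) = 0.
Proof.
apply: etrans (congr1 (dgerm iW _) (tcoordE i p j)) _.
apply: etrans (dgerm_cgerm CW qi _ _) _.
by rewrite eq_lrshift.
Qed.

Lemma tensDl m m' b : tens N (m + m') b = tens N m b + tens N m' b.
Proof. by have [[[+ _ _] _] _ _] := direct_image_laws N; exact. Qed.

Lemma tensDr m b b' : tens N m (b + b') = tens N m b + tens N m b'.
Proof. by have [[[_ + _] _] _ _] := direct_image_laws N; exact. Qed.

Lemma tens_pb (a : OX) m c : tens N (fun_op a *: m) (cls c) = tens N m (cls (pb a *: c)).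
Proof. by have [[[_ _ +] _] _ _] := direct_image_laws N; exact. Qed.

Lemma fo_tens (a : OW) m c : fun_op a *: tens N m (cls c) = tens N m (cls (a *: c)).
Proof. by have [_ + _] := direct_image_laws N; exact. Qed.

Lemma do_tens j m c : dop CW qi (rshift n j) *: tens N m (cls c) =
  tens N m (cls (frac_der (dW j) (loc_den l) c)).
Proof.
have [_ _ H] := direct_image_laws N.
have pb0 : pb 0 = 0 := morphD0 pbD.
(* A t-derivative projects to the zero field on the base, so the first term of the Leibniz rule
   disappears. *)
have D0 : derivation (val (0 : DX)).
  have zM (B : comNzRingType) (g h : B) : 0 = 0 * h + g * 0 by rewrite mul0r mulr0 addr0.
  by split=> [g h|g h|k]; [exact: esym (addr0 _)|exact: (zM _ g h)|].
have H0 g : val (dop CW qi (rshift n j)) (pb g) = pb (val (0 : DX) g).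
  exact: etrans (dgerm_pullback_r CA pi j g) (esym pb0).
have := H (dop CW qi (rshift n j)) 0 m c (dgerm_derivation CW qi (rshift n j)) D0 H0.
have t0 : tens N (0 *: m) (cls c) = 0.
  by rewrite scale0r; apply: (addIr (tens N 0 (cls c))); rewrite -tensDl !add0r.
by rewrite t0 add0r.
Qed.

Lemma Yo_tens k m c : dop CW qi (lshift d k) *: tens N m (cls c) =
  tens N (dop CA pi k *: m) (cls c) + tens N m (cls (frac_der (dY k) (loc_den l) c)).
Proof.
have [_ _ H] := direct_image_laws N.
have Hg g : val (dop CW qi (lshift d k)) (pb g) = pb (val (dop CA pi k) g).
  exact: (dgerm_pullback_l d CA pi k g).
exact: (H (dop CW qi (lshift d k)) (dop CA pi k) m c (dgerm_derivation CW qi (lshift d k)) (dgerm_derivation CA pi k) Hg).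
Qed.

Definition stalk_module :=
  @direct_image_module OX n (dgerm (x := p) i) M (fun a m => fun_op a *: m)
    (fun k m => dop CA pi k *: m) d fg OW DW N pb (tcoord A p) l dW dY (@fun_op _ _ _ AW q)
    (fun j => dop CW qi (rshift n j)) (fun k => dop CW qi (lshift d k)) (tens N)
    graph_eqE pbD pbM pb1 (fun j => dgermD CW qi (rshift n j)) (fun j => dgermM CW qi (rshift n j))
    (dgerm_pullback_r CA pi) dW_t (fun k => dgermD CW qi (lshift d k))
    (fun k => dgermM CW qi (lshift d k)) (dgerm_pullback_l d CA pi) dY_t
    (@fun_opD _ _ _ AW q) (@fun_opM _ _ _ AW q) (fun_op1 AW q)
    (fun j => dop_fun_op CW qi (rshift n j)) (fun k => dop_fun_op CW qi (lshift d k))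
    (fun j k => dopC CW qi (rshift n j) (rshift n k)) (fun j k => dopC CW qi (lshift d j) (rshift n k))
    tensDl tensDr tens_pb fo_tens do_tens Yo_tens.

Local Notation G := stalk_module.

Lemma ideal_Y_coord (g : OW) : ideal_Y g <-> exists b : 'I_d -> OW, g = \sum_j tcoord A p j * b j.
Proof.
split=> [/(ideal_YP CA pi) g0|[b ->]].
  have [b E] := hadamard0 CA pi g; exists b; apply: etrans E _.
  by rewrite g0 (morphD0 pbD) add0r.
apply/(ideal_YP CA pi).
have rD := pullD CA CW pi qi (chart_map_zero_section d i p).
rewrite /restr0 (big_morph _ rD (morphD0 rD)); apply: big1 => j _.
apply: etrans (pullM CA CW pi qi (chart_map_zero_section d i p) _ _) _.
apply: etrans (congr1 (fun y => y * _) (restr0_tcoord CA pi j)) _.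
exact: mul0r.
Qed.

Lemma ideal_Y_expnP k (g : OW) : ideal_Y_expn k g <-> coord_expn (tcoord A p) k g.
Proof.
apply: (ideal_expn_coord ideal_Y_coord) => [//|L h].
by split.
Qed.

(** For a negative exponent [i] the target exponent i + 1 is at most 0 and imposes nothing, so only
    natural exponents count. *)
Lemma V_filtration_lowers (P : DW) :
  V_filtration (-1) P <-> forall k g, coord_expn (tcoord A p) k g ->
    coord_expn (tcoord A p) (k + 1) (val P g).
Proof.
split=> [VP k g /ideal_Y_expnP Jg|H [k|[|k]] g //=].
  by apply/ideal_Y_expnP; exact: (VP (Posz k) g Jg).
move=> /ideal_Y_expnP Jg; apply/ideal_Y_expnP; exact: H.
Qed.

Variables (F : OX -> Prop) (u : M).
Hypothesis F0 : F 0.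
Hypothesis F_f : forall a, F a <-> exists b : 'I_d -> OX, a = \sum_j b j * germ A (f j) p.

(** Operators are determined by their action, so the existential over theta in [kills_mod_V] ranges
    over this single element. *)
Lemma gtheta_stalk (theta : DW) : is_theta theta <-> theta = gtheta G.
Proof.
have valS (s : seq 'I_d) (P : 'I_d -> DW) g :
    val (\sum_(j <- s) P j) g = \sum_(j <- s) val (P j) g.
  by elim: s => [|j s IH]; rewrite ?big_nil // !big_cons -IH.
have E g : val (gtheta G) g = \sum_j tcoord A p j * dt j g.
  apply: etrans (valS _ _ g) _; apply: eq_bigr => j _.
  by rewrite (dtE CA pi j g).
split=> [H|-> g]; last exact: E.
by apply: dstalk_inj => g; rewrite H E.
Qed.

(** The bridge to the algebraic part: membership in V^-1 v becomes level 1 of [gW], a condition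
    formulated with [F] and [u] and stable under [Phi]. *)
Lemma kills_stalk (b : {poly OX}) : kills_mod_V (image_section N u) b <->
  gW F u 1 (geval G b *: gv G u).
Proof.
have VP : (exists2 P : DW, lowers (G := G) (fun P => val (P : DW)) (coord_expn (tcoord A p)) 1 P &
    geval G b *: gv G u = P *: gv G u) <-> gW F u 1 (geval G b *: gv G u).
  apply: (@lowers_gWP OX n (dgerm (x := p) i) M (fun a m => fun_op a *: m)
    (fun k m => dop CA pi k *: m) d (fun j => germ A (f j) p) G F u
    (fun P => val (P : DW)) (coord_expn (tcoord A p)) (cgerm iW q) (dgerm (x := q) iW)).
  - by move=> a c m; rewrite fun_opM scalerA.
  - exact: F0.
  - exact: F_f.
  - exact: dstalk_inj.
  - by [].
  - by [].
  - by [].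
  - by [].
  - by [].
  - by [].
  - exact: coord_expnD.
  - exact: coord_expn0.
  - exact: coord_expnM.
  - exact: coord_expn_mono.
  - exact: coord_expn_coord.
  - by move=> k g [c Hc E]; exists c.
  - move=> k j g; apply: coord_expn_tangent => [||l].
    + exact (dgermD CW qi (lshift d j)).
    + exact (dgermM CW qi (lshift d j)).
    + exact (dY_t j l).
  - move=> k j g; apply: coord_expn_deriv.
    + exact (fun j => dgermD CW qi (rshift n j)).
    + exact (fun j => dgermM CW qi (rshift n j)).
    + exact dW_t.
  - move=> g; have [c E] := hadamard_graph CA pi lrep_germ0 g.
    by exists (graph_restr i (fun j => germ A (f j) p) g), c.
  - by [].
  - by [].
  - exact (dgermD CW qi).
  - exact (dgermM CW qi).
  - exact (dgermC CW qi).
  - exact (dgerm_cgerm CW qi).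
  - by move=> j; exact (esym (tcoordE i p j)).
  - by move=> m; exists (const_germ AW q m.+1%:R^-1); exact: const_germ_inv.
  - exact: (diffop_normal CW qi).
split=> [[theta [P [/gtheta_stalk -> VfP E]]]|/VP[P HP E]].
  by apply/VP; exists P => //; apply/V_filtration_lowers.
exists (gtheta G), P; split; [exact/gtheta_stalk|exact/V_filtration_lowers|exact E].
Qed.

End DirectImageStalk.

(** * Comparison of two systems of generators *)

Section ChangeOfGenerators.
Variables (R : realType) (n d e : nat) (T : topologicalType) (A : atlas R n T).
Local Notation C := (Cx R).
Variables (i : chart_index A) (p : T).
Hypothesis CA : compatible A.
Hypothesis pi : chart_dom A i p.
Local Notation OX := (ostalk A p).
Local Notation DX := (dstalk A p).
Variables (M : lmodType DX) (f : 'I_d -> T -> C) (g : 'I_e -> T -> C).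
Variables (N : @direct_image R n T A d p M f) (N' : @direct_image R n T A e p M g).
Hypothesis f_hol : forall j, hol_at A (f j) p.
Hypothesis fp : forall j, f j p = 0.
Local Notation G := (stalk_module CA pi N f_hol).
Local Notation AW := (prod_atlas d A).
Local Notation W := (T * 'rV[C]_d)%type.
Local Notation q := ((p, 0) : W).
Local Notation iW := (i : chart_index AW).
Let CW : compatible AW := compatible_prod d CA.
Let qi : chart_dom AW iW q := pi.

Variables (F : OX -> Prop) (u : M).
Hypothesis F0 : F 0.
Hypothesis F_f : forall a, F a <-> exists b : 'I_d -> OX, a = \sum_j b j * germ A (f j) p.

Lemma stalk_transfer (g_hol : forall j, hol_at A (g j) p) (a : 'I_e -> 'I_d -> OX) :
  let G' := stalk_module CA pi N' g_hol in exists Phi : gN G -> gN G',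
  [/\ {morph Phi : x y / x + y}, forall m, Phi (gv G m) = gv G' m &
      forall j x, Phi (gdo G j *: x) = pushed G' a j *: Phi x].
Proof.
move=> G'; have [HT _ _] := direct_image_laws N.
have f0 := lrep_germ0 CA pi f_hol fp.
have cm := chart_map_graph pi f0.
apply: (@transfer_map OX n (dgerm (x := p) i) M (fun a m => fun_op a *: m)
    (fun k m => dop CA pi k *: m) d (fun j => germ A (f j) p) _ _ _
    (@pullback R n T A d p) (tcoord A p) (graph_eq A p f)
    (fun j => dgerm (A := AW) (x := q) iW (rshift n j)) (fun j => dop CW qi (rshift n j))
    (tens N) (graph_eqE CA pi f_hol) (pb1 d CA pi) (fun j => dgermD CW qi (rshift n j))
    (fun j => dgermM CW qi (rshift n j)) (dgerm_pullback_r CA pi) (dW_t CA pi) (do_tens CA pi N)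
    (fun j k => dgermC CW qi (rshift n j) (rshift n k))
    (graph_restr i (fun j => germ A (f j) p)) (fun m => const_germ AW q m.+1%:R^-1)
    (const_germ_inv q CW)).
- exact (pullD CA CW pi qi cm).
- exact (pullM CA CW pi qi cm).
- exact (graph_restr_pullback CA pi f0).
- exact (graph_restr_tcoord CA pi f0).
- by move=> b c m; rewrite fun_opD scalerDl.
- by move=> b c m; rewrite fun_opM scalerA.
- by move=> m; rewrite fun_op1 scale1r.
- by move=> b m m'; rewrite scalerDr.
- by move=> phi; exact: (HT.2 (gN G') phi).
Qed.

Let kills_gW := kills_stalk CA pi N f_hol fp u F0 F_f.

Lemma gen_mem j : F (germ A (f j) p).
Proof.
apply/F_f; exists (fun k => (k == j)%:R).
exact: esym (sum_delta (fun k => germ A (f k) p) j).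
Qed.

(** Both sides are translated into [gW] for the same [F] and [u]. A matrix expressing the germs of
    [g] through those of [f] defines the map that carries one to the other. *)
Lemma kills_shift_transfer : (forall j, hol_at A (g j) p) -> (forall j, g j p = 0) ->
  (forall a, F a <-> exists b : 'I_e -> OX, a = \sum_j b j * germ A (g j) p) ->
  forall b : {poly OX}, kills_mod_V (image_section N u) (b \Po shiftX OX d) ->
    kills_mod_V (image_section N' u) (b \Po shiftX OX e).
Proof.
move=> g_hol gp F_g b /kills_gW H.
apply/(kills_stalk CA pi N' g_hol gp u F0 F_g).
have Fg k : F (germ A (g k) p).
  apply/F_g; exists (fun l => (l == k)%:R).
  exact: esym (sum_delta (fun l => germ A (g l) p) k).
have /choice[a gE] : forall k, exists a : 'I_d -> OX, germ A (g k) p = \sum_j a j * germ A (f j) p.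
  by move=> k; apply/F_f; exact: Fg.
have [Phi [PhiD Phi_v Phi_do]] := stalk_transfer g_hol a.
apply: (kills_transport _ _ (dgermD CA pi) (dgermM CA pi) gE PhiD Phi_v Phi_do F0 gen_mem H).
- by move=> c c' m; rewrite fun_opD scalerDl.
- by move=> c c' m; rewrite fun_opM scalerA.
Qed.

Lemma kills_ideal (c : {poly OX}) : (forall k, F c`_k) ->
  kills_mod_V (image_section N u) (c \Po shiftX OX d).
Proof.
move=> Fc; apply/kills_gW.
have mfM (b b' : OX) (m : M) : fun_op (b * b') *: m = fun_op b *: (fun_op b' *: m).
  by rewrite fun_opM scalerA.
have H := gW_geval mfM (stalk_module CA pi N f_hol) u F0 gen_mem d Fc.
by move: H; rewrite fun_op1 scale1r.
Qed.

Lemma kills_modD (b c : {poly OX}) : kills_mod_V (image_section N u) b ->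
  kills_mod_V (image_section N u) c -> kills_mod_V (image_section N u) (b + c).
Proof.
move=> /kills_gW Hb /kills_gW Hc.
apply/kills_gW.
by rewrite gevalD scalerDl; exact: GW_add.
Qed.

Lemma kills_modZ a (b : {poly OX}) : kills_mod_V (image_section N u) b ->
  kills_mod_V (image_section N u) (a *: b).
Proof.
move=> /kills_gW Hb.
apply/kills_gW.
by rewrite -mul_polyC geval_mulC -scalerA; exact: GW_fp.
Qed.
End ChangeOfGenerators.

(** * Minimal monic polynomials *)

Section ShiftedPolynomials.
Variable B : comNzRingType.
Implicit Types b c : {poly B}.

Lemma comp_poly_shiftK s b : (b \Po shiftX B s) \Po ('X - s%:R%:P) = b.
Proof. exact: comp_polyXaddC_K. Qed.

Lemma comp_poly_unshiftK s b : (b \Po ('X - s%:R%:P)) \Po shiftX B s = b.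
Proof. by rewrite -{2}(comp_polyXaddC_K b (- s%:R)) polyCN opprK. Qed.

Lemma size_comp_XaddC b (z : B) : size (b \Po ('X + z%:P)) = size b.
Proof.
have le c y : (size (c \Po ('X + y%:P)) <= size c)%N.
  have [->|c0] := eqVneq c 0; first by rewrite comp_poly0.
  apply: leq_trans (size_comp_poly_leq _ _) _.
  by rewrite size_XaddC muln1 prednK // lt0n size_poly_eq0.
apply/anti_leq/andP; split; first exact: le.
by have := le (b \Po ('X + z%:P)) (- z); rewrite polyCN comp_polyXaddC_K.
Qed.

(** Coefficients may have zero divisors, so the proof follows Horner's scheme: the factor at each
    stage is monic and degrees add. *)
Lemma lead_coef_comp_XaddC b (z : B) : lead_coef (b \Po ('X + z%:P)) = lead_coef b.
Proof.
elim/poly_ind: b => [|b c IH]; first by rewrite comp_poly0.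
rewrite comp_poly_MXaddC; have [->|b0] := eqVneq b 0.
  by rewrite comp_poly0 !mul0r.
have size_lt (q r : {poly B}) : q != 0 -> r \is monic -> size r = 2%N -> (size c%:P < size (q * r)%R)%N.
  move=> q0 rm r2; rewrite size_Mmonic // r2 addn2 /= ltnS.
  by apply: leq_trans (size_polyC_leq1 c) _; rewrite lt0n size_poly_eq0.
rewrite !lead_coefDl ?lead_coef_Mmonic ?monicXaddC ?monicX ?IH //.
  by apply: size_lt; rewrite ?monicX ?size_polyX.
apply: size_lt; rewrite ?monicXaddC ?size_XaddC //.
by rewrite -size_poly_eq0 size_comp_XaddC size_poly_eq0.
Qed.

Lemma monic_comp_XaddC b (z : B) : (b \Po ('X + z%:P) \is monic) = (b \is monic).
Proof. by rewrite !monicE lead_coef_comp_XaddC. Qed.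

Definition minimal_monic (K : {poly B} -> Prop) b :=
  [/\ b \is monic, K b & forall b', b' \is monic -> K b' -> (size b <= size b')%N].

Lemma minimal_monic_shift (K K' : {poly B} -> Prop) d e :
  (forall b, K' (b \Po shiftX B e) -> K (b \Po shiftX B d)) ->
  (forall b, K (b \Po shiftX B d) -> K' (b \Po shiftX B e)) ->
  forall b, minimal_monic K (b \Po shiftX B d) -> minimal_monic K' (b \Po shiftX B e).
Proof.
move=> K'K KK' b [mb Kb minb]; split; last 1 first.
- move=> b' mb'; rewrite -[b'](comp_poly_unshiftK e) => /K'K Kb'.
  have := minb _ _ Kb'; rewrite !size_comp_XaddC; apply.
  by move: mb'; rewrite monic_comp_XaddC -[in b' \is _](comp_poly_unshiftK e b') monic_comp_XaddC.
- by move: mb; rewrite !monic_comp_XaddC.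
- exact: KK'.
Qed.

Lemma minimal_monic_add (K : {poly B} -> Prop) s b c :
  (forall b c, K b -> K c -> K (b + c)) -> (size c < size b)%N ->
  minimal_monic K (b \Po shiftX B s) -> K (c \Po shiftX B s) ->
  minimal_monic K ((b + c) \Po shiftX B s).
Proof.
move=> KD cb [mb Kb minb] Kc; split.
- rewrite monic_comp_XaddC monicE lead_coefDl // -monicE.
  by move: mb; rewrite monic_comp_XaddC.
- by rewrite comp_polyD; exact: KD.
- move=> b' mb' Kb'; have := minb b' mb' Kb'.
  by rewrite !size_comp_XaddC size_polyDl.
Qed.
End ShiftedPolynomials.

Section ConstantCoefficients.
Variables (k : fieldType) (B : comNzRingType) (h : {rmorphism k -> B}).
Variable K : {poly B} -> Prop.
Hypothesis KD : forall b c, K b -> K c -> K (b + c).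
Hypothesis KZ : forall a b, K b -> K (a *: b).

(** The difference of two minimal polynomials has smaller degree and, if nonzero, can be made monic
    over a field, contradicting minimality. In a stalk the leading coefficient may fail to be
    invertible, which is why indicial polynomials need not be unique. *)
Lemma minimal_monic_unique b b' : minimal_monic (K \o map_poly h) b ->
  minimal_monic (K \o map_poly h) b' -> b = b'.
Proof.
move=> [mb Kb minb] [mb' Kb' minb'].
have sb : size b = size b' by apply/anti_leq; rewrite minb // minb'.
apply/eqP; rewrite -subr_eq0; apply/negPn/negP => r0.
have Kr : K (map_poly h ((lead_coef (b - b'))^-1 *: (b - b'))).
  rewrite map_polyZ rmorphB; apply: KZ; apply: KD => //.
  by rewrite -scaleN1r; exact: KZ.
have mr : (lead_coef (b - b'))^-1 *: (b - b') \is monic.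
  by rewrite monicE lead_coefZ mulVf // lead_coef_eq0.
have := minb _ mr Kr; rewrite size_scale ?invr_eq0 ?lead_coef_eq0 // leqNgt => /negP; apply.
have b0 : (0 < size b)%N by rewrite lt0n size_poly_eq0 monic_neq0.
rewrite -(prednK b0) ltnS; apply/leq_sizeP => j; rewrite leq_eqVlt => /orP[/eqP <-|jb].
  rewrite coefB; move: (monicP mb) (monicP mb'); rewrite /lead_coef sb => -> ->.
  exact: subrr.
rewrite coefB !nth_default ?subrr //; first by rewrite -sb -(prednK b0).
by rewrite -(prednK b0).
Qed.

Lemma map_poly_shift s (b : {poly k}) :
  map_poly h (b \Po shiftX k s) = map_poly h b \Po shiftX B s.
Proof. by rewrite map_comp_poly map_polyXaddC rmorph_nat. Qed.
End ConstantCoefficients.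

Lemma const_germ_rmorphism (R : realType) n (T : topologicalType) (A : atlas R n T) (x : T) :
  compatible A -> exists h : {rmorphism Cx R -> ostalk A x}, forall c, h c = germ A (fun=> c) x.
Proof.
move=> AC.
have aM : zmod_morphism (const_germ A x).
  move=> c c'; apply: (addIr (const_germ A x c')); rewrite subrK.
  by rewrite -[LHS](const_germD x AC) subrK.
have mM : monoid_morphism (const_germ A x).
  by split; [exact: const_germ1|move=> c c'; exact: const_germM].
pose h1 := GRing.isZmodMorphism.Build _ _ (const_germ A x) aM.
pose h2 := GRing.isMonoidMorphism.Build _ _ (const_germ A x) mM.
pose h : {rmorphism Cx R -> ostalk A x} := HB.pack (const_germ A x) h1 h2.
by exists h.
Qed.

(** A germ that does not vanish at [p] is a unit and would make the ideal the whole stalk. Hence the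
    graph passes through the zero section over [p]. *)
Lemma proper_ideal_vanish (R : realType) n (T : topologicalType) (A : atlas R n T)
    (i : chart_index A) (p : T) (F : set (ostalk A p)) (f : T -> Cx R) :
  compatible A -> chart_dom A i p -> (forall a g, F g -> F (a * g)) ->
  (exists a, ~ F a) -> hol_at A f p -> F (germ A f p) -> f p = 0.
Proof.
move=> CA pi FM [a Fa] hf Ff; apply: contra_notP Fa => /eqP f0.
have fE : lrep i (germ A f p) (chart A i p) = f p.
  rewrite lrepE /= (chartK CA pi).
  exact: nbhs_singleton (germ_repE CA hf).
have [h hE] : exists h, h * germ A f p = 1.
  by apply: (germ_unit CA pi); rewrite fE.
have := FM (a * h) _ Ff; rewrite -mulrA hE.
by rewrite mulr1.
Qed.

(** * Invariance of b-functions and of indicial polynomials *)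

Section Main.
Variables (R : realType) (n : nat) (T : topologicalType) (A : atlas R n T).
Variables (i : chart_index A) (p : T).
Hypothesis CA : compatible A.
Hypothesis pi : chart_dom A i p.
Local Notation OX := (ostalk A p).
Variables (M : lmodType (dstalk A p)) (F : set OX) (u : M).
Hypothesis F0 : F 0.

Definition ideal_generators d (f : 'I_d -> T -> Cx R) :=
  [/\ forall j, hol_at A (f j) p, forall j, f j p = 0 &
      forall a, F a <-> exists b : 'I_d -> OX, a = \sum_j b j * germ A (f j) p].

Section TwoGenerators.
Variables (d e : nat) (f : 'I_d -> T -> Cx R) (g : 'I_e -> T -> Cx R).
Variables (N : @direct_image R n T A d p M f) (N' : @direct_image R n T A e p M g).
Hypothesis Hf : ideal_generators f.
Hypothesis Hg : ideal_generators g.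

Lemma kills_transfer (b : {poly OX}) :
  kills_mod_V (image_section N u) (b \Po shiftX OX d) ->
  kills_mod_V (image_section N' u) (b \Po shiftX OX e).
Proof.
have [f_hol f0 F_f] := Hf; have [g_hol g0 F_g] := Hg.
exact: (kills_shift_transfer CA pi N' f_hol f0 F0 F_f g_hol g0 F_g).
Qed.

End TwoGenerators.

Lemma indicial_setP d f (N : @direct_image R n T A d p M f) (b : {poly OX}) :
  indicial_set N u b <->
  minimal_monic (kills_mod_V (image_section N u)) (b \Po shiftX OX d).
Proof. by split=> H; exact H. Qed.

Lemma indicial_set_sub d e f g N N' : @ideal_generators d f -> @ideal_generators e g ->
  @indicial_set R n T A d p M f N u `<=` @indicial_set R n T A e p M g N' u.
Proof.
move=> Hf Hg b /indicial_setP Hb; apply/indicial_setP.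
have T1 := kills_transfer N Hg Hf; have T2 := kills_transfer N' Hf Hg.
pose K := kills_mod_V (image_section N u); pose K' := kills_mod_V (image_section N' u).
exact (@minimal_monic_shift OX K K' d e (T1 N') (T2 N) b Hb).
Qed.

Lemma indicial_set_ideal d f N (b c : {poly OX}) : @ideal_generators d f ->
  @indicial_set R n T A d p M f N u b -> (forall j, F c`_j) -> (size c < size b)%N ->
  @indicial_set R n T A d p M f N u (b + c).
Proof.
move=> [f_hol f0 F_f] /indicial_setP Hb Fc cb.
have KD := kills_modD CA pi (N := N) (u := u) f_hol f0 F0 F_f.
have Kc := kills_ideal CA pi N f_hol f0 u F0 F_f Fc.
have X := minimal_monic_add KD cb Hb Kc.
apply/indicial_setP; exact X.
Qed.

Lemma bfunction_transfer d e f g N N' (b : {poly Cx R}) :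
  @ideal_generators d f -> @ideal_generators e g ->
  is_bfunction (@image_section R n T A d p M f N u) b ->
  (exists b' : {poly Cx R}, is_bfunction (@image_section R n T A e p M g N' u) b') /\
  (forall b' : {poly Cx R}, is_bfunction (@image_section R n T A e p M g N' u) b' ->
    b' \Po ('X - e%:R%:P) = b \Po ('X - d%:R%:P)).
Proof.
move=> Hf Hg Hb; have [h hE] := const_germ_rmorphism p CA.
have cE (c : {poly Cx R}) : const_poly A p c = map_poly h c.
  by apply: eq_map_poly => k; rewrite hE.
pose Kf c := kills_mod_V (image_section N u) (map_poly h c).
pose Kg c := kills_mod_V (image_section N' u) (map_poly h c).
have bP d' f' (N1 : @direct_image R n T A d' p M f') (c : {poly Cx R}) :
    is_bfunction (image_section N1 u) c <->
    minimal_monic (kills_mod_V (image_section N1 u) \o map_poly h) c.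
  rewrite /is_bfunction cE.
  split=> -[mc Kc minc]; split=> // b' mb' Kb'; apply: minc => //; move: Kb'; rewrite cE //.
(* [b0] is b(s - d), common to both sides. Shifting it by [e] gives a minimal polynomial for [g],
   and uniqueness identifies every b-function there with it. *)
pose b0 := b \Po ('X - d%:R%:P).
have bE : b = b0 \Po shiftX _ d by rewrite /b0 comp_poly_unshiftK.
have Hb' : minimal_monic (kills_mod_V (image_section N' u) \o map_poly h) (b0 \Po shiftX _ e).
  apply: (@minimal_monic_shift _ (kills_mod_V (image_section N u) \o map_poly h) _ d).
  - by move=> c; rewrite /= !map_poly_shift; exact: kills_transfer.
  - by move=> c; rewrite /= !map_poly_shift; exact: kills_transfer.
  - by rewrite -bE; apply/bP.
split; first by exists (b0 \Po shiftX _ e); apply/bP.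
have [g_hol g0 F_g] := Hg.
move=> b' /bP mb'.
rewrite (minimal_monic_unique (kills_modD CA pi g_hol g0 F0 F_g)
  (kills_modZ CA pi g_hol g0 F0 F_g) mb' Hb').
by rewrite comp_poly_shiftK.
Qed.

End Main.

Theorem theorem1 (R : realType) (n : nat) (X : complexManifold R n)
    (F : forall x : X, set (ostalk (charts X) x)) (p : X)
    (Omega : set X) (M : sheafModule (@dsection R n X (charts X)) Omega)
    (Vu : set X) (u : forall x : X, mstalk M x)
    (d e : nat) (U U' : set X)
    (f : 'I_d -> X -> Cx R) (g : 'I_e -> X -> Cx R)
    (N : @direct_image R n X (charts X) d p (mstalk M p) f)
    (N' : @direct_image R n X (charts X) e p (mstalk M p) g) :
  coherent_ideal_sheaf F ->
  (exists a : ostalk (charts X) p, ~ F p a) ->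
  open Omega -> coherent_dmodule M ->
  open Vu -> Vu p -> Vu `<=` Omega -> msec Vu u ->
  stein (charts X) U -> U p -> U `<=` Omega -> generators F U f ->
  stein (charts X) U' -> U' p -> U' `<=` Omega -> generators F U' g ->
  [/\ forall b : {poly Cx R}, is_bfunction (image_section N (u p)) b ->
        (exists b' : {poly Cx R}, is_bfunction (image_section N' (u p)) b') /\
        (forall b' : {poly Cx R}, is_bfunction (image_section N' (u p)) b' ->
           b' \Po ('X - e%:R%:P) = b \Po ('X - d%:R%:P)),
      indicial_set N (u p) = indicial_set N' (u p) &
      forall b c : {poly ostalk (charts X) p},
        indicial_set N (u p) b -> (forall i, F p c`_i) -> (size c < size b)%N ->
        indicial_set N (u p) (b + c)].
Proof.
move=> [[Fid _] _] Fproper _ _ _ _ _ _ _ Up _ genf _ U'p _ geng.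
have CA := compatible_charts X.
have [i pi] : exists i, chart_dom (charts X) i p by case: CA.
have [F0 FD FM] := Fid p.
(* From here on only the stalk at [p] counts: the germs of the generators generate [F p], and they
   vanish at [p] because [F p] is proper. *)
have gens k (V : set X) (h : 'I_k -> X -> Cx R) : V p -> generators F V h ->
    ideal_generators (F p) h.
  move=> Vp [h_hol h_gen]; split=> [j|j|a]; first exact: h_hol.
    apply: (proper_ideal_vanish CA pi FM Fproper (h_hol j p Vp)).
    apply/(h_gen p Vp); exists (fun l => (l == j)%:R).
    exact: esym (sum_delta (fun l => germ (charts X) (h l) p) j).
  exact: h_gen.
have Hf := gens _ _ _ Up genf; have Hg := gens _ _ _ U'p geng.
split=> [b||b c].
- exact: (bfunction_transfer CA pi F0 N' Hf Hg).
- apply/seteqP; split; first exact: (indicial_set_sub CA pi F0 N' Hf Hg).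
  exact: (indicial_set_sub CA pi F0 N Hg Hf).
- exact: (indicial_set_ideal CA pi F0 Hf).
Qed.
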